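(* Let $p\geq1$, let $\omega:\mathbb N\to(1,+\infty)$ with $\omega(k)\to+\infty$, and let $\mathbf w=(w_n)_{n\geq1}$ be a bounded sequence of positive real numbers such that $\sum_{n\geq1}(w_1\cdots w_n)^{-p}<+\infty$. Let $B_{\mathbf w}$ be the backward weighted shift on $\ell^p(\mathbb Z_+)$, $B_{\mathbf w}((x_n)_{n\geq0})=(w_{n+1}x_{n+1})_{n\geq0}$. Then there exists a $B_{\mathbf w}$-invariant Borel probability measure $\mu$ on $\ell^p(\mathbb Z_+)$ with full support, with respect to which $B_{\mathbf w}$ is strongly mixing, such that $E_\omega\subset L^2(\ell^p(\mathbb Z_+),\mathcal B,\mu)$. Suppose moreover that there exist $C>0$ and $\alpha>1/2$ with $w_1\cdots w_n\geq Cn^\alpha$ for all $n\geq1$. Then (the measure $\mu$ can be chosen so that) for any $f,g\in E_\omega$ there is $C_{f,g,\alpha}$ with, for all $n\geq1$, $|\mathrm{Cov}(f\circ B_{\mathbf w}^n,g)|\leq C_{f,g,\alpha}n^{1-2\alpha}$ if $\alpha\in(1/2,1)$, $\leq C_{f,g,\alpha}\frac{\log(n+1)}n$ if $\alpha=1$, $\leq C_{f,g,\alpha}n^{-\alpha}$ if $\alpha>1$; and if $\alpha>1$, then for every $f\in E_\omega$ with $\int f\,d\mu=0$, $\frac1{\sqrt n}(f+f\circ B_{\mathbf w}+\dots+f\circ B_{\mathbf w}^{n-1})$ converges in distribution to a Gaussian random variable with zero mean and finite variance.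
   Context: For a Banach space $X$, $E_\omega$ denotes the set of functions $f:X\to\mathbb R$ which are infinitely (Fréchet) differentiable at $0$, satisfy $f(x)=\sum_{\kappa=0}^{\infty}\frac{D^\kappa f(0)}{\kappa!}(x,\dots,x)$ for all $x\in X$, and satisfy $\sup_{\kappa\geq0}\|D^\kappa f(0)\|\,\omega(\kappa)^\kappa<+\infty$. $T$-invariant: $\mu(T^{-1}A)=\mu(A)$; full support: $\mu(U)>0$ for nonempty open $U$; strongly mixing: $\mu(A\cap T^{-n}B)\to\mu(A)\mu(B)$ for Borel $A,B$. $\mathrm{Cov}(f,g)=\int fg\,d\mu-\int f\,d\mu\int g\,d\mu$. *)

(* Defs.v *)
From HB Require Import structures.
From mathcomp Require Import all_boot all_order all_algebra.
From mathcomp Require Import all_classical all_reals all_analysis.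
Set Implicit Arguments. Unset Strict Implicit. Unset Printing Implicit Defensive.
Import Order.TTheory GRing.Theory Num.Theory.
Import numFieldNormedType.Exports.
Local Open Scope classical_set_scope.
Local Open Scope ring_scope.

Section lp_space.
Context {R : realType}.

Definition lp_mem (p : R) (x : nat -> R) : Prop :=
  (\sum_(k <oo) (`|x k| `^ p)%:E < +oo)%E.

Definition lp_norm (p : R) (x : nat -> R) : R :=
  (fine (\sum_(k <oo) (`|x k| `^ p)%:E)%E) `^ p^-1.

Definition lpT (p : R) (p1 : 1 <= p) := {x : nat -> R | lp_mem p x}.

Lemma lp_mem0 (p : R) : 1 <= p -> lp_mem p (fun _ => 0).
Proof.
move=> p1; rewrite /lp_mem eseries0 ?ltry// => i _ _.
by rewrite normr0 powR0 // gt_eqF // (lt_le_trans ltr01 p1).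
Qed.

Section instances.
Variables (p : R) (p1 : 1 <= p).
Definition lp0 : lpT p1 := exist _ (fun _ => 0) (lp_mem0 p1).
HB.instance Definition _ := gen_eqMixin (lpT p1).
HB.instance Definition _ := gen_choiceMixin (lpT p1).
HB.instance Definition _ := isPointed.Build (lpT p1) lp0.

Definition lpn (x : lpT p1) : R := lp_norm p (proj1_sig x).

Definition lp_open (U : set (lpT p1)) : Prop :=
  forall x, U x -> exists2 e : R, 0 < e &
    forall y : lpT p1, lp_norm p (proj1_sig y \- proj1_sig x) < e -> U y.

Definition lp_borel := g_sigma_algebraType lp_open.

(** the backward weighted shift  B_w (x_n)_n = (w_{n+1} x_{n+1})_n
    (the default value lp0 is never used when w is bounded) *)
Definition bshift (w : nat -> R) (x : nat -> R) : nat -> R :=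
  fun n => w n.+1 * x n.+1.

Definition Bw (w : nat -> R) (x : lp_borel) : lp_borel :=
  match pselect (lp_mem p (bshift w (proj1_sig x))) with
  | left h => exist _ (bshift w (proj1_sig x)) h
  | right _ => lp0
  end.

Definition tset (k : nat) (t : k.-tuple (lpT p1)) (i : 'I_k) (y : lpT p1) :=
  [tuple (if j == i then y else tnth t j) | j < k].

Definition in_unit_balls (k : nat) (t : k.-tuple (lpT p1)) : Prop :=
  forall i, lpn (tnth t i) <= 1.

Definition bounded_multilinear (k : nat) (M : k.-tuple (lpT p1) -> R) : Prop :=
  (forall (i : 'I_k) (t : k.-tuple (lpT p1)) (a : R) (u v z : lpT p1),
     proj1_sig z = (fun n => a * proj1_sig u n + proj1_sig v n) ->
     M (tset t i z) = a * M (tset t i u) + M (tset t i v)) /\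
  (exists C : R, forall t, in_unit_balls t -> `|M t| <= C).

(** D is the family of iterated Frechet derivatives of f, and f is
    infinitely Frechet differentiable at 0: D 0 = f, and for every k,
    on a neighbourhood of 0, D k x is a bounded k-linear form and D k is
    Frechet differentiable at x (for the operator norm of k-linear forms),
    with derivative D (k+1) x, i.e.
    D (k+1) x (v, h_1, ..., h_k) = (D(D^k f)(x) v)(h_1, ..., h_k). *)
Definition frechet_derivs (f : lpT p1 -> R)
    (D : forall k : nat, lpT p1 -> k.-tuple (lpT p1) -> R) : Prop :=
  (forall x t, D 0%N x t = f x) /\
  forall k : nat, exists2 r : R, 0 < r & forall x : lpT p1, lpn x < r ->
    bounded_multilinear (D k x) /\ bounded_multilinear (D k.+1 x) /\
    forall e : R, 0 < e -> exists2 d : R, 0 < d &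
      forall v y : lpT p1,
        proj1_sig y = (fun n => proj1_sig x n + proj1_sig v n) ->
        lpn v < d ->
        forall t : k.-tuple (lpT p1), in_unit_balls t ->
          `|D k y t - D k x t - D k.+1 x (cons_tuple v t)| <= e * lpn v.

Definition E_omega (omega : nat -> R) (f : lpT p1 -> R) : Prop :=
  exists D, frechet_derivs f D /\
    (forall x : lpT p1,
       (fun n => \sum_(k < n) D k lp0 (nseq_tuple k x) / (k`!)%:R)
         @ \oo --> f x) /\
    (exists M : R, forall (k : nat) (t : k.-tuple (lpT p1)),
       in_unit_balls t -> `|D k lp0 t| * omega k ^+ k <= M).

End instances.

(** expectation of phi under the centered Gaussian law of standard
    deviation s (s = 0: the Dirac mass at 0) *)
Definition gauss_expect (s : R) (phi : R -> R) : R :=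
  if s == 0 then phi 0
  else fine (\int[normal_prob 0 s]_x (phi x)%:E)%E.

Definition cov_rate (alpha : R) (n : nat) : R :=
  if alpha < 1 then n%:R `^ (1 - 2 * alpha)
  else if alpha == 1 then ln (n.+1)%:R / n%:R
  else n%:R `^ (- alpha).

End lp_space.
Arguments lp0 {R p} p1.
Arguments lpn {R p} p1 x.
Arguments lp_open {R p} p1 U.
Arguments lp_borel {R p} p1.
Arguments Bw {R p} p1 w x.
Arguments E_omega {R p} p1 omega f.

(* Main.v *)
(** Choose i.i.d. real variables y_n whose law gives mass to every nonempty open set and has
    E exp(A |y|^p) finite for every A, and let mu be the law of x_n = y_n / (w_1 ... w_n) in l^p.
    In the coordinates y the operator B_w is the one-sided Bernoulli shift, which gives invariance
    and strong mixing; full support comes from controlling finitely many y_n and making the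
    independent tail small.

    Since omega tends to infinity, a function of E_omega is Lipschitz on balls with a constant
    growing at most like exp(||x||^p + ||y||^p), up to a factor.  To bound Cov(f o B_w^n, g), take
    two independent copies of x and exchange their y-coordinates one at a time: exchanging the
    coordinate n + k moves the arguments of f o B_w^n and g by multiples of 1/W_k and 1/W_(n+k), where
    W_n = w_1 ... w_n, so the covariance is bounded by a multiple of sum_k 1/(W_k W_(n+k)).

    For the central limit theorem, f o B_w^n is approximated by functions of finitely many y_k, the
    resulting m-dependent sum is cut into independent blocks, and these are replaced by Gaussians
    one at a time (Lindeberg), against test functions smoothed by a Gaussian convolution. *)
Require Import Defs.
From HB Require Import structures.
From mathcomp Require Import all_boot all_order all_algebra.
From mathcomp Require Import all_classical all_reals all_analysis.
From mathcomp Require Import measurable_realfun zify lra ring.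
Import Order.TTheory GRing.Theory Num.Theory.
Import numFieldNormedType.Exports.
Local Open Scope classical_set_scope.
Local Open Scope ring_scope.

(** * Sequence spaces *)

(** All growth is measured by [Zp x], that is ||x||^p = sum_n W_n^-p |y_n|^p, and [expR (12 * Zp x)]
    must be integrable. Jensen's inequality with the weights W_n^-p / Wsum reduces this to E exp(12
    Wsum |y_0|^p), hence the moment level A = 12 Wsum. The 12 comes from the exchange of
    coordinates: the growth factors of f, of g and of the squared increment of y multiply to the
    exponential of twice a sum of six values of [Zp].

    If s exchanges one coordinate between the copies and takes g to h, then E f(g - h) is half of E
    (f - f o s)(g - h). This second increment is what yields 1/(W_k W_(n+k)) and not just 1/W_(n+k).

    Independence is used through splicing: taking the coordinates in J from the second copy and the
    others from the first gives a point of law mu again.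

    In the limit theorem a truncation error must be small in L2 after summation over n terms. One
    bound on its autocovariances is small but not summable in the lag, the other summable but not
    small; they are combined by cutting at a lag N fixed before the truncation level. *)

Lemma cvg_le_bound {R : realType} (u : nat -> R) (l M : R) :
  u @ \oo --> l -> (forall n, u n <= M) -> l <= M.
Proof.
move=> ul uM; rewrite -(cvg_lim (@Rhausdorff R) ul).
by apply: limr_le; [apply/cvg_ex; exists l|exact: nearW].
Qed.

Section lp_facts.
Context {R : realType}.
Variables (p : R) (p1 : 1 <= p).
Implicit Types (x y : nat -> R).

Definition psum x : \bar R := \sum_(k <oo) (`|x k| `^ p)%:E.

Let p_gt0 : 0 < p. Proof. exact: lt_le_trans ltr01 p1. Qed.
Let p_neq0 : p != 0. Proof. by rewrite gt_eqF. Qed.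

Lemma psum_ge0 x : (0 <= psum x)%E.
Proof. by apply: nneseries_ge0 => n _ _; rewrite lee_fin powR_ge0. Qed.

Lemma psum_fin x : lp_mem p x -> psum x \is a fin_num.
Proof. by move=> h; rewrite ge0_fin_numE// psum_ge0. Qed.

Lemma psum_fineK x : lp_mem p x -> (fine (psum x))%:E = psum x.
Proof. by move=> h; rewrite fineK// psum_fin. Qed.

Lemma psum_le x y : (forall n, `|x n| <= `|y n|) -> (psum x <= psum y)%E.
Proof.
move=> xy; apply: lee_nneseries => [i _ _|i _]; first by rewrite lee_fin powR_ge0.
by rewrite lee_fin; apply: ge0_ler_powR => //; [exact: ltW|rewrite nnegrE..].
Qed.

Lemma psumZ a x : psum (fun n => a * x n) = ((`|a| `^ p)%:E * psum x)%E.
Proof.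
rewrite /psum -nneseriesZl; last by move=> i _; rewrite lee_fin powR_ge0.
by apply: eq_eseriesr => i _; rewrite normrM powRM// EFinM.
Qed.

(** The larger modulus is at least half of |a| + |b|. The crude constant 2^p suffices, since this
    inequality stands in for Minkowski's. *)
Lemma powR_normD (a b : R) : `|a + b| `^ p <= 2 `^ p * (`|a| `^ p + `|b| `^ p).
Proof.
wlog ab : a b / `|a| <= `|b| => [hw|].
  have [/hw//|/ltW/hw] := leP `|a| `|b|; by rewrite addrC (addrC (_ `^ p)).
have -> : 2 `^ p * (`|a| `^ p + `|b| `^ p) =
  (2 * `|b|) `^ p + 2 `^ p * `|a| `^ p by rewrite powRM//; ring.
apply: (@le_trans _ _ ((2 * `|b|) `^ p)); last first.
  by rewrite lerDl mulr_ge0 ?powR_ge0.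
apply: ge0_ler_powR; rewrite ?nnegrE ?mulr_ge0//; first exact: ltW.
by rewrite (le_trans (ler_normD _ _))// mulr_natl mulr2n lerD2r.
Qed.

Lemma psumD x y :
  (psum (fun n => x n + y n)%R <= (2 `^ p)%:E * (psum x + psum y))%E.
Proof.
rewrite /psum -nneseriesD => [|i _ _|i _ _]; rewrite ?lee_fin ?powR_ge0//.
rewrite -nneseriesZl => [|i _]; last by rewrite adde_ge0 ?lee_fin ?powR_ge0.
apply: lee_nneseries => [i _ _|i _]; first by rewrite lee_fin powR_ge0.
by rewrite -EFinD -EFinM lee_fin powR_normD.
Qed.

Lemma lp_mem_le x y : (forall n, `|x n| <= `|y n|) -> lp_mem p y -> lp_mem p x.
Proof. by move=> xy; apply: le_lt_trans; exact: psum_le. Qed.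

Lemma lp_memD x y : lp_mem p x -> lp_mem p y -> lp_mem p (fun n => x n + y n).
Proof.
move=> hx hy; apply: le_lt_trans (psumD x y) _.
by rewrite -(psum_fineK _ hx) -(psum_fineK _ hy) -EFinD -EFinM ltry.
Qed.

Lemma lp_memZ a x : lp_mem p x -> lp_mem p (fun n => a * x n).
Proof.
by move=> hx; rewrite /lp_mem -/(psum _) psumZ -psum_fineK// -EFinM ltry.
Qed.

Lemma lp_memB x y : lp_mem p x -> lp_mem p y -> lp_mem p (x \- y).
Proof.
move=> hx hy; have := lp_memD _ _ hx (lp_memZ (-1) _ hy).
by congr lp_mem; apply/funext => n; rewrite mulN1r.
Qed.

Lemma psum_fin_supp x N : (forall n, (N <= n)%N -> x n = 0) ->
  psum x = (\sum_(k < N) `|x k| `^ p)%:E.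
Proof.
move=> h; rewrite /psum (@nneseries_split _ _ 0%N N); last first.
  by move=> k _; rewrite lee_fin powR_ge0.
rewrite add0n [X in (_ + X)%E]eseries0 ?adde0 ?big_mkord ?sumEFin//.
by move=> i Ni _; rewrite h// normr0 powR0.
Qed.

Lemma lp_mem_fin_supp x N : (forall n, (N <= n)%N -> x n = 0) -> lp_mem p x.
Proof. by move=> h; rewrite /lp_mem -/(psum _) (psum_fin_supp _ _ h) ltry. Qed.

Lemma psum_single k a : psum (fun n => if n == k then a else 0) = (`|a| `^ p)%:E.
Proof.
rewrite (psum_fin_supp _ k.+1) => [|n]; last by case: eqP => // ->; rewrite ltnn.
rewrite (bigD1 (@Ordinal k.+1 k (ltnSn k)))//= eqxx big1 ?addr0// => i.
by rewrite -val_eqE/= => /negbTE ->; rewrite normr0 powR0.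
Qed.

Lemma lp_norm_ge0 x : 0 <= lp_norm p x. Proof. exact: powR_ge0. Qed.

Lemma lp_norm_powR x : lp_norm p x `^ p = fine (psum x).
Proof. by rewrite /lp_norm -powRrM mulVf// powRr1// fine_ge0// psum_ge0. Qed.

Lemma powR_norm_inv a : 0 <= a -> (a `^ p) `^ p^-1 = a.
Proof. by move=> a0; rewrite -powRrM divff// powRr1. Qed.

Lemma lp_normZ (a : R) x : lp_norm p (fun n => a * x n) = `|a| * lp_norm p x.
Proof.
rewrite /lp_norm -!/(psum _) psumZ.
have [hx|hx] := pselect (lp_mem p x).
  rewrite -psum_fineK// -EFinM/= powRM ?powR_ge0 ?fine_ge0 ?psum_ge0//.
  by rewrite powR_norm_inv.
(* Outside l^p the norm is [fine +oo], that is 0, and both sides vanish. *)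
have -> : psum x = +oo%E.
  by apply/eqP; rewrite -leye_eq leNgt; apply/negP => h; exact: hx.
rewrite /= powR0 ?invr_neq0// mulr0.
have [->|a0] := eqVneq (`|a| `^ p) 0; first by rewrite mul0e/= powR0 ?invr_neq0.
by rewrite gt0_muley ?lte_fin ?lt_neqAle 1?eq_sym ?a0 ?powR_ge0//= powR0 ?invr_neq0.
Qed.

Lemma lp_norm_single k a : lp_norm p (fun n => if n == k then a else 0) = `|a|.
Proof. by rewrite /lp_norm -/(psum _) psum_single/= powR_norm_inv. Qed.

Lemma lp_norm0 : lp_norm p (fun=> 0 : R) = 0.
Proof.
rewrite -[RHS](normr0 R) -(lp_norm_single 0 0); congr lp_norm.
by apply/funext => n; case: eqP.
Qed.

Lemma lp_norm_le x y : lp_mem p y -> (forall n, `|x n| <= `|y n|) ->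
  lp_norm p x <= lp_norm p y.
Proof.
move=> hy xy; rewrite /lp_norm -!/(psum _); apply: ge0_ler_powR.
- by rewrite invr_ge0 ltW.
- by rewrite nnegrE fine_ge0// psum_ge0.
- by rewrite nnegrE fine_ge0// psum_ge0.
- by apply: fine_le; [exact/psum_fin/(lp_mem_le _ _ xy)|exact: psum_fin|exact: psum_le].
Qed.

Lemma lp_norm_eq x y : (forall n, `|x n| = `|y n|) -> lp_norm p x = lp_norm p y.
Proof.
by move=> xy; rewrite /lp_norm; congr (fine _ `^ _);
  apply: eq_eseriesr => i _; rewrite xy. Qed.

Lemma lp_norm_lt x (e : R) : 0 <= e -> lp_mem p x ->
  lp_norm p x < e <-> fine (psum x) < e `^ p.
Proof.
move=> e0 hx; split => h.
  by rewrite -lp_norm_powR gt0_ltr_powR ?nnegrE ?lp_norm_ge0.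
rewrite -[e]powR_norm_inv// /lp_norm gt0_ltr_powR ?invr_gt0 ?nnegrE//.
  by rewrite fine_ge0// psum_ge0.
exact: powR_ge0.
Qed.

Lemma lp_norm_le1D x : lp_norm p x <= 1 + fine (psum x).
Proof.
rewrite -lp_norm_powR; have [h|/ltW h] := leP (lp_norm p x) 1.
  by rewrite ler_wpDr ?powR_ge0.
by rewrite ler_wpDl// le1r_powR.
Qed.

Lemma lp_normB x y : lp_norm p (x \- y) = lp_norm p (y \- x).
Proof. by apply: lp_norm_eq => n; rewrite /= distrC. Qed.

(** A triangle inequality with a margin: 2^p ((e/4)^p + (e/4)^p) <= 2^p 2^p (e/4)^p = e^p, because 2
    <= 2^p. *)
Lemma lp_normD_lt x y (e : R) : 0 < e -> lp_mem p x -> lp_mem p y ->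
  lp_norm p x < e / 4 -> lp_norm p y < e / 4 ->
  lp_norm p (fun n => x n + y n) < e.
Proof.
move=> e0 hx hy; have e4 : 0 <= e / 4 by rewrite divr_ge0 ?ltW.
have hxy : lp_mem p (fun n => x n + y n) by exact: lp_memD.
move=> /(lp_norm_lt x _ e4 hx) xe /(lp_norm_lt y _ e4 hy) ye.
apply/(lp_norm_lt _ _ (ltW e0) hxy); rewrite -lte_fin psum_fineK//.
apply: le_lt_trans (psumD x y) _.
rewrite -(psum_fineK x hx) -(psum_fineK y hy) -EFinD -EFinM lte_fin.
apply: (@lt_le_trans _ _ (2 `^ p * ((e / 4) `^ p + (e / 4) `^ p))).
  by rewrite ltr_pM2l ?powR_gt0// ltrD.
have -> : (e / 4) `^ p + (e / 4) `^ p = 2 * (e / 4) `^ p by ring.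
apply: (@le_trans _ _ (2 `^ p * (2 `^ p * (e / 4) `^ p))).
  by rewrite ler_pM2l ?powR_gt0// ler_wpM2r ?powR_ge0// le1r_powR// ler1n.
have {2}-> : e = 2 * (2 * (e / 4)) by field.
by rewrite !powRM ?mulr_ge0 ?invr_ge0 ?(ltW e0).
Qed.

Lemma psum_tail_cvg0 x : lp_mem p x ->
  psum (fun n => if (n < N)%N then 0 else x n) @[N --> \oo] --> 0%E.
Proof.
move=> hx; have := @nneseries_tail_cvg R (fun k => (`|x k| `^ p)%:E) xpredT hx.
move=> /(_ (fun k _ => powR_ge0 _ _)); apply: cvg_trans; apply: near_eq_cvg.
near=> N; rewrite /psum [RHS](@nneseries_split _ _ 0%N N); last first.
  by move=> k _; rewrite lee_fin powR_ge0.
rewrite add0n big_nat_cond big1 ?add0e => [|i]; last first.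
  by rewrite andbT => /= iN; rewrite iN normr0 powR0.
rewrite -[LHS]nneseries_addn => [|i]; last by rewrite lee_fin powR_ge0.
rewrite -[RHS]nneseries_addn => [|i]; last by rewrite lee_fin powR_ge0.
by apply: eq_eseriesr => i _; rewrite ltnNge leq_addl.
Unshelve. all: by end_near. Qed.

Lemma fine_psum_tail_cvg0 x : lp_mem p x ->
  fine (psum (fun n => if (n < N)%N then 0 else x n)) @[N --> \oo] --> (0 : R).
Proof. by move=> hx; apply: fine_cvg; exact: psum_tail_cvg0. Qed.

(** A total constructor with the default [lp0], so that maps into l^p can be written without
    carrying membership proofs. *)
Definition lpmk x : lpT p1 :=
  match pselect (lp_mem p x) with left h => exist _ x h | right _ => lp0 p1 end.

Lemma lpmkE x : lp_mem p x -> proj1_sig (lpmk x) = x.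
Proof. by move=> h; rewrite /lpmk; case: pselect. Qed.

Lemma lp_ext (x y : lpT p1) : proj1_sig x = proj1_sig y -> x = y.
Proof.
case: x y => [x hx] [y hy] /= xy; move: hx; rewrite xy => hx.
by congr exist; exact: Prop_irrelevance.
Qed.

Lemma lpT_mem (x : lpT p1) : lp_mem p (proj1_sig x).
Proof. by case: x. Qed.

End lp_facts.

Lemma measurable_normpow {R : realType} d (T : measurableType d) (g : T -> R) p :
  measurable_fun setT g -> measurable_fun setT (fun t => `|g t| `^ p).
Proof. by move=> mg; apply: (measurableT_comp (measurable_powR p)); exact: measurableT_comp. Qed.

Lemma measurable_exp_normpow {R : realType} d (T : measurableType d) (g : T -> R) A p :
  measurable_fun setT g -> measurable_fun setT (fun t => expR (A * `|g t| `^ p)).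
Proof.
move=> mg; apply: (measurableT_comp (@measurable_expR R)).
by apply: measurable_funM => //; exact: measurable_normpow.
Qed.

(** * Measurability in l^p through coordinates *)

Section lp_measurability.
Context {R : realType}.
Variables (p : R) (p1 : 1 <= p).
Local Notation S := (lp_borel p1).

Let p_gt0 : 0 < p. Proof. exact: lt_le_trans ltr01 p1. Qed.

Lemma lp_open_measurable (U : set S) : lp_open p1 U -> measurable U.
Proof. by move=> oU; exact: sub_gen_smallest. Qed.

Lemma lp_continuous_measurable (f : S -> R) :
  (forall x (e : R), 0 < e -> exists2 d : R, 0 < d & forall y : S,
     lp_norm p (proj1_sig y \- proj1_sig x) < d -> `|f y - f x| < e) ->
  measurable_fun setT f.
Proof.
move=> cf; apply: (measurability _ (RGenOInfty.measurableE R)) => _ [_ [a ->] <-].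
rewrite setTI; apply: lp_open_measurable => x /=.
rewrite in_itv/= andbT => afx.
have [|d d0 hd] := cf x (f x - a); first by rewrite subr_gt0.
exists d => // y /hd; rewrite in_itv/= andbT => /ltr_normlP[h _].
by lra.
Qed.

Lemma coord_le_norm (x : nat -> R) n : lp_mem p x -> `|x n| <= lp_norm p x.
Proof.
move=> hx; rewrite -(lp_norm_single p p1 n (x n)); apply: lp_norm_le => // k.
by case: eqP => [->//|_]; rewrite normr0.
Qed.

Lemma measurable_coord n : measurable_fun setT (fun x : S => proj1_sig x n).
Proof.
apply: lp_continuous_measurable => x e e0; exists e => // y; apply: le_lt_trans.
exact: (coord_le_norm _ n (lp_memB _ p1 _ _ (lpT_mem _ _ y) (lpT_mem _ _ x))).
Qed.

Definition ratseq (s : seq rat) : nat -> R := fun n => ratr (nth 0%Q s n).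

Lemma ratseq_mem s : lp_mem p (ratseq s).
Proof.
apply: (lp_mem_fin_supp _ p1 _ (size s)) => n sn.
by rewrite /ratseq nth_default// rmorph0.
Qed.

(** The tail beyond N is small by summability, and the first N coordinates are approximated by
    rationals. *)
Lemma ratseq_dense (x : nat -> R) (e : R) : lp_mem p x -> 0 < e ->
  exists s, lp_norm p (x \- ratseq s) < e.
Proof.
move=> hx e0; have e40 : 0 < e / 4 by rewrite divr_gt0.
have /cvgrPdist_lt/(_ ((e / 4) `^ p)) := fine_psum_tail_cvg0 _ p1 _ hx.
rewrite powR_gt0// => /(_ isT)[N _ /(_ N (leqnn N))].
rewrite sub0r normrN ger0_norm ?fine_ge0 ?psum_ge0// => tailN.
have Ng0 : 0 < (N.+1)%:R :> R by rewrite ltr0n.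
(* Dividing by N+1 itself is enough: N (N+1)^-p < (N+1)^(1-p) <= 1. *)
pose eta := e / 4 / N.+1%:R.
have eta0 : 0 < eta by rewrite divr_gt0.
have dr (i : nat) : exists r : rat, `|x i - ratr r| < eta.
  have [|r] := @rat_in_itvoo R (x i - eta) (x i + eta); first by lra.
  by rewrite in_itv/= => /andP[h1 h2]; exists r; rewrite ltr_norml; apply/andP; split; lra.
have [r hr] := choice dr.
exists (mkseq r N).
pose y n := if (n < N)%N then x n - ratr (r n) else 0.
pose z n := if (n < N)%N then 0 else x n.
have -> : x \- ratseq (mkseq r N) = (fun n => y n + z n).
  apply/funext => n /=; rewrite /ratseq /y /z; case: ltnP => nN.
    by rewrite nth_mkseq// addr0.
  by rewrite nth_default ?size_mkseq// rmorph0 subr0 add0r.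
have hy0 n : (N <= n)%N -> y n = 0 by rewrite /y leqNgt => /negbTE ->.
have hy : lp_mem p y by exact: (lp_mem_fin_supp _ p1 _ N).
have hz : lp_mem p z.
  by apply: lp_mem_le hx => // n; rewrite /z; case: ifP; rewrite ?normr0.
apply: (lp_normD_lt p p1) => //.
- apply/(lp_norm_lt _ p1 _ _ (ltW e40) hy).
  rewrite (psum_fin_supp p p1 _ N hy0)/=.
  apply: (@le_lt_trans _ _ (\sum_(k < N) eta `^ p)).
    apply: ler_sum => i _; rewrite /y ltn_ord; apply: ge0_ler_powR.
    - exact: ltW.
    - by rewrite nnegrE.
    - by rewrite nnegrE ltW.
    - exact: ltW.
  rewrite sumr_const card_ord -[X in X < _]mulr_natl /eta powRM; [|exact: ltW|by rewrite invr_ge0].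
  rewrite mulrCA gtr_pMr ?powR_gt0//.
  apply: (@lt_le_trans _ _ (N.+1%:R * N.+1%:R^-1 `^ p)).
    by rewrite ltr_pM2r ?powR_gt0 ?invr_gt0// ltr_nat.
  rewrite -[N.+1%:R^-1]powR_inv1// -powRrM mulN1r powRN -ler_pdivlMl ?invr_gt0//.
    by rewrite mulr1 lef_pV2 ?posrE ?powR_gt0//; apply: le1r_powR; rewrite ?ler1n.
- by apply/(lp_norm_lt _ p1 _ _ (ltW e40) hz).
Qed.

Lemma measurable_psum d (T : measurableType d) (g : T -> nat -> R) :
  (forall n, measurable_fun setT (fun t => g t n)) ->
  measurable_fun setT (fun t => psum p (g t) : \bar R).
Proof.
move=> mg; apply: ge0_emeasurable_sum => [k x _ _|k _].
  by rewrite lee_fin powR_ge0.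
apply/measurable_EFinP; apply: (measurableT_comp (measurable_powR p)).
exact: measurableT_comp.
Qed.

Lemma measurable_lp_norm d (T : measurableType d) (g : T -> nat -> R) :
  (forall n, measurable_fun setT (fun t => g t n)) ->
  measurable_fun setT (fun t => lp_norm p (g t)).
Proof.
move=> mg; apply: (measurableT_comp (measurable_powR _)).
exact: (measurableT_comp (@fine_measurable R setT measurableT) (measurable_psum _ _ _ mg)).
Qed.

(** The coordinates generate the Borel sets: by separability an open set is a countable union of
    balls centred at rational sequences, and the norm is a measurable function of the
    coordinates. *)
Lemma measurable_lp d (T : measurableType d) (g : T -> S) :
  (forall n, measurable_fun setT (fun t => proj1_sig (g t) n)) ->
  measurable_fun setT g.
Proof.
move=> mg; apply: (measurability (lp_open p1 : set (set S)) erefl) => _ [U oU <-].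
rewrite setTI.
pose B (z : seq rat * nat) : set S :=
  [set x | lp_norm p (proj1_sig x \- ratseq z.1) < z.2.+1%:R^-1].
(* Balls are indexed by [nat] through [unpickle]; codes of balls not contained in U contribute the
   empty set. *)
pose V i := if (unpickle i : option (seq rat * nat)) is Some z then
  if `[< B z `<=` U >] then g @^-1` B z else set0 else set0.
have -> : g @^-1` U = \bigcup_i V i.
  apply/seteqP; split => [t /= Ut|t [i _]]; last first.
    by rewrite /V; case: unpickle => // z; case: asboolP => // h /h.
  have [e e0 eU] := oU _ Ut.
  have e40 : 0 < e / 4 by rewrite divr_gt0.
  have [k _ /(_ k (leqnn k)) hk] := near_infty_natSinv_lt (PosNum e40).
  have k0 : 0 < k.+1%:R^-1 :> R by rewrite invr_gt0 ltr0n.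
  have [s hs] := ratseq_dense (proj1_sig (g t)) _ (lpT_mem p p1 (g t)) k0.
  exists (pickle (s, k)) => //; rewrite /V pickleK.
  case: asboolP => [_//|[]] y /= By; apply: eU.
  have -> : proj1_sig y \- proj1_sig (g t) =
    (fun n => (proj1_sig y \- ratseq s) n + (ratseq s \- proj1_sig (g t)) n).
    by apply/funext => n /=; rewrite addrA subrK.
  apply: (lp_normD_lt p p1) => //.
  - by apply: lp_memB => //; [exact: lpT_mem|exact: ratseq_mem].
  - by apply: lp_memB => //; [exact: ratseq_mem|exact: lpT_mem].
  - exact: lt_trans By hk.
  - by rewrite lp_normB; exact: lt_trans hs hk.
apply: bigcupT_measurable => i; rewrite /V; case: unpickle => // z.
case: ifP => // _; rewrite /B -[X in measurable X]setTI.
have : measurable_fun setT (fun t => lp_norm p (proj1_sig (g t) \- ratseq z.1)).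
  by apply: measurable_lp_norm => n; exact: measurable_funB.
move=> /(_ measurableT `]-oo, z.2.+1%:R^-1[%classic (measurable_itv _)).
by congr measurable; apply/seteqP; split => t /=; rewrite in_itv.
Qed.

Lemma measurable_lpmk d (T : measurableType d) (g : T -> nat -> R) :
  (forall n, measurable_fun setT (fun t => g t n)) ->
  measurable_fun setT (fun t => lpmk p p1 (g t) : S).
Proof.
move=> mg; apply: measurable_lp => n.
have -> : (fun t => proj1_sig (lpmk p p1 (g t)) n) =
    (fun t => if `[< (psum p (g t) < +oo)%E >] then g t n else 0).
  by apply/funext => t; rewrite /lpmk; case: pselect => h; case: asboolP.
apply: measurable_fun_ifT => //=.
apply: (measurable_fun_bool true).
have := measurable_psum _ _ _ mg measurableT `[-oo%E, +oo%E[%classic (emeasurable_itv `[-oo%E, +oo%E[).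
by rewrite !setTI; congr measurable; apply/seteqP; split => t /=;
  rewrite in_itv/= leNye/=; [move=> ->; exact: asboolT|move=> /asboolP].
Qed.

End lp_measurability.

(** * Lipschitz bounds for power series on l^p *)

Section E_omega_lipschitz.
Context {R : realType}.
Variables (p : R) (p1 : 1 <= p).
Local Notation X := (lpT p1).

Let p_gt0 : 0 < p. Proof. exact: lt_le_trans ltr01 p1. Qed.

Definition lpscale (a : R) (x : X) : X := lpmk p p1 (fun n => a * proj1_sig x n).

Lemma lpscaleE a x : proj1_sig (lpscale a x) = (fun n => a * proj1_sig x n).
Proof. by rewrite lpmkE//; apply: lp_memZ => //; exact: lpT_mem. Qed.

Section multilinear.
Variables (k : nat) (M : k.-tuple X -> R) (C : R).
Hypothesis linM : forall (i : 'I_k) (t : k.-tuple X) (a : R) (u v z : X),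
  proj1_sig z = (fun n => a * proj1_sig u n + proj1_sig v n) ->
  M (tset t i z) = a * M (tset t i u) + M (tset t i v).
Hypothesis bndM : forall t, in_unit_balls t -> `|M t| <= C.

Let scaleM i t a u : M (tset t i (lpscale a u)) = a * M (tset t i u).
Proof.
have h0 : M (tset t i (lp0 p1)) = 0.
  have := linM i t 1 (lp0 p1) (lp0 p1) (lp0 p1).
  rewrite mul1r => h; have {h} := h _; move=> h; apply: (@addrI _ (M (tset t i (lp0 p1)))).
  by rewrite addr0 -h//; apply/funext => n /=; rewrite mulr0 addr0.
rewrite (linM i t a u (lp0 p1)) ?h0 ?addr0// lpscaleE.
by apply/funext => n /=; rewrite addr0.
Qed.

(** Interpolates between the constant tuples of v and of u. Consecutive tuples differ in one slot,
    where linearity applies. *)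
Let hyb (u v : X) (j : nat) : k.-tuple X := [tuple (if (i < j)%N then u else v) | i < k].

Let hyb0 u v : hyb u v 0 = nseq_tuple k v.
Proof. by apply: eq_from_tnth => i; rewrite tnth_mktuple tnth_nseq. Qed.

Let hybk u v : hyb u v k = nseq_tuple k u.
Proof. by apply: eq_from_tnth => i; rewrite tnth_mktuple tnth_nseq ltn_ord. Qed.

Let hyb_setl u v (j : 'I_k) : hyb u v j.+1 = tset (hyb u v j) j u.
Proof.
apply: eq_from_tnth => i; rewrite !tnth_mktuple -val_eqE/= ltnS leq_eqVlt.
by case: eqP.
Qed.

Let hyb_setr u v (j : 'I_k) : hyb u v j = tset (hyb u v j) j v.
Proof.
apply: eq_from_tnth => i; rewrite !tnth_mktuple -val_eqE/=.
by case: eqP => // ->; rewrite ltnn.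
Qed.

Let homM a x : M (nseq_tuple k (lpscale a x)) = a ^+ k * M (nseq_tuple k x).
Proof.
pose m j := M (hyb (lpscale a x) x j).
have mS j : (j < k)%N -> m j.+1 = a * m j.
  move=> jk; rewrite /m; have -> := hyb_setl (lpscale a x) x (Ordinal jk).
  by rewrite scaleM; have /= <- := hyb_setr (lpscale a x) x (Ordinal jk).
have -> : M (nseq_tuple k (lpscale a x)) = m k by rewrite /m hybk.
have -> : M (nseq_tuple k x) = m 0%N by rewrite /m hyb0.
move: mS; move: m => m mS; elim: k mS => [_|j ih mS]; first by rewrite mul1r.
by rewrite mS// exprS -mulrA ih// => i ij; rewrite mS// ltnW.
Qed.

Let unit_bnd x y : lpn p1 x <= 1 -> lpn p1 y <= 1 ->
  `|M (nseq_tuple k x) - M (nseq_tuple k y)| <=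
  k%:R * (lp_norm p (proj1_sig x \- proj1_sig y) * C).
Proof.
move=> x1 y1; set d := lp_norm p _.
have hxy : lp_mem p (proj1_sig x \- proj1_sig y).
  by apply: lp_memB => //; exact: lpT_mem.
have -> : M (nseq_tuple k x) - M (nseq_tuple k y) = M (hyb x y k) - M (hyb x y 0).
  by rewrite hybk hyb0.
have step (j : 'I_k) : `|M (hyb x y j.+1) - M (hyb x y j)| <= d * C.
  rewrite hyb_setl {2}hyb_setr.
  have [d0|d0] := eqVneq d 0.
    have -> : x = y.
      apply: lp_ext; apply/funext => n; apply/eqP; rewrite -subr_eq0 -normr_le0 -d0.
      exact: (coord_le_norm p p1 _ n hxy).
    by rewrite subrr normr0 d0 mul0r.
  have dp : 0 < d by rewrite lt_neqAle eq_sym d0 lp_norm_ge0.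
  (* The normalised difference (x - y)/d lies in the unit ball, so the boundedness hypothesis
     applies to it and linearity gives back the factor d. *)
  pose v := lpscale d^-1 (lpmk p p1 (proj1_sig x \- proj1_sig y)).
  have vE : proj1_sig v = fun n => d^-1 * (proj1_sig x n - proj1_sig y n).
    by rewrite lpscaleE lpmkE.
  have v1 : lpn p1 v <= 1.
    suff -> : lpn p1 v = d^-1 * d by rewrite mulVf.
    by rewrite /lpn vE lp_normZ// ger0_norm// invr_ge0 ltW.
  rewrite (linM j _ d v y) ?addrK; last first.
    by rewrite vE; apply/funext => n; rewrite mulrA divff// mul1r subrK.
  rewrite normrM (gtr0_norm dp) ler_pM2l//; apply: bndM => i.
  rewrite tnth_mktuple; case: ifP => _; first exact: v1.
  by rewrite tnth_mktuple; case: ifP => _; [exact: x1|exact: y1].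
have -> : M (hyb x y k) - M (hyb x y 0) =
    \sum_(0 <= j < k) (M (hyb x y j.+1) - M (hyb x y j)).
  by rewrite (telescope_sumr (fun j => M (hyb x y j)))//.
rewrite big_mkord.
apply: le_trans (ler_norm_sum _ _ _) _.
apply: (@le_trans _ _ (\sum_(j < k) d * C)); first exact: ler_sum.
by rewrite sumr_const card_ord mulr_natl.
Qed.

(** Division by r = ||x|| + ||y|| brings both points into the unit ball. Homogeneity restores r^k
    and the distance loses one factor r, which leaves r^(k-1); r = 0 is treated apart. *)
Lemma multilinear_diag_lipschitz x y :
  `|M (nseq_tuple k x) - M (nseq_tuple k y)| <=
  k%:R * (lpn p1 x + lpn p1 y) ^+ k.-1 *
    (lp_norm p (proj1_sig x \- proj1_sig y) * C).
Proof.
set r := lpn p1 x + lpn p1 y.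
have [r0|r0] := eqVneq r 0.
  have zero z : lpn p1 z <= 0 -> proj1_sig z = fun=> 0.
    move=> z0; apply/funext => n; apply/eqP; rewrite -normr_le0.
    by apply: le_trans z0; exact: (coord_le_norm p p1 _ n (lpT_mem _ _ z)).
  have xy : x = y.
    apply: lp_ext; rewrite !zero//.
      by rewrite -r0 lerDr lp_norm_ge0.
    by rewrite -r0 lerDl lp_norm_ge0.
  rewrite xy subrr normr0.
  have -> : proj1_sig y \- proj1_sig y = (fun n => 0 * proj1_sig y n).
    by apply/funext => n /=; rewrite subrr mul0r.
  by rewrite lp_normZ// normr0 !mul0r mulr0.
have rp : 0 < r by rewrite lt_neqAle eq_sym r0 addr_ge0 ?lp_norm_ge0.
have sc z : z = lpscale r (lpscale r^-1 z).
  apply: lp_ext; rewrite !lpscaleE; apply/funext => n.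
  by rewrite mulrA divff// mul1r.
have hom z : M (nseq_tuple k z) = r ^+ k * M (nseq_tuple k (lpscale r^-1 z)).
  by rewrite -homM -sc.
rewrite (hom x) (hom y) -mulrBr normrM ger0_norm ?exprn_ge0 ?(ltW rp)//.
have n1 z : lpn p1 z <= r -> lpn p1 (lpscale r^-1 z) <= 1.
  move=> zr; rewrite /lpn lpscaleE lp_normZ// ger0_norm ?invr_ge0 ?(ltW rp)//.
  by rewrite ler_pdivrMl// mulr1.
have /n1 x1 : lpn p1 x <= r by rewrite lerDl lp_norm_ge0.
have /n1 y1 : lpn p1 y <= r by rewrite lerDr lp_norm_ge0.
apply: le_trans (ler_wpM2l _ (unit_bnd _ _ x1 y1)) _; first by rewrite exprn_ge0 ?(ltW rp).
rewrite !lpscaleE.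
have -> : lp_norm p ((fun n => r^-1 * proj1_sig x n) \- (fun n => r^-1 * proj1_sig y n)) =
    r^-1 * lp_norm p (proj1_sig x \- proj1_sig y).
  have := lp_normZ p p1 r^-1 (proj1_sig x \- proj1_sig y).
  have rin : `|r^-1| = r^-1 by rewrite ger0_norm// invr_ge0 ltW.
  rewrite rin => <-.
  by congr (lp_norm p); apply/funext => n /=; rewrite mulrBr.
set D := lp_norm p _.
have e : r ^+ k * r^-1 * k%:R = k%:R * r ^+ k.-1.
  by case: (k) => [|m]; rewrite ?mulr0n ?mulr0 ?mul0r// exprS/=; field.
have -> : r ^+ k * (k%:R * (r^-1 * D * C)) = (r ^+ k * r^-1 * k%:R) * (D * C) by ring.
by rewrite e.
Qed.

End multilinear.

Lemma exp_partial_le (r : R) n : 0 <= r -> \sum_(k < n) r ^+ k / k`!%:R <= expR r.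
Proof.
move=> r0; rewrite -(big_mkord xpredT (fun k => r ^+ k / k`!%:R)).
have := @nondecreasing_cvgn_le R (series (exp_coeff r)) _ (is_cvg_series_exp_coeff r) n.
apply; apply: nondecreasing_series => i _ _; exact: exp_coeff_ge0.
Qed.

(** As [omega k] exceeds 1, one M bounds all derivatives at 0 in norm. The terms k r^(k-1) M d / k!
    then sum to at most M d exp(r), where r = ||x|| + ||y||. *)
Lemma E_omega_lipschitz omega (f : X -> R) : (forall k, 1 < omega k) ->
  E_omega p1 omega f ->
  exists2 K, 0 <= K & forall x y, `|f x - f y| <=
    K * expR (lpn p1 x + lpn p1 y) * lp_norm p (proj1_sig x \- proj1_sig y).
Proof.
move=> om1 [D [[_ hD] [cvgD [M hM]]]].
have bnd k t : in_unit_balls t -> `|D k (lp0 p1) t| <= M.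
  move=> /hM; apply: le_trans; rewrite ler_peMr// exprn_ege1// ltW//; exact: om1.
have M0 : 0 <= M.
  apply: le_trans (bnd 0%N [tuple] _) => //; by case.
exists M => // x y; set r := lpn p1 x + lpn p1 y; set d := lp_norm p _.
have r0 : 0 <= r by rewrite addr_ge0 ?lp_norm_ge0.
have d0 : 0 <= d by rewrite lp_norm_ge0.
have lin k : bounded_multilinear (D k (lp0 p1)).
  have [e e0 /(_ (lp0 p1))] := hD k.
  rewrite /lpn /= => h; suff /h[] : lp_norm p (fun=> 0 : R) < e by [].
  by rewrite lp_norm0.
have cv : (fun n => `|\sum_(k < n) D k (lp0 p1) (nseq_tuple k x) / (k`!)%:R -
    \sum_(k < n) D k (lp0 p1) (nseq_tuple k y) / (k`!)%:R|) @ \oo --> `|f x - f y|.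
  by apply: cvg_norm; apply: cvgB; exact: cvgD.
apply: (cvg_le_bound _ _ _ cv) => n; rewrite -sumrB.
apply: le_trans (ler_norm_sum _ _ _) _.
apply: (@le_trans _ _ (\sum_(k < n) (k%:R * r ^+ k.-1 * (d * M)) / k`!%:R)).
  apply: ler_sum => k _; rewrite -mulrBl normrM [X in _ * X]ger0_norm ?invr_ge0//.
  rewrite ler_wpM2r ?invr_ge0//; apply: multilinear_diag_lipschitz; last exact: bnd.
  exact: (proj1 (lin k)).
case: n => [|n]; first by rewrite big_ord0 !mulr_ge0 ?expR_ge0.
rewrite big_ord_recl/= mulr0n !mul0r add0r.
have -> : \sum_(i < n) (lift ord0 i)%:R * r ^+ (lift ord0 i).-1 * (d * M) / (lift ord0 i)`!%:R =
    (\sum_(k < n) r ^+ k / k`!%:R) * (d * M).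
  rewrite mulr_suml; apply: eq_bigr => k _; rewrite lift0/= factS natrM.
  have k0 : k.+1%:R != 0 :> R by rewrite pnatr_eq0.
  have f0 : k`!%:R != 0 :> R by rewrite pnatr_eq0 -lt0n fact_gt0.
  move: k0 f0; move: (k.+1%:R : R) (k`!%:R : R) => a b a0 b0.
  by field; rewrite a0 b0.
have -> : M * expR r * d = expR r * (d * M) by ring.
by rewrite ler_wpM2r ?mulr_ge0//; exact: exp_partial_le.
Qed.

End E_omega_lipschitz.

(** * I.i.d. coordinates *)

Section affine_lebesgue.
Context {R : realType}.
Local Notation leb := (@lebesgue_measure R).
Local Notation RR := (measurableTypeR R).
Variables (s t : R).
Hypothesis s0 : 0 < s.

Definition affine_map (u : RR) : RR := s * u + t.

Lemma measurable_affine_map : measurable_fun setT affine_map.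
Proof. by apply: measurable_funD => //; exact: measurable_funM. Qed.

(** Lebesgue measure is determined by half-open intervals, on which s times the push-forward has the
    right value. *)
Lemma lebesgue_measure_affine (C : set RR) : measurable C ->
  leb (affine_map @^-1` C) = (s^-1%:E * leb C)%E.
Proof.
move=> mC; have sn : 0 <= s by exact: ltW.
have eqm X : ocitv X -> leb X = mscale (NngNum sn) (pushforward leb affine_map) X.
  move=> [[a b] _ <-]/=; rewrite /mscale/= /pushforward.
  have -> : affine_map @^-1` `]a, b]%classic = `](a - t) / s, (b - t) / s]%classic.
    apply/seteqP; split => u /=; rewrite !in_itv/= /affine_map;
      rewrite ltr_pdivrMr// ler_pdivlMr// ltrBlDr lerBrDr mulrC//.
  rewrite !lebesgue_measure_itv/= !lte_fin ltr_pM2r ?invr_gt0// ltrD2r.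
  case: ifP => _; last by rewrite mule0.
  by rewrite -!EFinD -EFinM; congr EFin; field; rewrite gt_eqF.
have := lebesgue_measure_unique (eqm measurable_affine_map) mC.
rewrite /mscale/= /pushforward => ->.
by rewrite muleA -EFinM mulVf ?gt_eqF// mul1e.
Qed.

Lemma ge0_integral_affine (f : R -> \bar R) : measurable_fun setT f ->
  (forall x, 0 <= f x)%E ->
  (\int[leb]_x f (s * x + t)%R = s^-1%:E * \int[leb]_x f x)%E.
Proof.
move=> mf f0; have sn : 0 <= s^-1 by rewrite invr_ge0 ltW.
rewrite -[s^-1]/((NngNum sn)%:num) -ge0_integral_mscale//.
have H := ge0_integral_pushforward measurable_affine_map leb measurableT mf
  (fun x _ => f0 x).
transitivity (\int[leb]_(x in affine_map @^-1` setT) (f \o affine_map) x)%E => //.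
rewrite -H; apply: eq_measure_integral; first exact: measurable_affine_map.
move=> mphi A mA _.
exact (lebesgue_measure_affine A mA).
Qed.

End affine_lebesgue.

(** * Independent geometric digits of a point of ]0, 1] *)

Section iid_digits.
Context {R : realType}.
Local Notation leb := (@lebesgue_measure R).
Local Notation RR := (measurableTypeR R).
Local Notation D := (`]0, 1]%classic : set RR).

Let pw (a : nat) : R := 2^-1 ^+ a.
Let pw_gt0 a : 0 < pw a. Proof. by rewrite exprn_gt0// invr_gt0. Qed.
Let pwS a : pw a.+1 = pw a / 2. Proof. by rewrite /pw exprS mulrC. Qed.
Let pw_le a b : (a <= b)%N -> pw b <= pw a.
Proof. by move=> ab; rewrite /pw ler_wiXn2l// ?invr_ge0// invf_le1// ler1n. Qed.

(** The intervals ]2^-(a+1), 2^-a] partition ]0, 1], and [T] maps each of them affinely onto ]0, 1].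
    Under Lebesgue measure the digit [dg u] is therefore independent of [T u], which is again
    uniform, and the digits along the orbit of u are i.i.d. geometric. *)
Let I (a : nat) : set RR := `]pw a.+1, pw a]%classic.
Let dg (u : RR) : nat := xget 0%N [set a | I a u].
Let T (u : RR) : RR := (pw (dg u).+1)^-1 * u + (-1).

Let I_D a : I a `<=` D.
Proof.
move=> u; rewrite /I/= !in_itv/= => /andP[h1 h2]; rewrite (lt_trans _ h1)//=.
by apply: (le_trans h2); have := pw_le 0 a (leq0n a); rewrite {2}/pw expr0.
Qed.

Let I_inj a b u : I a u -> I b u -> a = b.
Proof.
wlog ab : a b / (a <= b)%N => [hw ha hb|].
  by have [/hw|/ltnW/hw h] := leqP a b; [apply|exact/esym/h].
rewrite /I /= !in_itv/= => /andP[a1 a2] /andP[b1 b2].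
apply/eqP; rewrite eqn_leq ab leqNgt; apply/negP => /(pw_le a.+1).
by move/(le_trans b2) => h; move: a1; rewrite ltNge h.
Qed.

Let I_dg a u : I a u -> dg u = a.
Proof.
move=> Iu; apply: (I_inj (dg u) a u _ Iu).
by apply: (@xgetPex _ 0%N [set a | I a u]); exists a.
Qed.

Let D_I u : D u -> I (dg u) u.
Proof.
rewrite /= in_itv/= => /andP[u0 u1]; apply: (@xgetPex _ 0%N [set a | I a u]).
have : exists n, pw n < u.
  have /cvgrPdist_lt/(_ u u0)[N _ /(_ N (leqnn N))] : pw n @[n --> \oo] --> 0.
    by apply: cvg_expr; rewrite ger0_norm ?invr_ge0// invf_lt1// ltr1n.
  by rewrite sub0r normrN ger0_norm ?ltW// => h; exists N.
move=> /ex_minnP[[|n] hn hmin]; first by move: hn; rewrite /pw expr0 ltNge u1.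
exists n; rewrite /I /= in_itv/= hn/= leNgt; apply/negP => /hmin.
by rewrite ltnn.
Qed.

Let T_D u : D u -> D (T u).
Proof.
move=> /D_I; rewrite /I /T /= !in_itv/= => /andP[h1 h2].
rewrite subr_gt0 -ltr_pdivrMl ?invr_gt0// invrK mulr1 h1/=.
rewrite lerBlDr ler_pdivrMl// (le_trans h2)// pwS; have := pw_gt0 (dg u); lra.
Qed.

Let mI a : measurable (I a). Proof. exact: measurable_itv. Qed.
Let mD : measurable D. Proof. exact: measurable_itv. Qed.

(** Off ]0, 1] the digit takes the default 0. Preimages under [dg] and [T] thus need one extra
    piece, supplied by [measurable_split]. *)
Let dg_out u : ~ D u -> dg u = 0%N.
Proof. by move=> nD; rewrite /dg xgetPN// => a /I_D. Qed.

Let measurable_split (A : nat -> set RR) (A' : set RR) :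
  (forall a, measurable (A a)) -> measurable A' ->
  measurable ((\bigcup_a (I a `&` A a)) `|` (~` D `&` A')).
Proof.
move=> mA mA'; apply: measurableU; last by apply: measurableI => //; exact: measurableC.
by apply: bigcupT_measurable => a; exact: measurableI.
Qed.

Let mdg (B : set nat) : measurable (dg @^-1` B).
Proof.
have -> : dg @^-1` B = (\bigcup_a (I a `&` [set _ | B a])) `|` (~` D `&` [set _ | B 0%N]).
  apply/seteqP; split => [u /= Bu|u].
    have [Du|nD] := pselect (D u); last by right; split => //=; rewrite -(dg_out u nD).
    by left; exists (dg u) => //; split => //; exact: D_I.
  move=> [[a _ [/I_dg <-]]//|[nD]]/=; by rewrite dg_out.
have mc P : measurable [set _ : RR | P].
  by have [h|h] := pselect P; [rewrite (_ : [set _ | _] = setT)|rewrite (_ : [set _ | _] = set0)];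
  try exact: measurableT; try exact: measurable0; apply/seteqP; split.
exact: measurable_split.
Qed.

Let mT : measurable_fun setT T.
Proof.
move=> _ C mC; rewrite setTI.
have -> : T @^-1` C = (\bigcup_a (I a `&` (affine_map (pw a.+1)^-1 (-1)) @^-1` C))
    `|` (~` D `&` (affine_map (pw 1)^-1 (-1)) @^-1` C).
  apply/seteqP; split => [u /= Cu|u].
    have [Du|nD] := pselect (D u).
      by left; exists (dg u) => //; split => //; exact: D_I.
    by right; split => //=; move: Cu; rewrite /T dg_out.
  move=> [[a _ [/I_dg e]]|[nD]]/=; rewrite /T ?e//; by rewrite dg_out.
have ma s : measurable ((affine_map s (-1) : RR -> RR) @^-1` C).
  by rewrite -[X in measurable X]setTI; exact: measurable_affine_map.
by apply: measurable_split.
Qed.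

Let P0 (A : set RR) : \bar R := mrestr leb mD A.

Let cyl1 a C : measurable C ->
  P0 ([set u | dg u = a] `&` T @^-1` C) = ((pw a.+1)%:E * P0 C)%E.
Proof.
move=> mC; rewrite /P0 /mrestr.
have -> : [set u | dg u = a] `&` T @^-1` C `&` D =
    (affine_map (pw a.+1)^-1 (-1)) @^-1` (C `&` D).
  apply/seteqP; split => [u [[/= da Cu] Du]|u [/= Cu]].
    by have := T_D u Du; rewrite /affine_map /T -da /= in Cu *.
  rewrite /= in_itv/= /affine_map => /andP[h1 h2].
  have Iu : I a u.
    rewrite /I/= in_itv/=; apply/andP; split.
      by move: h1; rewrite subr_gt0 -ltr_pdivrMl ?invr_gt0// invrK mulr1.
    move: h2; rewrite lerBlDr ler_pdivrMl// => /le_trans; apply.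
    by rewrite pwS; have := pw_gt0 a; lra.
  split; last exact: (I_D _ _ Iu).
  by split => /=; rewrite ?/T (I_dg _ _ Iu).
rewrite lebesgue_measure_affine ?invr_gt0// ?invrK//.
exact: measurableI.
Qed.

(** Summing [cyl1] over the digits in B leaves a factor that does not depend on C; the case C =
    [setT] identifies it as the probability that the digit lies in B. *)
Let cyl B C : measurable C ->
  P0 (dg @^-1` B `&` T @^-1` C) = (P0 (dg @^-1` B) * P0 C)%E.
Proof.
move=> mC.
have key C' : measurable C' -> P0 (dg @^-1` B `&` T @^-1` C') =
   (P0 C' * \sum_(a <oo | a \in B) (pw a.+1)%:E)%E.
  move=> mC'.
  have mTC : measurable (T @^-1` C') by rewrite -[X in measurable X]setTI; exact: mT.
  have -> : dg @^-1` B `&` T @^-1` C' = \bigcup_(a in B) ([set u | dg u = a] `&` T @^-1` C').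
    apply/seteqP; split => [u [Bu Cu]|u [a Ba [/= da Cu]]]; first by exists (dg u).
    by split => //=; rewrite da.
  rewrite [LHS]measure_bigcup/=; last 2 first.
    by move=> a _; apply: measurableI => //; exact: (mdg [set a]).
    by move=> i j _ _ [u [[/= <- _] [/= <- _]]].
  transitivity (\sum_(a <oo | a \in B) (P0 C' * (pw a.+1)%:E)%E)%E.
    by apply: eq_eseriesr => a _; rewrite muleC; exact: cyl1.
  have fP : P0 C' \is a fin_num.
    rewrite ge0_fin_numE//; apply: (@le_lt_trans _ _ (leb D)).
      by apply: le_measure; rewrite ?inE//; exact: measurableI.
    by rewrite lebesgue_measure_itv/= lte_fin ltr01 -EFinB ltry.
  rewrite -(fineK fP) nneseriesZl// => i _; by rewrite lee_fin ltW.
have P0T : P0 setT = 1%E.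
  by rewrite /P0 /mrestr setTI lebesgue_measure_itv/= lte_fin ltr01 oppr0 adde0.
have := key setT measurableT; rewrite preimage_setT setIT P0T mul1e => ->.
by rewrite key// muleC.
Qed.

Let xi n (u : RR) : nat := dg (iter n T u).

(** The first digit is split off: the remaining conditions form the preimage under [T] of an event
    of the same kind. *)
Let indep N : forall (B : nat -> set nat),
  P0 [set u | forall i, (i < N)%N -> B i (xi i u)] =
  (\prod_(i < N) P0 (dg @^-1` (B i)))%E.
Proof.
elim: N => [|N ih] B.
  rewrite big_ord0 (_ : [set _ | _] = setT); last by apply/seteqP; split.
  by rewrite /P0 /mrestr setTI lebesgue_measure_itv/= lte_fin ltr01 oppr0 adde0.
rewrite big_ord_recl -(ih (fun i => B i.+1)) -cyl.
  congr P0; apply/seteqP; split => [u /= h|u [/= h1 h2] [|i] iN]; rewrite /xi.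
  - split => [|i iN]; first exact: (h 0%N).
    by rewrite /xi -iterSr; exact: (h i.+1).
  - exact: h1.
  - by rewrite iterSr; exact: h2.
have -> : [set u | forall i, (i < N)%N -> B i.+1 (xi i u)] =
   \bigcap_(i in [set i | (i < N)%N]) (xi i @^-1` B i.+1).
  by apply/seteqP; split => u h i; exact: h.
apply: bigcap_measurableType => i _.
have mit : measurable_fun setT (iter i T).
  by elim: i => [|i ihi]/=; [exact: measurable_id|exact: measurableT_comp].
rewrite (_ : xi i @^-1` _ = iter i T @^-1` (dg @^-1` B i.+1))//.
by rewrite -[X in measurable X]setTI; apply: mit => //; exact: mdg.
Qed.

Lemma iid_digits_exist : exists (P : probability RR R) (x : nat -> RR -> nat),
  [/\ forall n B, measurable (x n @^-1` B),
      forall n a, P [set u | x n u = a] = (2^-1 ^+ a.+1)%:E &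
      forall N (B : nat -> set nat),
        P [set u | forall i, (i < N)%N -> B i (x i u)] =
        (\prod_(i < N) P (x 0%N @^-1` (B i)))%E].
Proof.
have P0T : P0 setT = 1%E.
  by rewrite /P0 /mrestr setTI lebesgue_measure_itv/= lte_fin ltr01 oppr0 adde0.
pose P : probability RR R :=
  HB.pack (mrestr leb mD) (Measure_isProbability.Build _ _ _ (mrestr leb mD) P0T).
have mx n B : measurable (xi n @^-1` B).
  have mit : measurable_fun setT (iter n T).
    by elim: n => [|i ihi]/=; [exact: measurable_id|exact: measurableT_comp].
  rewrite (_ : xi n @^-1` _ = iter n T @^-1` (dg @^-1` B))//.
  by rewrite -[X in measurable X]setTI; apply: mit => //; exact: mdg.
have dga a : P0 [set u | dg u = a] = (2^-1 ^+ a.+1)%:E.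
  by have := cyl1 a setT measurableT; rewrite preimage_setT setIT P0T mule1.
exists P, xi; split; [exact: mx|move=> n a|exact: indep].
rewrite -[RHS]dga.
(* The law of the n-th digit is read off from independence, with no condition on the other
   digits. *)
pose B i := if i == n then [set a] else [set: nat].
have := indep n.+1 B; rewrite (bigD1 ord_max)//= /B eqxx big1 ?mule1.
  move=> <-; congr P0; apply/seteqP; split => u /=.
    by move=> h i _; case: eqP => // ->.
  by move/(_ n (ltnSn n)); rewrite eqxx.
by move=> i; rewrite -val_eqE/= => /negbTE ->; rewrite preimage_setT.
Qed.

End iid_digits.

(** * A law on l^p with independent rescaled coordinates *)

Section iid_measure.
Context {R : realType}.

Definition Wprod (w : nat -> R) (n : nat) : R := \prod_(i < n) w i.+1.

Lemma powRV (x r : R) : 0 < x -> x^-1 `^ r = x `^ (- r).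
Proof. by move=> x0; rewrite -[x^-1]powR_inv1 ?(ltW x0)// -powRrM mulN1r. Qed.

Lemma inj_nat_unbounded (f : nat -> nat) N : injective f -> exists j, (N <= f j)%N.
Proof.
move=> fi; apply: contrapT => /forallNP h.
have sub : {subset map f (iota 0 N.+1) <= iota 0 N}.
  move=> _ /mapP[j _ ->]; rewrite mem_iota/= add0n ltnNge; apply/negP; exact: h.
have := uniq_leq_size _ sub; rewrite map_inj_uniq// iota_uniq size_map !size_iota.
by move=> /(_ isT); rewrite ltnn.
Qed.

(** Every rational is coded infinitely often, by pairing it with an arbitrary integer, and is
    replaced by 0 while the growth bound forbids it. Slow growth against geometric weights gives the
    exponential moment, density gives the full support. *)
Lemma slow_dense_sequence (p kap : R) : p != 0 -> 0 < kap ->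
  exists q : nat -> R, (forall a, `|q a| `^ p <= kap * a%:R) /\
    forall r e, 0 < e -> exists a, `|q a - r| < e.
Proof.
move=> p0 kap0.
pose q a : R := if (unpickle a : option (rat * nat)) is Some z then
  if `|ratr z.1| `^ p <= kap * a%:R then ratr z.1 else 0 else 0.
have q0 a : `|0 : R| `^ p <= kap * a%:R.
  by rewrite normr0 powR0// mulr_ge0// ltW.
exists q; split => [a|r e e0].
  by rewrite /q; case: unpickle => [z|//]; case: ifP.
have [|t] := @rat_in_itvoo R (r - e) (r + e); first by lra.
rewrite in_itv/= => /andP[t1 t2].
pose N := (Num.truncn (`|ratr t| `^ p / kap)).+1.
have [|j hj] := inj_nat_unbounded (fun j => pickle (t, j)) N.
  by move=> i j /(pcan_inj pickleK)[].
exists (pickle (t, j)); rewrite /q pickleK/= ifT.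
  by rewrite ltr_norml; apply/andP; split; lra.
rewrite mulrC -ler_pdivrMr//; apply: ltW.
apply: (@lt_le_trans _ _ N%:R); last by rewrite ler_nat.
by rewrite truncnS_gt.
Qed.

Lemma probability_ae_eq d (T : measurableType d) (P : probability T R) (G A B : set T) :
  measurable G -> measurable A -> measurable B -> P (~` G) = 0%E ->
  (forall t, G t -> (A t <-> B t)) -> P A = P B.
Proof.
move=> mG mA mB G0.
wlog suff: A B mA mB / (forall t, G t -> (A t <-> B t)) -> (P A <= P B)%E.
  move=> hw AB; apply/eqP; rewrite eq_le !hw// => t Gt; by apply: iff_sym; exact: AB.
move=> AB; apply: (@le_trans _ _ (P (B `|` ~` G))).
  apply: le_measure; rewrite ?inE//; first by apply: measurableU => //; exact: measurableC.
  by move=> t At; have [Gt|] := pselect (G t); [left; exact/(AB _ Gt)|right].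
apply: (le_trans (measureU2 _ mB (measurableC mG))).
by rewrite [X in (_ + X)%E](_ : _ = 0%E)// adde0.
Qed.

Variables (p : R) (p1 : 1 <= p) (w : nat -> R).
Local Notation S := (lp_borel p1).
Local Notation W := (Wprod w).

(** The variables y_i are W_i x_i. As W_0 = 1, y_0 is the coordinate x_0, whose law serves as the
    common law; no auxiliary probability space remains in the definition. *)
Definition iid_law (A : R) (mu : probability S R) : Prop :=
  [/\ forall N (B : nat -> set R), (forall i, measurable (B i)) ->
        mu [set x | forall i, (i < N)%N -> B i (W i * proj1_sig x i)] =
        (\prod_(i < N) mu [set x | B i (proj1_sig x 0%N)])%E,
      (\int[mu]_x (expR (A * `|proj1_sig x 0%N| `^ p))%:E < +oo)%E &
      forall r e : R, 0 < e -> (0 < mu [set x | (`|proj1_sig x 0%N - r| < e)%R])%E].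

Hypothesis w_gt0 : forall n, 0 < w n.+1.
Hypothesis W_sum : (\sum_(n <oo) (W n.+1 `^ (- p))%:E < +oo)%E.

Lemma Wprod_gt0 n : 0 < W n.
Proof. by apply: prodr_gt0 => i _; exact: w_gt0. Qed.

Lemma Wprod0 : W 0 = 1. Proof. by rewrite /Wprod big_ord0. Qed.

Lemma Wprod_sum_lty : (\sum_(n <oo) (W n `^ (- p))%:E < +oo)%E.
Proof.
rewrite (@nneseries_split _ _ 0%N 1); last by move=> k _; rewrite lee_fin powR_ge0.
rewrite add0n big_nat1; apply: lte_add_pinfty; first exact: ltry.
rewrite -nneseries_addn => [|i]; last by rewrite lee_fin powR_ge0.
by under eq_eseriesr => i _ do rewrite addn1.
Qed.

Section digit_integrals.
Variables (d : measure_display) (T : measurableType d) (P : probability T R).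
Variables (x : nat -> T -> nat).
Hypothesis mx : forall n B, measurable (x n @^-1` B).
Hypothesis Px : forall n a, P [set u | x n u = a] = (2^-1 ^+ a.+1)%:E.

Lemma integral_digit (f : nat -> R) n : (forall a, 0 <= f a) ->
  (\int[P]_u (f (x n u))%:E = \sum_(a <oo) (f a * 2^-1 ^+ a.+1)%:E)%E.
Proof.
move=> f0.
have fE u : ((f (x n u))%:E = \sum_(a <oo) (f a)%:E * (\1_(x n @^-1` [set a]) u)%:E)%E.
  rewrite (@nneseriesD1 _ _ (x n u) xpredT)//; last first.
    by move=> k _; rewrite mule_ge0 ?lee_fin.
  rewrite indicE mem_set//= mule1 eseries0 ?adde0// => i _ /= ixu.
  by rewrite indicE memNset ?mule0//= => h; move: ixu; rewrite -h eqxx.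
under eq_integral do rewrite fE.
rewrite integral_nneseries//; last 2 first.
- move=> a; apply/measurable_funeM; apply/measurable_EFinP/measurable_indic; exact: mx.
- by move=> a u _; rewrite mule_ge0 ?lee_fin.
apply: eq_eseriesr => a _.
rewrite ge0_integralZl//; last 2 first.
- by apply/measurable_EFinP/measurable_indic; exact: mx.
- by rewrite lee_fin.
rewrite integral_indic ?setIT ?EFinM -?(Px n a)//; exact: mx.
Qed.

(** Terms at most (3/2)^a against the weights 2^-(a+1): a geometric series of ratio 3/4. *)
Lemma integral_digit_exp_lty (A kap : R) (h : nat -> R) n : 0 < A ->
  (forall a, h a <= kap * a%:R) -> expR (A * kap) <= 3 / 2 ->
  (\int[P]_u (expR (A * h (x n u)))%:E < +oo)%E.
Proof.
move=> A0 hk eA; rewrite (integral_digit (fun a => expR (A * h a))); last first.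
  by move=> a; exact: expR_ge0.
apply: (@le_lt_trans _ _ (\sum_(a <oo) ((2^-1) * (3 / 4) ^+ a)%:E)%E).
  apply: lee_nneseries => [a _ _|a _]; first by rewrite lee_fin mulr_ge0 ?expR_ge0.
  rewrite lee_fin exprS mulrCA ler_wpM2l//.
  have -> : 3 / 4 = (3 / 2) * 2^-1 :> R by field.
  rewrite exprMn ler_wpM2r ?exprn_ge0//.
  apply: (@le_trans _ _ (expR (A * kap) ^+ a)).
    by rewrite -expRM_natr ler_expR -mulrA ler_pM2l.
  by rewrite lerXn2r ?nnegrE ?expR_ge0//; lra.
have -> : (\sum_(a <oo) (2^-1 * (3 / 4) ^+ a)%:E)%E = (2 : R)%:E.
  apply/cvg_lim => //.
  have cg : series (geometric (2^-1 : R) (3 / 4)) @ \oo --> (2 : R).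
    have e2 : 2^-1 / (1 - 3 / 4) = 2 :> R by field.
    by rewrite -[X in _ --> X]e2; apply: cvg_geometric_series; rewrite ger0_norm; lra.
  have pE m : (\sum_(0 <= a < m) (2^-1 * (3 / 4) ^+ a)%:E)%E =
      (series (geometric (2^-1 : R) (3 / 4)) m)%:E by rewrite /series/= -sumEFin.
  rewrite (_ : (fun m => _) = EFin \o series (geometric (2^-1 : R) (3 / 4))); last first.
    by apply/funext => m; exact: pE.
  by apply/fine_cvgP; split; first exact: nearW.
exact: ltry.
Qed.

End digit_integrals.

Lemma iid_law_exists (A : R) : 0 < A -> exists mu, iid_law A mu.
Proof.
move=> A0.
have p0 : p != 0 by rewrite gt_eqF// (lt_le_trans ltr01 p1).
(* The growth rate for which [expR (A * kap)] equals 3/2, below the ratio 2 of the geometric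
   weights. *)
pose kap : R := ln (3 / 2) / A.
have kap0 : 0 < kap by rewrite divr_gt0// ln_gt0//; lra.
have eAk : expR (A * kap) <= 3 / 2.
  by rewrite /kap mulrC divfK ?gt_eqF// lnK// posrE; lra.
have [q [qk qd]] := slow_dense_sequence p kap p0 kap0.
have [P [x [mx Px Pprod]]] := @iid_digits_exist R.
have expfin n := integral_digit_exp_lty _ _ P x mx Px A kap (fun a => `|q a| `^ p) n A0 qk eAk.
pose Y u : nat -> R := fun n => q (x n u) / W n.
have mq n : measurable_fun setT (fun u => q (x n u)).
  by move=> _ B mB; rewrite setTI (_ : _ @^-1` B = x n @^-1` (q @^-1` B)).
have mY n : measurable_fun setT (fun u => Y u n) by exact: measurable_funM.
pose G := [set u | lp_mem p (Y u)].
have mpsum := measurable_psum p _ _ _ mY.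
have mG : measurable G.
  have := mpsum measurableT `[-oo%E, +oo%E[%classic (emeasurable_itv `[-oo%E, +oo%E[).
  by rewrite setTI; congr measurable; apply/seteqP; split => u /=;
    rewrite in_itv/= leNye.
(* Almost surely Y is in l^p, because E sum_n W_n^-p |q(x_n)|^p is finite: At <= exp(At), and all
   digits have the same law, so the exponential moment at index 0 bounds every term. *)
have G0 : P (~` G) = 0%E.
  have : P.-integrable setT (fun u => psum p (Y u)).
    apply/integrableP; split => //.
    under eq_integral do rewrite gee0_abs ?psum_ge0//.
    rewrite /psum integral_nneseries//; last first.
    - by move=> n; apply/measurable_EFinP; exact: measurable_normpow.
    apply: (@le_lt_trans _ _ (\sum_(n <oo) (W n `^ (- p))%:E *
        (A^-1%:E * \int[P]_u (expR (A * `|q (x 0%N u)| `^ p))%:E)))%E.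
      apply: lee_nneseries => [n _ _|n _].
        by apply: integral_ge0 => u _; rewrite lee_fin powR_ge0.
      have -> : (\int[P]_u (expR (A * `|q (x 0%N u)| `^ p))%:E =
                 \int[P]_u (expR (A * `|q (x n u)| `^ p))%:E)%E.
        by rewrite !(integral_digit _ _ P x mx Px (fun a => expR (A * `|q a| `^ p)))// => a;
          exact: expR_ge0.
      rewrite muleA -EFinM.
      have mE : measurable_fun setT (fun u => (expR (A * `|q (x n u)| `^ p))%:E).
        by apply/measurable_EFinP; exact: measurable_exp_normpow.
      rewrite -ge0_integralZl//; last first.
        by rewrite lee_fin mulr_ge0 ?powR_ge0 ?invr_ge0 ?(ltW A0).
      apply: ge0_le_integral => //.
      - by apply/measurable_EFinP; exact: measurable_normpow.
      - exact: measurable_funeM.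
      - move=> u _; rewrite -EFinM lee_fin /Y normrM normfV powRM ?invr_ge0//.
        rewrite (gtr0_norm (Wprod_gt0 n)) powRV//; last exact: Wprod_gt0.
        rewrite mulrC -mulrA ler_wpM2l ?powR_ge0//.
        rewrite ler_pdivlMl//; apply: le_trans (expR_ge1Dx _); lra.
    under eq_eseriesr => n _ do rewrite muleC.
    have fin : (\int[P]_u (expR (A * `|q (x 0%N u)| `^ p))%:E)%E \is a fin_num.
      rewrite ge0_fin_numE; first exact: expfin.
      by apply: integral_ge0 => u _; rewrite lee_fin expR_ge0.
    rewrite -(fineK fin) -EFinM nneseriesZl; last by move=> i _; rewrite lee_fin powR_ge0.
    have fin2 : (\sum_(n <oo) (W n `^ (- p))%:E)%E \is a fin_num.
      rewrite ge0_fin_numE; first exact: Wprod_sum_lty.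
      by apply: nneseries_ge0 => i _ _; rewrite lee_fin powR_ge0.
    by rewrite -(fineK fin2) -EFinM ltry.
  move=> /(integrable_ae measurableT)[N [mN N0 hN]].
  apply/eqP; rewrite -measure_le0 -N0; apply: le_measure; rewrite ?inE//.
    exact: measurableC.
  move=> u nG; apply: hN => /(_ I) hf; apply: nG.
  by move: hf; rewrite ge0_fin_numE ?psum_ge0.
pose X u : S := lpmk p p1 (Y u).
have mX : measurable_fun setT X by exact: measurable_lpmk.
pose X' : {mfun _ >-> S} := HB.pack X (isMeasurableFun.Build _ _ _ _ X mX).
pose mu : probability S R := distribution P X'.
have XG u : G u -> proj1_sig (X u) = Y u by move=> Gu; rewrite lpmkE.
have mupre (V : set S) : mu V = P (X @^-1` V) by [].
have law0 (B : set R) : measurable B -> mu [set z | B (proj1_sig z 0%N)] = P [set u | B (q (x 0%N u))].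
  move=> mB; rewrite mupre; apply: (probability_ae_eq _ _ P G) => //.
  - rewrite -[X in measurable X]setTI.
    exact: (measurableT_comp (measurable_coord p p1 0%N) mX measurableT mB).
  - by rewrite -[X in measurable X]setTI; exact: mq.
  - by move=> u Gu; rewrite /= XG// /Y Wprod0 divr1.
exists mu; split.
- move=> N B mB; rewrite mupre.
  transitivity (P [set u | forall i, (i < N)%N -> (q @^-1` B i) (x i u)]).
    apply: (probability_ae_eq _ _ P G) => //.
    + have -> : X @^-1` [set z | forall i, (i < N)%N -> B i (W i * proj1_sig z i)] =
        \bigcap_(i in [set i | (i < N)%N]) ((fun u => W i * proj1_sig (X u) i) @^-1` B i).
        by apply/seteqP; split => u h i; exact: h.
      apply: bigcap_measurableType => i _; rewrite -[X in measurable X]setTI.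
      apply: measurable_funM => //.
      exact: (measurableT_comp (measurable_coord p p1 i) mX).
    + have -> : [set u | forall i, (i < N)%N -> (q @^-1` B i) (x i u)] =
        \bigcap_(i in [set i | (i < N)%N]) (x i @^-1` (q @^-1` B i)).
        by apply/seteqP; split => u h i; exact: h.
      by apply: bigcap_measurableType => i _; exact: mx.
    + move=> u Gu; rewrite /= XG//.
      by split => h i /h; rewrite /Y mulrC divfK ?gt_eqF ?Wprod_gt0.
  rewrite (Pprod N (fun i => q @^-1` B i)).
  by apply: eq_bigr => i _; rewrite law0.
- have mE : measurable_fun setT (fun z : S => (expR (A * `|proj1_sig z 0%N| `^ p))%:E).
    by apply/measurable_EFinP/measurable_exp_normpow; exact: measurable_coord.
  suff -> : (\int[mu]_z (expR (A * `|proj1_sig z 0%N| `^ p))%:E =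
      \int[P]_u (expR (A * `|q (x 0%N u)| `^ p))%:E)%E by exact: expfin.
  have := @ge0_integral_distribution _ _ _ _ _ P X' _ mE.
  move=> /(_ (fun z => expR_ge0 _)) ->.
  apply: ae_eq_integral => //=.
  + exact: (measurableT_comp mE mX).
  + by apply/measurable_EFinP; exact: measurable_exp_normpow.
  + exists (~` G); split => //; first exact: measurableC.
    by move=> u /= h Gu; apply: h => _; rewrite XG// /Y Wprod0 divr1.
- move=> r e e0; have [a ha] := qd r e e0.
  have mB : measurable [set y : R | `|y - r| < e].
    have -> : [set y : R | `|y - r| < e] = `]r - e, r + e[%classic.
      by apply/seteqP; split => y /=; rewrite in_itv/= -ltr_distl.
    exact: measurable_itv.
  rewrite (law0 _ mB); apply: (@lt_le_trans _ _ (P [set u | x 0%N u = a])).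
    by rewrite Px lte_fin exprn_gt0// invr_gt0.
  apply: le_measure; rewrite ?inE.
  + exact: (mx 0%N [set a]).
  + exact: (mx 0%N [set a | `|q a - r| < e]).
  + by move=> u /= ->.
Qed.

End iid_measure.

Section measure_extensionality.
Context {R : realType}.

Lemma pushforward_probability d d' (T : measurableType d) (T' : measurableType d')
    (P : probability T R) (f : T -> T') : measurable_fun setT f ->
  exists Q : probability T' R, forall A, Q A = P (f @^-1` A).
Proof.
move=> mf; pose f' : {mfun T >-> T'} := HB.pack f (isMeasurableFun.Build _ _ _ _ f mf).
by exists (distribution P f').
Qed.

(** That G generates the sigma-algebra is expressed as measurability of the identity, which on l^p
    can be checked coordinate by coordinate. *)
Lemma probability_unique d (T : measurableType d) (G : set (set T))
    (P Q : probability T R) :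
  setI_closed G -> G setT -> G `<=` measurable ->
  measurable_fun setT (id : g_sigma_algebraType G -> T) ->
  (forall A, G A -> P A = Q A) -> forall A, measurable A -> P A = Q A.
Proof.
move=> GI GT Gm mid PQ A mA; apply: (measure_unique G (fun=> setT)) => //.
- apply/seteqP; split => [B mB|]; last by apply: smallest_sub => //; exact: sigma_algebra_measurable.
  by have := mid measurableT B mB; rewrite setTI.
- by apply/seteqP; split => // t _; exists 0%N.
- by move=> _; apply: (@le_lt_trans _ _ 1%E); [exact: probability_le1|exact: ltry].
Qed.

End measure_extensionality.

(** * Cylinders, splicing and the shift *)

Section cylinders.
Context {R : realType}.
Variables (p : R) (p1 : 1 <= p) (w : nat -> R).
Local Notation S := (lp_borel p1).
Local Notation W := (Wprod w).
Hypothesis w_gt0 : forall n, 0 < w n.+1.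

Definition ycoord (n : nat) (x : S) : R := W n * proj1_sig x n.

Lemma ycoord0 x : ycoord 0 x = proj1_sig x 0%N.
Proof. by rewrite /ycoord Wprod0 mul1r. Qed.

Lemma measurable_ycoord n : measurable_fun setT (ycoord n).
Proof. by apply: measurable_funM => //; exact: measurable_coord. Qed.

Lemma coordE (x : S) n : proj1_sig x n = (W n)^-1 * ycoord n x.
Proof. by rewrite /ycoord mulKf// gt_eqF// Wprod_gt0. Qed.

Lemma ycoord_inj (x y : S) : (forall n, ycoord n x = ycoord n y) -> x = y.
Proof. by move=> h; apply: lp_ext; apply/funext => n; rewrite !coordE h. Qed.

Lemma measurable_lp_ycoord d (T : measurableType d) (g : T -> S) :
  (forall n, measurable_fun setT (fun t => ycoord n (g t))) -> measurable_fun setT g.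
Proof.
move=> mg; apply: measurable_lp => n.
rewrite (_ : (fun t => _) = (fun t => (W n)^-1 * ycoord n (g t))).
  by apply: measurable_funM.
by apply/funext => t; rewrite coordE.
Qed.

Definition cyl N (B : nat -> set R) : set S :=
  [set x | forall i, (i < N)%N -> B i (ycoord i x)].

Lemma measurable_cyl N B : (forall i, measurable (B i)) -> measurable (cyl N B).
Proof.
move=> mB; have -> : cyl N B = \bigcap_(i in [set i | (i < N)%N]) (ycoord i @^-1` B i).
  by apply/seteqP; split => u h i; exact: h.
apply: bigcap_measurableType => i _; rewrite -[X in measurable X]setTI.
exact: measurable_ycoord.
Qed.

Lemma cylI N B N' B' : cyl N B `&` cyl N' B' =
  cyl (maxn N N') (fun i => (if (i < N)%N then B i else setT) `&`
                            (if (i < N')%N then B' i else setT)).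
Proof.
apply/seteqP; split => [x [h h'] i _|x h].
  by split; case: ifP => // iN; [exact: h|exact: h'].
by split => i iN; have [|] := h i; rewrite ?leq_max ?iN ?orbT.
Qed.

Lemma cyl_single k (B : set R) :
  ycoord k @^-1` B = cyl k.+1 (fun i => if i == k then B else setT).
Proof.
apply/seteqP; split => [x Bx i _|x /(_ k (ltnSn k))]; last by rewrite eqxx.
by case: eqP => // ->.
Qed.

Lemma measurable_id_cyl :
  measurable_fun setT
    (id : g_sigma_algebraType [set cyl NB.1 NB.2 | NB in
      [set NB : nat * (nat -> set R) | forall i, measurable (NB.2 i)]] -> S).
Proof.
apply: measurable_lp_ycoord => n _ B mB; rewrite setTI.
apply: sub_gen_smallest; exists (n.+1, fun i => if i == n then B else setT) => /=.
  by move=> i; case: ifP.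
by rewrite -cyl_single.
Qed.

Lemma cyl_unique (P Q : probability S R) :
  (forall N B, (forall i, measurable (B i)) -> P (cyl N B) = Q (cyl N B)) ->
  forall A, measurable A -> P A = Q A.
Proof.
move=> PQ; apply: probability_unique measurable_id_cyl _.
- move=> _ _ [[N B]/= mB <-] [[N' B']/= mB' <-]; rewrite cylI.
  eexists (_, _); last by [].
  by move=> i /=; apply: measurableI; case: ifP.
- by exists (0%N, fun=> setT) => //=; apply/seteqP; split.
- by move=> _ [[N B]/= mB <-]; exact: measurable_cyl.
- by move=> _ [[N B]/= mB <-]; exact: PQ.
Qed.

Definition cyl2 : set (set (S * S)) :=
  [set cyl NB.1 NB.2 `*` cyl NB'.1 NB'.2 | NB in
      [set NB : nat * (nat -> set R) | forall i, measurable (NB.2 i)] &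
      NB' in [set NB : nat * (nat -> set R) | forall i, measurable (NB.2 i)]].

Lemma cyl2_unique (P Q : probability (S * S)%type R) :
  (forall N B N' B', (forall i, measurable (B i)) -> (forall i, measurable (B' i)) ->
    P (cyl N B `*` cyl N' B') = Q (cyl N B `*` cyl N' B')) ->
  forall A, measurable A -> P A = Q A.
Proof.
move=> PQ; apply: (@probability_unique _ _ _ cyl2).
- move=> _ _ [[N B]/= mB [[N' B']/= mB' <-]] [[M C]/= mC [[M' C']/= mC' <-]].
  rewrite -setXI !cylI.
  eexists (_, _); last (eexists (_, _); last by []).
  + by move=> i /=; apply: measurableI; case: ifP.
  + by move=> i /=; apply: measurableI; case: ifP.
- exists (0%N, fun=> setT) => //=; exists (0%N, fun=> setT) => //=.
  by apply/seteqP; split.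
- move=> _ [[N B]/= mB [[N' B']/= mB' <-]].
  by apply: measurableX; exact: measurable_cyl.
- apply/measurable_fun_pairP; split; apply: measurable_lp_ycoord => n _ B mB;
    rewrite setTI; apply: sub_gen_smallest.
  + exists (n.+1, fun i => if i == n then B else setT) => /=.
      by move=> i; case: ifP.
    exists (0%N, fun=> setT) => //=; rewrite -cyl_single.
    by apply/seteqP; split => [z []|z]//=.
  + exists (0%N, fun=> setT) => //=.
    exists (n.+1, fun i => if i == n then B else setT) => /=.
      by move=> i; case: ifP.
    by rewrite -cyl_single; apply/seteqP; split => [z []|z]//=.
- by move=> _ [[N B]/= mB [[N' B']/= mB' <-]]; exact: PQ.
Qed.

(** The splicing operation behind every use of independence: under mu x mu the spliced point has law
    mu for any J ([mix_law]), and a function of coordinates outside J sees only x, one of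
    coordinates in J only y. *)
Definition mix (J : pred nat) (x y : S) : S :=
  lpmk p p1 (fun n => if J n then proj1_sig y n else proj1_sig x n).

Lemma psum_mix (J : pred nat) (x y : nat -> R) :
  (psum p (fun n => if J n then y n else x n) <= psum p x + psum p y)%E.
Proof.
rewrite /psum -nneseriesD; [|by move=> i _ _; rewrite lee_fin powR_ge0..].
apply: lee_nneseries => i _; first by rewrite lee_fin powR_ge0.
by case: ifP => _; rewrite -EFinD lee_fin ?lerDl ?lerDr powR_ge0.
Qed.

Lemma mix_mem (J : pred nat) (x y : S) :
  lp_mem p (fun n => if J n then proj1_sig y n else proj1_sig x n).
Proof.
apply: le_lt_trans (psum_mix _ _ _) _.
by apply: lte_add_pinfty; exact: lpT_mem.
Qed.

Lemma mixE J x y n : proj1_sig (mix J x y) n =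
  if J n then proj1_sig y n else proj1_sig x n.
Proof. by rewrite /mix lpmkE//; exact: mix_mem. Qed.

Lemma ycoord_mix J x y n : ycoord n (mix J x y) = if J n then ycoord n y else ycoord n x.
Proof. by rewrite /ycoord mixE; case: ifP. Qed.

Lemma measurable_mix J d (T : measurableType d) (f g : T -> S) :
  measurable_fun setT f -> measurable_fun setT g ->
  measurable_fun setT (fun t => mix J (f t) (g t)).
Proof.
move=> mf mg; apply: measurable_lp_ycoord => n; under eq_fun do rewrite ycoord_mix.
by case: (J n); apply: (measurableT_comp (measurable_ycoord n)).
Qed.

Variables (A : R) (mu : probability S R).
Hypothesis mu_iid : iid_law p p1 w A mu.

Lemma mu_cyl N B : (forall i, measurable (B i)) ->
  mu (cyl N B) = (\prod_(i < N) mu (ycoord 0 @^-1` B i))%E.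
Proof.
move=> mB; have [/(_ N B mB) + _ _] := mu_iid; rewrite /cyl /ycoord => ->.
apply: eq_bigr => i _; congr (mu _).
by apply/seteqP; split => x /=; rewrite Wprod0 mul1r.
Qed.

(** It is enough to compare products of cylinders, padded with [setT] to a common length. Both sides
    are then products of the same one-dimensional probabilities, those with index in J having
    changed places between the two cylinders. *)
Lemma swap_law J (C : set (S * S)) : measurable C ->
  (mu \x mu)%E [set z | C (mix J z.1 z.2, mix J z.2 z.1)] = (mu \x mu)%E C.
Proof.
have mswap : measurable_fun setT (fun z : S * S => (mix J z.1 z.2, mix J z.2 z.1)).
  by apply: measurable_fun_pair; apply: measurable_mix; [exact: measurable_fst
    |exact: measurable_snd|exact: measurable_snd|exact: measurable_fst].
have [Q QE] := pushforward_probability _ _ _ _ (mu \x mu)%E _ mswap.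
move=> mC; rewrite -[LHS]/((mu \x mu)%E ((fun z : S * S => (mix J z.1 z.2, mix J z.2 z.1)) @^-1` C)).
rewrite -QE; apply: cyl2_unique mC => N B N' B' mB mB'; rewrite QE.
pose E i := if (i < N)%N then B i else setT.
pose E' i := if (i < N')%N then B' i else setT.
have mE i : measurable (E i) by rewrite /E; case: ifP.
have mE' i : measurable (E' i) by rewrite /E'; case: ifP.
pose M := maxn N N'.
have -> : cyl N B = cyl M E.
  apply/seteqP; split => x h i iN; first by rewrite /E; case: ifP => // /h.
  by have := h i; rewrite /E iN; apply; rewrite leq_max iN.
have -> : cyl N' B' = cyl M E'.
  apply/seteqP; split => x h i iN; first by rewrite /E'; case: ifP => // /h.
  by have := h i; rewrite /E' iN; apply; rewrite leq_max iN orbT.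
pose F i := if J i then E' i else E i.
pose F' i := if J i then E i else E' i.
have mF i : measurable (F i) by rewrite /F; case: ifP.
have mF' i : measurable (F' i) by rewrite /F'; case: ifP.
rewrite (_ : _ @^-1` _ = cyl M F `*` cyl M F'); last first.
  apply/seteqP; split => [[x y]/= [h h']|[x y]/= [h h']].
    split => i iM; have := h i iM; have := h' i iM; rewrite /= !ycoord_mix /F /F';
      by case: ifP.
  split => i iM /=; rewrite ycoord_mix; have := h i iM; have := h' i iM;
    by rewrite /F /F'; case: ifP.
transitivity (mu (cyl M F) * mu (cyl M F'))%E.
  by apply: product_measure1E; exact: measurable_cyl.
transitivity (mu (cyl M E) * mu (cyl M E'))%E; last first.
  by apply/esym; apply: product_measure1E; exact: measurable_cyl.
rewrite !mu_cyl// -!big_split/=; apply: eq_bigr => i _.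
by rewrite /F /F'; case: ifP => // _; rewrite muleC.
Qed.

(** The first marginal of [swap_law]. *)
Lemma mix_law J (C : set S) : measurable C ->
  (mu \x mu)%E [set z | C (mix J z.1 z.2)] = mu C.
Proof.
move=> mC.
have -> : [set z | C (mix J z.1 z.2)] =
    [set z : S * S | (C `*` setT) (mix J z.1 z.2, mix J z.2 z.1)].
  by apply/seteqP; split => z /= => [|[]].
rewrite swap_law; last exact: measurableX.
transitivity (mu C * mu setT)%E; first exact: product_measure1E.
by rewrite probability_setT mule1.
Qed.

Hypothesis w_bnd : exists M, forall n, w n.+1 <= M.
Local Notation T := (Bw p1 w).

Lemma bshift_mem (x : S) : lp_mem p (bshift w (proj1_sig x)).
Proof.
have [M wM] := w_bnd.
have h0 : lp_mem p (fun n => proj1_sig x n.+1).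
  have := lpT_mem p p1 x; rewrite /lp_mem.
  rewrite (@nneseries_split _ _ 0%N 1); last by move=> k _; rewrite lee_fin powR_ge0.
  rewrite add0n -nneseries_addn => [|i]; last by rewrite lee_fin powR_ge0.
  under [X in (_ + X < _)%E -> _]eq_eseriesr => i _ do rewrite addn1.
  by apply: le_lt_trans; rewrite leeDr// big_nat1 lee_fin powR_ge0.
apply: lp_mem_le (lp_memZ p M _ h0) => // n.
rewrite /bshift !normrM ler_wpM2r// (gtr0_norm (w_gt0 n)).
exact: le_trans (wM n) (ler_norm _).
Qed.

Lemma BwE (x : S) : proj1_sig (T x) = bshift w (proj1_sig x).
Proof. by rewrite /Bw; case: pselect => // h; exfalso; exact/h/bshift_mem. Qed.

Lemma ycoord_Bw n (x : S) : ycoord n (T x) = ycoord n.+1 x.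
Proof. by rewrite /ycoord BwE /bshift mulrA /Wprod big_ord_recr. Qed.

Lemma ycoord_iterBw m n (x : S) : ycoord n (iter m T x) = ycoord (m + n) x.
Proof.
elim: m n => [//|m ih] n; by rewrite iterS ycoord_Bw ih addnS addSn.
Qed.

Lemma measurable_Bw : measurable_fun setT T.
Proof.
apply: measurable_lp_ycoord => n; under eq_fun do rewrite ycoord_Bw.
exact: measurable_ycoord.
Qed.

Lemma measurable_iterBw n : measurable_fun setT (iter n T).
Proof.
apply: measurable_lp_ycoord => k; under eq_fun do rewrite ycoord_iterBw.
exact: measurable_ycoord.
Qed.

Lemma Bw_invariant (C : set S) : measurable C -> mu (T @^-1` C) = mu C.
Proof.
have [Q QE] := pushforward_probability _ _ _ _ mu _ measurable_Bw.
move=> mC; rewrite -QE; apply: cyl_unique mC => N B mB; rewrite QE.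
rewrite (_ : _ @^-1` _ = cyl N.+1 (fun i => if i is j.+1 then B j else setT)).
  rewrite !mu_cyl//; last by case.
  by rewrite big_ord_recl/= preimage_setT probability_setT mul1e.
apply/seteqP; split => [x /= h [|i]//= iN|x /= h i iN].
  by have := h i iN; rewrite ycoord_Bw.
by rewrite ycoord_Bw; exact: (h i.+1).
Qed.

Lemma iterBw_invariant n (C : set S) : measurable C -> mu (iter n T @^-1` C) = mu C.
Proof.
elim: n C => [//|n ih] C mC.
rewrite (_ : _ @^-1` _ = iter n T @^-1` (T @^-1` C))//.
rewrite ih ?Bw_invariant//.
by rewrite -[X in measurable X]setTI; exact: measurable_Bw.
Qed.

Lemma iterBw_mix n (J : pred nat) (x y : S) :
  iter n T (mix J x y) = mix (fun i => J (n + i)%N) (iter n T x) (iter n T y).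
Proof.
by apply: ycoord_inj => k; rewrite !ycoord_iterBw !ycoord_mix !ycoord_iterBw.
Qed.

End cylinders.

(** * Expectations *)

Section expectation.
Context {R : realType} {d : measure_display} {T : measurableType d}.
Variable P : probability T R.
Implicit Types (f g : T -> R).

Definition rint f : Prop := P.-integrable setT (EFin \o f).
Definition Ex f : R := \int[P]_x f x.

Lemma rint_meas f : rint f -> measurable_fun setT f.
Proof. by move=> /measurable_int/measurable_EFinP. Qed.

Lemma rint_le f g : measurable_fun setT f -> rint g -> (forall x, `|f x| <= g x) -> rint f.
Proof.
move=> mf ig fg; apply: le_integrable ig => //; first exact/measurable_EFinP.
by move=> x _ /=; rewrite lee_fin (le_trans (fg x))// ler_norm.
Qed.

Lemma rint_cst (c : R) : rint (fun=> c).
Proof. exact: finite_measure_integrable_cst. Qed.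

Lemma rint_bounded f (M : R) : measurable_fun setT f -> (forall x, `|f x| <= M) -> rint f.
Proof. by move=> mf fM; apply: rint_le (rint_cst M) _. Qed.

Lemma rintD f g : rint f -> rint g -> rint (fun x => f x + g x).
Proof. by move=> hf hg; exact: (integrableD measurableT hf hg). Qed.

Lemma rintB f g : rint f -> rint g -> rint (fun x => f x - g x).
Proof. by move=> hf hg; exact: (integrableB measurableT hf hg). Qed.

Lemma rintZ (c : R) f : rint f -> rint (fun x => c * f x).
Proof. by move=> hf; exact: (integrableZl measurableT c hf). Qed.

Lemma rint_norm f : rint f -> rint (fun x => `|f x|).
Proof. by move=> hf; exact: (integrable_norm hf). Qed.

Lemma rint_sum (I : Type) (r : seq I) (Q : pred I) (F : I -> T -> R) :
  (forall i, rint (F i)) -> rint (fun x => \sum_(i <- r | Q i) F i x).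
Proof.
move=> iF; elim: r => [|i r ih].
  by under [X in rint X]eq_fun do rewrite big_nil; exact: rint_cst.
under [X in rint X]eq_fun do rewrite big_cons.
by case: (Q i); [exact: rintD|].
Qed.

Lemma Ex_EFin f : rint f -> (Ex f)%:E = (\int[P]_x (f x)%:E)%E.
Proof. by move=> hf; rewrite /Ex /Rintegral fineK//; exact: integrable_fin_num hf. Qed.

Lemma Ex_cst (c : R) : Ex (fun=> c) = c.
Proof.
rewrite /Ex Rintegral_cst// [X in fine X](_ : _ = 1%E) ?mulr1//.
exact: probability_setT.
Qed.

Lemma ExD f g : rint f -> rint g -> Ex (fun x => f x + g x) = Ex f + Ex g.
Proof. by move=> hf hg; exact: RintegralD. Qed.

Lemma ExB f g : rint f -> rint g -> Ex (fun x => f x - g x) = Ex f - Ex g.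
Proof. by move=> hf hg; exact: RintegralB. Qed.

Lemma ExZ (c : R) f : rint f -> Ex (fun x => c * f x) = c * Ex f.
Proof. by move=> hf; exact: RintegralZl. Qed.

Lemma Ex_sum (I : Type) (r : seq I) (Q : pred I) (F : I -> T -> R) :
  (forall i, rint (F i)) ->
  Ex (fun x => \sum_(i <- r | Q i) F i x) = \sum_(i <- r | Q i) Ex (F i).
Proof.
move=> iF; elim: r => [|i r ih].
  by rewrite big_nil; under [X in Ex X]eq_fun do rewrite big_nil; exact: Ex_cst.
rewrite big_cons; under [X in Ex X]eq_fun do rewrite big_cons.
by case: (Q i) => //; rewrite ExD// ?ih//; exact: rint_sum.
Qed.

Lemma Ex_ge0 f : (forall x, 0 <= f x) -> 0 <= Ex f.
Proof. by move=> f0; apply: Rintegral_ge0. Qed.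

Lemma Ex_le f g : rint f -> rint g -> (forall x, f x <= g x) -> Ex f <= Ex g.
Proof. by move=> hf hg fg; apply: le_Rintegral. Qed.

Lemma Ex_norm_le f : rint f -> `|Ex f| <= Ex (fun x => `|f x|).
Proof. by move=> hf; apply: le_normr_Rintegral. Qed.

Lemma Ex_norm_le_bound f (M : R) : rint f -> (forall x, `|f x| <= M) -> `|Ex f| <= M.
Proof.
move=> hf fM; apply: (le_trans (Ex_norm_le _ hf)).
by rewrite -[leRHS]Ex_cst; apply: Ex_le => //; [exact: rint_norm|exact: rint_cst].
Qed.

Lemma Ex_dominated (F : nat -> T -> R) f g : (forall n, measurable_fun setT (F n)) ->
  measurable_fun setT f -> (forall x, F n x @[n --> \oo] --> f x) -> rint g ->
  (forall n x, `|F n x| <= g x) -> Ex (F n) @[n --> \oo] --> Ex f.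
Proof.
move=> mF mf Ff ig Fg.
have iF n : rint (F n) by apply: rint_le ig _.
have [] := @dominated_convergence _ _ _ P setT measurableT (fun n => EFin \o F n)
  (EFin \o f) (EFin \o g).
- by move=> n; exact/measurable_EFinP.
- exact/measurable_EFinP.
- by apply: aeW => x _; apply/fine_cvgP; split; [exact: nearW|exact: Ff].
- exact: ig.
- by apply: aeW => x n _ /=; rewrite lee_fin.
move=> iff _ h; rewrite /Ex /Rintegral; apply: fine_cvg.
by rewrite fineK//; exact: integrable_fin_num iff.
Qed.

Definition sq_int f : Prop := measurable_fun setT f /\ rint (fun x => f x ^+ 2).

Lemma sq_int_mul f g : sq_int f -> sq_int g -> rint (fun x => f x * g x).
Proof.
move=> [mf f2] [mg g2]; apply: rint_le (rintD _ _ f2 g2) _; first exact: measurable_funM.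
move=> x; have := sqr_ge0 (f x - g x); have := sqr_ge0 (f x + g x).
by rewrite ler_norml => h1 h2; apply/andP; split; nra.
Qed.

Lemma sq_int_rint f : sq_int f -> rint f.
Proof.
move=> [mf f2]; apply: rint_le (rintD _ _ f2 (rint_cst 1)) _ => // x.
have := sqr_ge0 (f x - 1); have := sqr_ge0 (f x + 1).
by rewrite ler_norml => h1 h2; apply/andP; split; nra.
Qed.

Lemma sq_intD f g : sq_int f -> sq_int g -> sq_int (fun x => f x + g x).
Proof.
move=> hf hg; split; first by apply: measurable_funD; [case: hf|case: hg].
have := rintD _ _ (rintD _ _ hf.2 hg.2) (rintZ 2 _ (sq_int_mul _ _ hf hg)).
by congr rint; apply/funext => x /=; ring.
Qed.

Lemma sq_intZ (c : R) f : sq_int f -> sq_int (fun x => c * f x).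
Proof.
move=> [mf f2]; split; first exact: measurable_funM.
by have := rintZ (c ^+ 2) _ f2; congr rint; apply/funext => x; rewrite exprMn.
Qed.

Lemma sq_intB f g : sq_int f -> sq_int g -> sq_int (fun x => f x - g x).
Proof.
move=> hf /(sq_intZ (-1)) hg; have := sq_intD _ _ hf hg.
by congr sq_int; apply/funext => x; rewrite mulN1r.
Qed.

Lemma sq_int_cst (c : R) : sq_int (fun=> c).
Proof. by split => //; exact: rint_cst. Qed.

Lemma sq_int_sum (I : Type) (r : seq I) (Q : pred I) (F : I -> T -> R) :
  (forall i, sq_int (F i)) -> sq_int (fun x => \sum_(i <- r | Q i) F i x).
Proof.
move=> iF; elim: r => [|i r ih].
  by under [X in sq_int X]eq_fun do rewrite big_nil; exact: sq_int_cst.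
under [X in sq_int X]eq_fun do rewrite big_cons.
by case: (Q i); [exact: sq_intD|].
Qed.

Definition L2n f : R := Num.sqrt (Ex (fun x => f x ^+ 2)).

Lemma L2n_ge0 f : 0 <= L2n f. Proof. exact: sqrtr_ge0. Qed.

Lemma sqr_L2n f : L2n f ^+ 2 = Ex (fun x => f x ^+ 2).
Proof. by rewrite sqr_sqrtr//; apply: Ex_ge0 => x; exact: sqr_ge0. Qed.

(** Cauchy-Schwarz from fg <= (t f^2 + g^2/t)/2 with t close to b/a. The shift by e keeps t positive
    and finite when a norm vanishes, and e is small enough for the error e(a + b)/2 to stay below
    the slack. *)
Lemma Ex_mul_le f g : sq_int f -> sq_int g -> Ex (fun x => f x * g x) <= L2n f * L2n g.
Proof.
move=> hf hg; apply/ler_addgt0Pl => e0' e0_gt0; have [e0 e0E] : exists e0 : R, e0 = e0' by exists e0'.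
rewrite -e0E in e0_gt0 *; move: e0_gt0 => {e0' e0E} e0_gt0.
set a := L2n f; set b := L2n g.
have a0 : 0 <= a := L2n_ge0 f. have b0 : 0 <= b := L2n_ge0 g.
pose e : R := e0 / (a + b + 1).
have ab1 : 0 < a + b + 1 by rewrite ltr_wpDl ?addr_ge0.
have e_gt0 : 0 < e by rewrite divr_gt0.
pose t := (b + e) / (a + e).
have ae : 0 < a + e by rewrite ltr_wpDl.
have be : 0 < b + e by rewrite ltr_wpDl.
have t0 : 0 < t by rewrite divr_gt0.
have h : Ex (fun x => f x * g x) <= (t / 2) * a ^+ 2 + (t^-1 / 2) * b ^+ 2.
  rewrite /a /b !sqr_L2n -ExZ; last exact: hf.2.
  rewrite -ExZ; last exact: hg.2.
  rewrite -ExD; [|by apply: rintZ; exact: hf.2|by apply: rintZ; exact: hg.2].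
  apply: Ex_le.
  - exact: sq_int_mul.
  - by apply: rintD; apply: rintZ; [exact: hf.2|exact: hg.2].
  - move=> x; rewrite -subr_ge0.
    have -> : t / 2 * f x ^+ 2 + t^-1 / 2 * g x ^+ 2 - f x * g x =
      (t * f x - g x) ^+ 2 / (2 * t) by field; rewrite gt_eqF.
    by rewrite divr_ge0 ?sqr_ge0// mulr_ge0// ltW.
apply: (le_trans h).
have h1 : t * a ^+ 2 <= (b + e) * a.
  rewrite /t mulrAC ler_pdivrMr// expr2.
  by have := mulr_ge0 (mulr_ge0 (ltW be) a0) (ltW e_gt0); nra.
have h2 : t^-1 * b ^+ 2 <= (a + e) * b.
  rewrite /t invf_div mulrAC ler_pdivrMr// expr2.
  by have := mulr_ge0 (mulr_ge0 (ltW ae) b0) (ltW e_gt0); nra.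
have h3 : e * (a + b) <= e0.
  by rewrite /e mulrAC ler_pdivrMr//; nra.
by lra.
Qed.

Lemma L2n_triangle f g : sq_int f -> sq_int g ->
  L2n (fun x => f x + g x) <= L2n f + L2n g.
Proof.
move=> hf hg; rewrite -(@ler_pXn2r _ 2)// ?nnegrE ?addr_ge0 ?L2n_ge0//.
rewrite sqr_L2n.
have -> : Ex (fun x => (f x + g x) ^+ 2) = L2n f ^+ 2 + L2n g ^+ 2 + 2 * Ex (fun x => f x * g x).
  have hfg := sq_int_mul _ _ hf hg.
  rewrite !sqr_L2n -(ExZ 2 _ hfg) -(ExD _ _ hf.2 hg.2).
  rewrite -(ExD _ _ (rintD _ _ hf.2 hg.2) (rintZ 2 _ hfg)).
  by congr Ex; apply/funext => x; ring.
by have := Ex_mul_le _ _ hf hg; rewrite sqrrD -mulr_natl; lra.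
Qed.

Lemma L2nZ (c : R) f : rint (fun x => f x ^+ 2) -> L2n (fun x => c * f x) = `|c| * L2n f.
Proof.
move=> hf; rewrite /L2n; under [X in Ex X]eq_fun do rewrite exprMn.
by rewrite ExZ// sqrtrM ?sqr_ge0// sqrtr_sqr.
Qed.

Lemma L2n_dist f g : sq_int f -> sq_int g ->
  `|L2n f - L2n g| <= L2n (fun x => f x - g x).
Proof.
move=> hf hg.
have key u v : sq_int u -> sq_int v -> L2n u - L2n v <= L2n (fun x => u x - v x).
  move=> hu hv; rewrite lerBlDr.
  have {1}-> : u = (fun x => (u x - v x) + v x) by apply/funext => x; rewrite subrK.
  exact: L2n_triangle (sq_intB _ _ hu hv) hv.
have sym : L2n (fun x => g x - f x) = L2n (fun x => f x - g x).
  by congr (Num.sqrt (Ex _)); apply/funext => x; ring.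
rewrite ler_norml key// andbT; have := key _ _ hg hf; rewrite sym; lra.
Qed.

Lemma Ex_norm_L2n f : sq_int f -> Ex (fun x => `|f x|) <= L2n f.
Proof.
move=> hf; have sqn x : `|f x| ^+ 2 = f x ^+ 2 by rewrite -normrX ger0_norm ?sqr_ge0.
have h : sq_int (fun x => `|f x|).
  split; first exact: measurableT_comp (hf.1).
  by have := hf.2; congr rint; apply/funext => x; rewrite sqn.
have := Ex_mul_le _ _ h (sq_int_cst 1).
have -> : L2n (fun=> 1) = 1 by rewrite /L2n expr1n Ex_cst sqrtr1.
have -> : L2n (fun x => `|f x|) = L2n f.
  by congr (Num.sqrt (Ex _)); apply/funext => x; rewrite sqn.
by rewrite mulr1; under [X in Ex X <= _ -> _]eq_fun do rewrite mulr1.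
Qed.

End expectation.

Section expectation_transfer.
Context {R : realType} {d d' : measure_display}.
Context {T : measurableType d} {T' : measurableType d'}.
Variables (P : probability T R) (Q : probability T' R) (phi : T -> T').
Hypothesis mphi : measurable_fun setT phi.
Hypothesis PQ : forall A, measurable A -> P (phi @^-1` A) = Q A.

Let ge0_transfer (h : T' -> \bar R) : measurable_fun setT h -> (forall x, 0 <= h x)%E ->
  (\int[Q]_x h x = \int[P]_x h (phi x))%E.
Proof.
move=> mh h0; have := ge0_integral_pushforward mphi P measurableT mh (fun x _ => h0 x).
rewrite preimage_setT => <-; apply: eq_measure_integral => A mA _.
exact: (esym (PQ A mA)).
Qed.

Lemma rint_transfer (g : T' -> R) : rint Q g <-> (measurable_fun setT g /\ rint P (g \o phi)).
Proof.
split => [ig|[mg ig]].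
  have mg := rint_meas _ _ ig; split => //.
  apply/integrableP; split.
    by apply/measurable_EFinP; exact: measurableT_comp.
  move/integrableP : ig => [_]; rewrite ge0_transfer//.
  by apply: measurableT_comp => //; exact/measurable_EFinP.
apply/integrableP; split; first exact/measurable_EFinP.
move/integrableP : ig => [_]; rewrite ge0_transfer//.
by apply: measurableT_comp => //; exact/measurable_EFinP.
Qed.

Lemma rint_comp (g : T' -> R) : rint Q g -> rint P (fun x => g (phi x)).
Proof. by move=> /rint_transfer[]. Qed.

Lemma Ex_comp (g : T' -> R) : rint Q g -> Ex P (fun x => g (phi x)) = Ex Q g.
Proof.
move=> ig; have mg := rint_meas _ _ ig; have /rint_transfer[_ ig'] := ig.
rewrite /Ex /Rintegral; congr fine.
have mE : measurable_fun setT (EFin \o g) by exact/measurable_EFinP.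
have H := integral_pushforward mphi mE ig' measurableT.
rewrite preimage_setT in H.
transitivity (\int[P]_x ((EFin \o g) \o phi) x)%E => //.
rewrite -H; apply: eq_measure_integral => A mA _.
exact: PQ.
Qed.

Lemma sq_int_comp (g : T' -> R) : sq_int Q g -> sq_int P (fun x => g (phi x)).
Proof.
move=> [mg g2]; split; first exact: measurableT_comp.
exact: (rint_comp (fun x => g x ^+ 2)).
Qed.

End expectation_transfer.

Section expectation_product.
Context {R : realType} {d d' : measure_display}.
Context {T : measurableType d} {T' : measurableType d'}.
Variables (P : probability T R) (Q : probability T' R).
Local Notation PQ := (P \x Q)%E.

Lemma fst_law (A : set T) : measurable A -> PQ (fst @^-1` A) = P A.
Proof.
move=> mA; rewrite (_ : _ @^-1` _ = A `*` setT).
  transitivity (P A * Q setT)%E; first exact: product_measure1E.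
  by rewrite probability_setT mule1.
by apply/seteqP; split => z //= [].
Qed.

Lemma snd_law (A : set T') : measurable A -> PQ (snd @^-1` A) = Q A.
Proof.
move=> mA; rewrite (_ : _ @^-1` _ = setT `*` A).
  transitivity (P setT * Q A)%E; first exact: product_measure1E.
  by rewrite probability_setT mul1e.
by apply/seteqP; split => z //= [].
Qed.

Lemma rint_fst (f : T -> R) : rint P f -> rint PQ (fun z => f z.1).
Proof. exact: (rint_comp _ _ _ measurable_fst fst_law). Qed.

Lemma rint_snd (f : T' -> R) : rint Q f -> rint PQ (fun z => f z.2).
Proof. exact: (rint_comp _ _ _ measurable_snd snd_law). Qed.

Lemma Ex_fst (f : T -> R) : rint P f -> Ex PQ (fun z => f z.1) = Ex P f.
Proof. exact: (Ex_comp _ _ _ measurable_fst fst_law). Qed.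

Lemma Ex_snd (f : T' -> R) : rint Q f -> Ex PQ (fun z => f z.2) = Ex Q f.
Proof. exact: (Ex_comp _ _ _ measurable_snd snd_law). Qed.

Lemma rint_prod (f : T -> R) (g : T' -> R) : rint P f -> rint Q g ->
  rint PQ (fun z => f z.1 * g z.2).
Proof.
move=> hf hg; have mf := rint_meas _ _ hf; have mg := rint_meas _ _ hg.
have mfg : measurable_fun setT (fun z : T * T' => f z.1 * g z.2).
  apply: measurable_funM; first exact: (measurableT_comp mf measurable_fst).
  exact: (measurableT_comp mg measurable_snd).
apply/integrable12ltyP; first exact/measurable_EFinP.
have fi : (\int[P]_x `|(f x)%:E|)%E \is a fin_num.
  by rewrite ge0_fin_numE ?integral_ge0//; case/integrableP : hf.
have gi : (\int[Q]_x `|(g x)%:E|)%E \is a fin_num.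
  by rewrite ge0_fin_numE ?integral_ge0//; case/integrableP : hg.
rewrite (_ : (\int[P]_x _)%E = (\int[P]_x (`|(f x)%:E| * \int[Q]_y `|(g y)%:E|))%E); last first.
  apply: eq_integral => x _; rewrite -ge0_integralZl//; last first.
    by apply: measurableT_comp => //; exact/measurable_EFinP.
  by apply: eq_integral => y _ /=; rewrite normrM EFinM.
rewrite -(fineK gi) ge0_integralZr//; last 2 first.
  by apply: measurableT_comp => //; exact/measurable_EFinP.
  by rewrite lee_fin fine_ge0// integral_ge0.
by rewrite -(fineK fi) -EFinM ltry.
Qed.

Lemma Ex_prod (f : T -> R) (g : T' -> R) : rint P f -> rint Q g ->
  Ex PQ (fun z => f z.1 * g z.2) = Ex P f * Ex Q g.
Proof.
move=> hf hg; have h := rint_prod _ _ hf hg.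
apply: EFin_inj; rewrite Ex_EFin// -(integral12_prod_meas1 h) /fubini_F/=.
rewrite EFinM (Ex_EFin _ _ hf).
transitivity (\int[P]_x ((f x)%:E * (Ex Q g)%:E))%E.
  apply: eq_integral => x _; rewrite (Ex_EFin _ _ hg).
  by rewrite -integralZl//; apply: eq_integral => y _; rewrite EFinM.
by rewrite integralZr.
Qed.

Lemma Ex_Fubini (h : T * T' -> R) (M : R) : measurable_fun setT h ->
  (forall z, `|h z| <= M) -> Ex PQ h = Ex P (fun x => Ex Q (fun y => h (x, y))).
Proof.
move=> mh hM; have ih : rint PQ h by exact: rint_bounded hM.
have i2 x : rint Q (fun y => h (x, y)).
  by apply: (rint_bounded _ _ M) => //; exact: measurableT_comp mh _.
rewrite /Ex {1}/Rintegral -(integral12_prod_meas1 ih) /fubini_F/=.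
congr fine; apply: eq_integral => x _; by rewrite -Ex_EFin.
Qed.

Lemma measurable_Ex2 (h : T * T' -> R) (M : R) : measurable_fun setT h ->
  (forall z, `|h z| <= M) -> measurable_fun setT (fun x => Ex Q (fun y => h (x, y))).
Proof.
move=> mh hM; have ih : rint PQ h by exact: rint_bounded hM.
exact: (measurableT_comp (@fine_measurable R setT measurableT) (measurable_fubini_F ih)).
Qed.

End expectation_product.

Lemma expR_add3 {R : realType} (u v w : R) :
  expR (u + v + w) <= expR (3 * u) + expR (3 * v) + expR (3 * w).
Proof.
have := expR_ge0 (3 * u); have := expR_ge0 (3 * v); have := expR_ge0 (3 * w).
have [uv|uv] := leP u v; have [uw|uw] := leP u w; have [vw|vw] := leP v w.
all: first [have : expR (u + v + w) <= expR (3 * w) by rewrite ler_expR; lra |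
  have : expR (u + v + w) <= expR (3 * v) by rewrite ler_expR; lra |
  have : expR (u + v + w) <= expR (3 * u) by rewrite ler_expR; lra]; lra.
Qed.

(** Replaces a product of dependent growth factors by a sum of separate exponentials, whose
    expectations are known. The exponent 12 is 2 * 2 * 3: two triples, then three terms in each. *)
Lemma expR_add6 {R : realType} (a b c d g h : R) :
  expR (2 * (a + b + c + d + g + h)) <=
  expR (12 * a) + expR (12 * b) + expR (12 * c) +
  (expR (12 * d) + expR (12 * g) + expR (12 * h)).
Proof.
have h1 : expR (2 * (a + b + c + d + g + h)) <= expR (4 * (a + b + c)) + expR (4 * (d + g + h)).
  have [l|l] := leP (a + b + c) (d + g + h).
    by apply: ler_wpDl; rewrite ?expR_ge0// ler_expR; lra.
  by apply: ler_wpDr; rewrite ?expR_ge0// ler_expR; lra.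
apply: (le_trans h1); apply: lerD.
  have := expR_add3 (4 * a) (4 * b) (4 * c).
  by rewrite -!mulrDr !mulrA (_ : 3 * 4 = 12 :> R)//; ring.
have := expR_add3 (4 * d) (4 * g) (4 * h).
by rewrite -!mulrDr !mulrA (_ : 3 * 4 = 12 :> R)//; ring.
Qed.

(** * Functions with exponentially growing Lipschitz constant *)

Section lp_functions.
Context {R : realType}.
Variables (p : R) (p1 : 1 <= p) (w : nat -> R).
Local Notation S := (lp_borel p1).
Local Notation W := (Wprod w).
Hypothesis w_gt0 : forall n, 0 < w n.+1.
Hypothesis w_bnd : exists M, forall n, w n.+1 <= M.
Local Notation T := (Bw p1 w).

Definition Zp (x : S) : R := fine (psum p (proj1_sig x)).
Definition dlp (x y : S) : R := lp_norm p (proj1_sig x \- proj1_sig y).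

Lemma dlpE x y : dlp x y = lp_norm p (proj1_sig x \- proj1_sig y).
Proof. by []. Qed.

Lemma Zp_ge0 x : 0 <= Zp x. Proof. by apply: fine_ge0; exact: psum_ge0. Qed.

Lemma measurable_Zp : measurable_fun setT Zp.
Proof.
apply: (measurableT_comp (@fine_measurable R setT measurableT)).
by apply: measurable_psum => n; exact: measurable_coord.
Qed.

Lemma Zp_EFin x : (Zp x)%:E = psum p (proj1_sig x).
Proof. by rewrite /Zp psum_fineK//; exact: lpT_mem. Qed.

Lemma Zp_mix J (x y : S) : Zp (mix p p1 J x y) <= Zp x + Zp y.
Proof.
rewrite -lee_fin EFinD !Zp_EFin; apply: le_trans (psum_mix p J _ _).
by apply: psum_le => // n; rewrite mixE.
Qed.

Lemma Zp0 : Zp (lp0 p1) = 0.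
Proof. by rewrite /Zp (psum_fin_supp p p1 _ 0%N)// big_ord0. Qed.

Lemma lpn_le_Zp x : lpn p1 x <= 1 + Zp x.
Proof. exact: lp_norm_le1D. Qed.

Lemma Zp_ge_ycoord0 x : `|ycoord p p1 w 0 x| `^ p <= Zp x.
Proof.
rewrite ycoord0 -lee_fin Zp_EFin /psum.
rewrite (@nneseries_split _ _ 0%N 1); last by move=> k _; rewrite lee_fin powR_ge0.
rewrite add0n big_nat1 leeDl//; apply: nneseries_ge0 => i _ _.
by rewrite lee_fin powR_ge0.
Qed.

(** The number y_k is the zeroth coordinate of B_w^k x, so |y_k| <= 1 + |y_k|^p <= 1 + Z(B_w^k x).
    An increment of y thus becomes a growth factor of the same kind as those of the functions. *)
Lemma sqr_ycoord_le k x : ycoord p p1 w k x ^+ 2 <= expR (2 * Zp (iter k T x)).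
Proof.
have h : `|ycoord p p1 w k x| <= expR (Zp (iter k T x)).
  apply: le_trans (expR_ge1Dx _).
  have := Zp_ge_ycoord0 (iter k T x); rewrite (ycoord_iterBw p p1 w w_gt0 w_bnd) addn0.
  set u := ycoord _ _ _ _ _; have [u1 _|u1] := leP `|u| 1.
    by rewrite ler_wpDr ?Zp_ge0.
  by move=> /(le_trans (le1r_powR _ _)) => /(_ (ltW u1) p1); lra.
have -> : ycoord p p1 w k x ^+ 2 = `|ycoord p p1 w k x| ^+ 2.
  by rewrite -normrX ger0_norm ?sqr_ge0.
have -> : expR (2 * Zp (iter k T x)) = expR (Zp (iter k T x)) ^+ 2.
  by rewrite mulrC expRM_natr.
by rewrite lerXn2r ?nnegrE ?expR_ge0.
Qed.

Opaque psum lp_norm.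

(** The property of [E_omega] on which all the probability rests. It is stable under sums,
    subtraction of constants and truncation of the argument. *)
Definition explip (K : R) (F : S -> R) : Prop :=
  [/\ measurable_fun setT F, 0 <= K &
      forall x y, `|F x - F y| <= K * expR (Zp x + Zp y) * dlp x y].

(** The factor [expR 2] pays for ||x|| <= 1 + ||x||^p at both points. Measurability comes from
    continuity: in the unit ball around x, [Zp] is at most 2^p (Zp x + 1), so the Lipschitz constant
    stays bounded. *)
Lemma E_omega_explip omega f : (forall k, 1 < omega k) -> E_omega p1 omega f ->
  exists K, explip K f.
Proof.
move=> om /(E_omega_lipschitz p p1 _ _ om)[K K0 hK].
have hf x y : `|f x - f y| <= K * expR 2 * expR (Zp x + Zp y) * dlp x y.
  apply: le_trans (hK x y) _; rewrite -mulrA -[leRHS]mulrA -[leRHS]mulrA ler_wpM2l//.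
  rewrite mulrA -expRD ler_wpM2r ?lp_norm_ge0// ler_expR.
  have l4 (a b c d : R) : a <= 1 + b -> c <= 1 + d -> a + c <= 2 + (b + d) by lra.
  by apply: l4; exact: lpn_le_Zp.
exists (K * expR 2); split => //; last by rewrite mulr_ge0 ?expR_ge0.
apply: lp_continuous_measurable => x e e0.
pose B := K * expR 2 * expR (Zp x + 2 `^ p * (Zp x + 1)).
have B0 : 0 <= B by rewrite !mulr_ge0 ?expR_ge0.
exists (Num.min 1 (e / (B + 1))).
  by rewrite lt_min ltr01 divr_gt0// ltr_wpDl.
move=> y; rewrite lt_min => /andP[d1 d2].
apply: le_lt_trans (hf y x) _.
have hyx : lp_mem p (proj1_sig y \- proj1_sig x).
  by apply: lp_memB => //; exact: lpT_mem.
have Zy : Zp y <= 2 `^ p * (Zp x + 1).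
  rewrite -lee_fin Zp_EFin.
  have -> : proj1_sig y = (fun n => proj1_sig x n + (proj1_sig y \- proj1_sig x) n).
    by apply/funext => n /=; rewrite addrC subrK.
  apply: le_trans (psumD p p1 _ _) _; rewrite EFinM EFinD -Zp_EFin.
  apply: lee_wpmul2l; first by rewrite lee_fin powR_ge0.
  apply: leeD2l; rewrite -(psum_fineK _ _ hyx) lee_fin.
  by move: d1 => /(lp_norm_lt p p1 _ 1 ler01 hyx); rewrite powR1 => /ltW.
apply: (@le_lt_trans _ _ (B * dlp y x)).
  rewrite ler_wpM2r ?lp_norm_ge0// ler_wpM2l ?mulr_ge0 ?expR_ge0// ler_expR; lra.
apply: (@le_lt_trans _ _ (B * (e / (B + 1)))).
  by rewrite ler_wpM2l// ltW.
rewrite mulrA ltr_pdivrMr ?ltr_wpDl//; nra.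
Qed.

(** Comparison with the value at 0, the distance ||x|| <= 1 + Z x <= exp(Z x) being absorbed by a
    second exponential. *)
Lemma explip_bound K F : explip K F -> forall x, `|F x| <= (`|F (lp0 p1)| + K) * expR (2 * Zp x).
Proof.
move=> [_ K0 hF] x; have := hF x (lp0 p1); rewrite Zp0 addr0.
have -> : dlp x (lp0 p1) = lpn p1 x.
  by apply: lp_norm_eq => n /=; rewrite subr0.
move=> h; have e1 : 1 <= expR (2 * Zp x).
  by rewrite -expR0 ler_expR mulr_ge0 ?Zp_ge0.
have h2 : K * expR (Zp x) * lpn p1 x <= K * expR (2 * Zp x).
  rewrite -mulrA ler_wpM2l// (_ : 2 * Zp x = Zp x + Zp x); last by ring.
  rewrite expRD ler_wpM2l ?expR_ge0// (le_trans (lpn_le_Zp x))//; exact: expR_ge1Dx.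
have h3 : `|F x| <= `|F (lp0 p1)| + `|F x - F (lp0 p1)|.
  by rewrite -[in leLHS](subrK (F (lp0 p1)) (F x)) addrC ler_normD.
rewrite mulrDl (le_trans h3)// lerD// ?(le_trans h h2)//.
by rewrite ler_peMr.
Qed.

Lemma explipD K K' F G : explip K F -> explip K' G -> explip (K + K') (fun x => F x + G x).
Proof.
move=> [mF K0 hF] [mG K0' hG]; split; [exact: measurable_funD|exact: addr_ge0|] => x y.
rewrite opprD addrACA (le_trans (ler_normD _ _))//.
by rewrite !mulrDl; exact: lerD (hF x y) (hG x y).
Qed.

Lemma explipN K F : explip K F -> explip K (fun x => - F x).
Proof.
move=> [mF K0 hF]; split => //; first exact: measurableT_comp.
by move=> x y; rewrite -opprD normrN.
Qed.

Lemma explipBcst K F c : explip K F -> explip K (fun x => F x - c).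
Proof.
move=> [mF K0 hF]; split => //; first exact: measurable_funB.
by move=> x y; rewrite opprB addrA subrK.
Qed.

Definition trunc (m : nat) (x : S) : S := mix p p1 (fun i => (m <= i)%N) x (lp0 p1).

Lemma ycoord_trunc m n x : ycoord p p1 w n (trunc m x) =
  if (m <= n)%N then 0 else ycoord p p1 w n x.
Proof. by rewrite ycoord_mix /ycoord/= mulr0. Qed.

Lemma Zp_trunc m x : Zp (trunc m x) <= Zp x.
Proof. by have := Zp_mix (fun i => (m <= i)%N) x (lp0 p1); rewrite Zp0 addr0. Qed.

Lemma explip_trunc m K F : explip K F -> explip K (F \o trunc m).
Proof.
move=> [mF K0 hF]; split => //.
  by apply: measurableT_comp => //; apply: measurable_mix.
move=> x y; apply: (le_trans (hF (trunc m x) (trunc m y))).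
apply: ler_pM; [by rewrite mulr_ge0 ?expR_ge0|exact: lp_norm_ge0| |].
  by apply: ler_wpM2l K0 _ _ _; rewrite ler_expR; apply: lerD; exact: Zp_trunc.
apply: (lp_norm_le p p1); first by apply: lp_memB => //; exact: lpT_mem.
by move=> n /=; rewrite !mixE; case: ifP => // _; rewrite subrr normr0.
Qed.

(** Stated for pairs because only the difference matters: it serves truncations of one point as well
    as splices of two. *)
Lemma dlp_tail_cvg0 (a : nat -> S * S) (x y : S) :
  (forall k n, proj1_sig (a k).1 n - proj1_sig (a k).2 n =
     if (n < k)%N then 0 else proj1_sig x n - proj1_sig y n) ->
  dlp (a k).1 (a k).2 @[k --> \oo] --> (0 : R).
Proof.
move=> ha; have hxy : lp_mem p (proj1_sig x \- proj1_sig y).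
  by apply: lp_memB => //; exact: lpT_mem.
apply/cvgrPdist_lt => e e0.
have /cvgrPdist_lt/(_ (e `^ p) (powR_gt0 _ e0)) := fine_psum_tail_cvg0 p p1 _ hxy.
apply: filterS => k; rewrite !sub0r !normrN ger0_norm ?fine_ge0 ?psum_ge0//.
rewrite ger0_norm ?lp_norm_ge0// => h; apply/(lp_norm_lt p p1).
- exact: ltW.
- by apply: lp_memB => //; exact: lpT_mem.
- move: h; congr (fine (psum p _) < _); apply/funext => n /=.
  by rewrite ha.
Qed.

Lemma dlp_sym x y : dlp x y = dlp y x. Proof. exact: lp_normB. Qed.

Lemma explip_cvg K F (a : nat -> S) (y : S) (B : R) : explip K F ->
  (forall k, Zp (a k) <= B) -> dlp (a k) y @[k --> \oo] --> (0 : R) ->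
  F (a k) @[k --> \oo] --> F y.
Proof.
move=> [_ K0 hF] aB da; apply/cvgrPdist_lt => e e0.
pose C := K * expR (B + Zp y) + 1.
have C0 : 0 < C by rewrite ltr_wpDl ?mulr_ge0 ?expR_ge0.
move/cvgrPdist_lt/(_ (e / C) (divr_gt0 e0 C0)) : da; apply: filterS => k.
rewrite sub0r normrN ger0_norm ?lp_norm_ge0// ltr_pdivlMr// => h.
rewrite distrC; apply: le_lt_trans (hF _ _) _; apply: le_lt_trans h.
rewrite mulrC ler_wpM2l ?lp_norm_ge0// /C ler_wpDr// ler_wpM2l// ler_expR.
by rewrite lerD2r.
Qed.

End lp_functions.

(** * Swapping coordinates *)

Opaque psum lp_norm Zp dlp.

Section swap_inequality.
Context {R : realType} {d : measure_display} {T : measurableType d}.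
Variable P : probability T R.

Lemma Ex_sum6 (f1 f2 f3 f4 f5 f6 : T -> R) (M : R) :
  (rint P f1 /\ Ex P f1 = M) -> (rint P f2 /\ Ex P f2 = M) -> (rint P f3 /\ Ex P f3 = M) ->
  (rint P f4 /\ Ex P f4 = M) -> (rint P f5 /\ Ex P f5 = M) -> (rint P f6 /\ Ex P f6 = M) ->
  rint P (fun x => f1 x + f2 x + f3 x + (f4 x + f5 x + f6 x)) /\
  Ex P (fun x => f1 x + f2 x + f3 x + (f4 x + f5 x + f6 x)) = 6 * M.
Proof.
move=> [h1 e1] [h2 e2] [h3 e3] [h4 e4] [h5 e5] [h6 e6].
have h12 := rintD _ _ _ h1 h2; have h45 := rintD _ _ _ h4 h5.
have h13 := rintD _ _ _ h12 h3; have h46 := rintD _ _ _ h45 h6.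
split; first exact: rintD.
rewrite (ExD _ _ _ h13 h46) (ExD _ _ _ h12 h3) (ExD _ _ _ h45 h6) (ExD _ _ _ h1 h2).
by rewrite (ExD _ _ _ h4 h5) e1 e2 e3 e4 e5 e6; ring.
Qed.

(** As s preserves P and exchanges g and h, E f(g - h) = - E (f o s)(g - h). Averaging the two
    expressions gives half of E (f - f o s)(g - h), where the increment of f appears as well. *)
Lemma Ex_swap_le (s : T -> T) (f g h Phi : T -> R) (c : R) :
  measurable_fun setT s -> (forall A, measurable A -> P (s @^-1` A) = P A) ->
  (forall z, g (s z) = h z) -> (forall z, h (s z) = g z) ->
  rint P (fun z => f z * g z) -> rint P (fun z => f z * h z) -> rint P Phi ->
  (forall z, `|(f z - f (s z)) * (g z - h z)| <= c * Phi z) ->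
  `|Ex P (fun z => f z * g z) - Ex P (fun z => f z * h z)| <= c / 2 * Ex P Phi.
Proof.
move=> ms slaw gs hs fg fh iPhi le.
have fg' := rint_comp P P _ ms slaw _ fg; have fh' := rint_comp P P _ ms slaw _ fh.
have i1 := rintB _ _ _ fg fh; have i2 := rintB _ _ _ fg' fh'.
have e1 := ExB _ _ _ fg fh; have e2 := ExB _ _ _ fg' fh'.
rewrite (Ex_comp P P _ ms slaw _ fg) (Ex_comp P P _ ms slaw _ fh) in e2.
have e3 := ExD _ _ _ i1 i2; have i3 := rintD _ _ _ i1 i2.
have E : (fun x => f x * g x - f x * h x + (f (s x) * g (s x) - f (s x) * h (s x))) =
  (fun z => (f z - f (s z)) * (g z - h z)) by apply/funext => z; rewrite gs hs; ring.
rewrite E in e3 i3; rewrite e1 e2 in e3.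
have := Ex_le _ _ _ (rint_norm _ _ i3) (rintZ _ c _ iPhi) le.
rewrite (ExZ _ _ _ iPhi); move/(le_trans (Ex_norm_le _ _ i3)); rewrite e3.
move: (Ex P (fun z => f z * g z) - _) => u.
have -> : u + u = 2 * u by ring.
rewrite normrM ger0_norm// mulrAC ler_pdivlMr// mulrC; exact: id.
Qed.

End swap_inequality.

Lemma cvg_addn {R : realType} (u : nat -> R) (l : R) n :
  u k @[k --> \oo] --> l -> u (k + n)%N @[k --> \oo] --> l.
Proof. by move=> ?; rewrite (cvg_shiftn n u). Qed.

Lemma telescope_le {R : realType} (a b : nat -> R) N n :
  (forall k, `|a (k + n)%N - a (k + n).+1| <= b k) ->
  `|a n - a (N + n)%N| <= \sum_(k < N) b k.
Proof.
move=> h; elim: N => [|N ih]; first by rewrite add0n subrr normr0 big_ord0.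
rewrite big_ord_recr/= addSn (_ : a n - _ = (a n - a (N + n)%N) + (a (N + n)%N - a (N + n).+1)).
  by rewrite (le_trans (ler_normD _ _))// lerD.
by ring.
Qed.

Lemma expR_leD2 {R : realType} (g h : R) : 0 <= h ->
  expR (2 * g) <= expR (2 * g + 2 * h).
Proof. by move=> h0; rewrite ler_expR; lra. Qed.

Lemma lin_bnd0 {R : realType} (f f' a b v : R) : v <= a + b -> 0 <= a -> 0 <= b -> 0 <= f' ->
  2 * f + 2 * v <= 2 * (f + f' + a + b + a + b).
Proof. lra. Qed.

Lemma lin_dG {R : realType} (a b u v : R) : a <= u + v -> b <= u + v ->
  a + b <= 2 * u + 2 * v.
Proof. lra. Qed.

Lemma lin_dF {R : realType} (a u v : R) : a <= u + v -> 0 <= v -> u + a <= 2 * u + 2 * v.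
Proof. lra. Qed.

Lemma lin_prod {R : realType} (f f' a b g h : R) :
  2 * f + 2 * f' + (2 * a + 2 * b) + (2 * g + 2 * h) <= 2 * (f + f' + a + b + g + h).
Proof. lra. Qed.

Lemma sqrB_le4 {R : realType} (u v e : R) : u ^+ 2 <= e -> v ^+ 2 <= e -> (u - v) ^+ 2 <= 4 * e.
Proof. by have := sqr_ge0 (u + v); nra. Qed.

Section covariance_inequality.
Context {R : realType}.
Variables (p : R) (p1 : 1 <= p) (w : nat -> R).
Local Notation S := (lp_borel p1).
Local Notation W := (Wprod w).
Hypothesis w_gt0 : forall n, 0 < w n.+1.
Hypothesis w_bnd : exists M, forall n, w n.+1 <= M.
Hypothesis W_sum : (\sum_(n <oo) (W n.+1 `^ (- p))%:E < +oo)%E.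
Local Notation T := (Bw p1 w).
Local Notation y := (ycoord p p1 w).
Local Notation Z := (Zp p p1).

(** The sum starts at n = 0, where the term is 1; hence [Wsum_ge1]. It normalises the weights W_n^-p
    to a probability in Jensen's inequality. *)
Definition Wsum : R := fine (\sum_(n <oo) (W n `^ (- p))%:E)%E.

Lemma Wsum_EFin : Wsum%:E = (\sum_(n <oo) (W n `^ (- p))%:E)%E.
Proof.
rewrite fineK// ge0_fin_numE; first exact: Wprod_sum_lty.
by apply: nneseries_ge0 => i _ _; rewrite lee_fin powR_ge0.
Qed.

Lemma Wsum_ge1 : 1 <= Wsum.
Proof.
rewrite -lee_fin Wsum_EFin (@nneseries_split _ _ 0%N 1); last first.
  by move=> k _; rewrite lee_fin powR_ge0.
rewrite add0n big_nat1 Wprod0 powR1 leeDl//; apply: nneseries_ge0 => i _ _.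
by rewrite lee_fin powR_ge0.
Qed.

Let c := Wsum.
Let c_gt0 : 0 < c. Proof. exact: lt_le_trans ltr01 Wsum_ge1. Qed.

Lemma Zp_series x : (Z x)%:E = (\sum_(n <oo) (W n `^ (- p) * `|y n x| `^ p)%:E)%E.
Proof.
rewrite Zp_EFin; apply: eq_eseriesr => n _.
have W0 := Wprod_gt0 w w_gt0 n.
rewrite (coordE p p1 w w_gt0) normrM powRM// ger0_norm ?invr_ge0 ?ltW// powRV//.
Qed.

(* Jensen for exp and the weights W_n^-p / Wsum, through the tangent line of exp at 12 Z. *)
Lemma expZ_jensen x : ((expR (12 * Z x))%:E <=
  \sum_(n <oo) (W n `^ (- p) / c * expR (12 * c * `|y n x| `^ p))%:E)%E.
Proof.
set m := 12 * Z x.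
have m0 : 0 <= m by rewrite mulr_ge0 ?Zp_ge0.
have w0 n : 0 <= W n `^ (- p) / c by rewrite divr_ge0 ?powR_ge0 ?(ltW c_gt0).
have e1 : (\sum_(n <oo) (W n `^ (- p) / c)%:E = 1)%E.
  under eq_eseriesr => n _ do rewrite mulrC EFinM.
  rewrite nneseriesZl => [|i _]; last by rewrite lee_fin powR_ge0.
  by rewrite -Wsum_EFin -EFinM mulVf// gt_eqF.
have e2 : (\sum_(n <oo) (W n `^ (- p) / c * (12 * c * `|y n x| `^ p))%:E = m%:E)%E.
  rewrite /m EFinM Zp_series -nneseriesZl => [|i _]; last by rewrite lee_fin mulr_ge0 ?powR_ge0.
  by apply: eq_eseriesr => n _; rewrite -EFinM; congr EFin; field; rewrite gt_eqF.
rewrite -(@leeD2rE _ (expR m * m)%:E)//.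
have -> : ((expR m * m)%:E = \sum_(n <oo) (expR m * m)%:E * (W n `^ (- p) / c)%:E)%E.
  by rewrite nneseriesZl ?e1 ?mule1// => i _; rewrite lee_fin.
have pos3 i : (0 <= (W i `^ (- p) / c * expR (12 * c * `|y i x| `^ p))%:E)%E.
  by rewrite lee_fin mulr_ge0 ?expR_ge0.
have pos4 i : (0 <= (expR m * m)%:E * (W i `^ (- p) / c)%:E)%E.
  by rewrite -EFinM lee_fin mulr_ge0// mulr_ge0 ?expR_ge0.
rewrite -nneseriesD => [|i _ _|i _ _]; [|exact: pos3|exact: pos4].
have -> : ((expR m)%:E + \sum_(n <oo) (expR m * m)%:E * (W n `^ (- p) / c)%:E =
  \sum_(n <oo) (expR m)%:E * ((W n `^ (- p) / c)%:E + (W n `^ (- p) / c * (12 * c * `|y n x| `^ p))%:E))%E.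
  rewrite [RHS]nneseriesZl => [|i _]; last first.
    by rewrite -EFinD lee_fin addr_ge0// mulr_ge0// mulr_ge0 ?powR_ge0// mulr_ge0// ltW.
  rewrite nneseriesD => [|i _ _|i _ _]; last 2 first.
  - by rewrite lee_fin.
  - by rewrite lee_fin mulr_ge0// mulr_ge0 ?powR_ge0// mulr_ge0// ltW.
  rewrite e1 e2 nneseriesZl => [|i _]; last by rewrite lee_fin.
  by rewrite e1 mule1 -EFinD -EFinD -EFinM mulrDr mulr1.
apply: lee_nneseries => [i _ _|n _].
  by rewrite -EFinD -EFinM lee_fin mulr_ge0 ?expR_ge0// addr_ge0// mulr_ge0// mulr_ge0 ?powR_ge0// mulr_ge0// ltW.
rewrite -EFinD -!EFinM -EFinD lee_fin.
set v := 12 * c * _; set u := W n `^ (- p) / c.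
have h : expR m * (1 + (v - m)) <= expR v.
  have -> : v = m + (v - m) by ring.
  rewrite expRD ler_wpM2l ?expR_ge0// (_ : m + (v - m) - m = v - m); last by ring.
  exact: expR_ge1Dx.
have := ler_wpM2l (w0 n) h; rewrite -/u; nra.
Qed.

Variables (A : R) (mu : probability S R).
Hypothesis mu_iid : iid_law p p1 w A mu.
Hypothesis A_ge : 12 * Wsum <= A.

Let inv n := iterBw_invariant p p1 w w_gt0 A mu mu_iid w_bnd n.
Let mT n := measurable_iterBw p p1 w w_gt0 w_bnd n.

Lemma rint_iter n (F : S -> R) : rint mu F -> rint mu (fun x => F (iter n T x)).
Proof. exact: (rint_comp mu mu _ (mT n) (inv n)). Qed.

Lemma Ex_iter n (F : S -> R) : rint mu F -> Ex mu (fun x => F (iter n T x)) = Ex mu F.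
Proof. exact: (Ex_comp mu mu _ (mT n) (inv n)). Qed.

(** After Jensen, invariance of mu gives all y_n the law of y_0, so the expectations of the terms
    sum to the single moment E exp(12 Wsum |y_0|^p), finite because 12 Wsum <= A. *)
Lemma rint_expZ : rint mu (fun x => expR (12 * Z x)).
Proof.
have my0 n : measurable_fun setT (fun x => expR (12 * c * `|y n x| `^ p)).
  by apply: measurable_exp_normpow; exact: measurable_ycoord.
have i0 : rint mu (fun x => expR (12 * c * `|y 0 x| `^ p)).
  apply: (rint_le mu _ (fun x : S => expR (A * `|proj1_sig x 0%N| `^ p))) => //.
    have [_ h _] := mu_iid; apply/integrableP; split.
      by apply/measurable_EFinP/measurable_exp_normpow; exact: measurable_coord.
    by under eq_integral do rewrite /= ger0_norm ?expR_ge0//.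
  move=> x; rewrite ger0_norm ?expR_ge0// ler_expR ycoord0 ler_wpM2r ?powR_ge0//.
have yE n : (fun x => expR (12 * c * `|y n x| `^ p)) =
            (fun x => expR (12 * c * `|y 0 (iter n T x)| `^ p)).
  by apply/funext => x; rewrite (ycoord_iterBw p p1 w w_gt0 w_bnd) addn0.
have in_ n : rint mu (fun x => expR (12 * c * `|y n x| `^ p)).
  by rewrite yE; exact: rint_iter i0.
have mZ : measurable_fun setT (fun x : S => expR (12 * Z x)).
  apply: measurableT_comp => //; apply: measurable_funM => //; exact: measurable_Zp.
apply/integrableP; split; first exact/measurable_EFinP.
under eq_integral do rewrite /= ger0_norm ?expR_ge0//.
apply: (@le_lt_trans _ _ (\int[mu]_x (\sum_(n <oo)
    (W n `^ (- p) / c * expR (12 * c * `|y n x| `^ p))%:E)))%E.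
  apply: ge0_le_integral => //.
  - exact/measurable_EFinP.
  - apply: ge0_emeasurable_sum => [k x _ _|k _].
      by rewrite lee_fin !mulr_ge0 ?expR_ge0 ?powR_ge0 ?invr_ge0 ?(ltW c_gt0).
    by apply/measurable_EFinP; apply: measurable_funM.
  - by move=> x _; exact: expZ_jensen.
rewrite integral_nneseries//; last 2 first.
- by move=> n; apply/measurable_EFinP; apply: measurable_funM.
- by move=> n x _; rewrite lee_fin !mulr_ge0 ?expR_ge0 ?powR_ge0 ?invr_ge0 ?(ltW c_gt0).
have eI n : (\int[mu]_x (W n `^ (- p) / c * expR (12 * c * `|y n x| `^ p))%:E =
    (Ex mu (fun x => expR (12 * c * `|y 0 x| `^ p)) / c)%:E * (W n `^ (- p))%:E)%E.
  rewrite -(Ex_EFin mu (fun x => W n `^ (- p) / c * _)); last exact: rintZ.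
  rewrite (ExZ _ _ _ (in_ n)) yE (Ex_iter n _ i0) -EFinM; congr EFin.
  by move: (Ex mu _) => e; ring.
under eq_eseriesr => n _ do rewrite eI.
rewrite nneseriesZl => [|i _]; last by rewrite lee_fin powR_ge0.
by rewrite -Wsum_EFin -EFinM ltry.
Qed.

Definition expZ_moment : R := Ex mu (fun x => expR (12 * Z x)).
Let M0 := expZ_moment.

Lemma expZ_moment_ge0 : 0 <= M0.
Proof. by apply: Ex_ge0 => x; exact: expR_ge0. Qed.

Lemma rint_expZ_le (k : R) : 0 <= k -> k <= 12 -> rint mu (fun x => expR (k * Z x)).
Proof.
move=> k0 k12; apply: (rint_le _ _ _ _ rint_expZ).
  apply: measurableT_comp => //; apply: measurable_funM => //; exact: measurable_Zp.
by move=> x; rewrite ger0_norm ?expR_ge0// ler_expR ler_wpM2r// Zp_ge0.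
Qed.

Lemma explip_sq_int K F : explip p p1 K F -> sq_int mu F.
Proof.
move=> hF; have [mF K0 _] := hF; split => //.
apply: (rint_le mu _ (fun x => (`|F (lp0 p1)| + K) ^+ 2 * expR (4 * Z x))).
- exact: measurable_funX.
- by apply: rintZ; apply: rint_expZ_le; lra.
- move=> x; rewrite normrX (_ : 4 * Z x = 2 * Z x * 2%:R); last by ring.
  rewrite expRM_natr -exprMn lerXn2r ?nnegrE ?mulr_ge0 ?addr_ge0 ?expR_ge0//.
  exact: explip_bound hF x.
Qed.

Lemma explip_rint K F : explip p p1 K F -> rint mu F.
Proof. by move=> /explip_sq_int; exact: sq_int_rint. Qed.

Lemma explip_cube_int K F : explip p p1 K F -> rint mu (fun x => `|F x| ^+ 3).
Proof.
move=> hF; have [mF K0 _] := hF.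
apply: (rint_le mu _ (fun x => (`|F (lp0 p1)| + K) ^+ 3 * expR (6 * Z x))).
- by apply: measurable_funX; exact: measurableT_comp.
- by apply: rintZ; apply: rint_expZ_le; lra.
- move=> x; rewrite normrX normr_id (_ : 6 * Z x = 2 * Z x * 3%:R); last by ring.
  rewrite expRM_natr -exprMn lerXn2r ?nnegrE ?mulr_ge0 ?addr_ge0 ?expR_ge0//.
  exact: explip_bound hF x.
Qed.

(** Dominated convergence: truncation does not increase [Zp], so all the truncated values obey the
    growth bound at x itself. *)
Lemma explip_trunc_cvg K F : explip p p1 K F ->
  Ex mu (fun x => (F x - F (trunc p p1 m x)) ^+ 2) @[m --> \oo] --> (0 : R).
Proof.
move=> hF; have [mF K0 _] := hF; pose C := `|F (lp0 p1)| + K.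
rewrite -[X in _ --> X](Ex_cst mu).
have mt m : measurable_fun setT (fun x => F (trunc p p1 m x)).
  by have [] := explip_trunc p p1 w w_gt0 m _ _ hF.
apply: (Ex_dominated mu _ _ (fun x => (4 * C ^+ 2) * expR (4 * Z x))).
- by move=> m; apply: measurable_funX; exact: measurable_funB.
- exact: measurable_cst.
- move=> x; rewrite (_ : 0 = (F x - F x) ^+ 2 :> R); last by rewrite subrr expr0n.
  have ct : F (trunc p p1 m x) @[m --> \oo] --> F x.
    apply: (explip_cvg p p1 K F (fun m => trunc p p1 m x) x (Z x)) => //.
      by move=> m; exact: Zp_trunc.
    rewrite (_ : (fun k => _) = fun k => dlp p p1 x (trunc p p1 k x)); last first.
      by apply/funext => k; rewrite dlp_sym.
    apply: (dlp_tail_cvg0 p p1 (fun k => (x, trunc p p1 k x)) x (lp0 p1)) => k n /=.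
    by rewrite mixE ltnNge; case: leqP => _; rewrite ?subrr.
  apply: cvgM; apply: cvgB => //; exact: cvg_cst.
- by apply: rintZ; apply: rint_expZ_le; lra.
- move=> m x; rewrite normrX.
  have b1 := explip_bound p p1 _ _ hF x.
  have b2 : `|F (trunc p p1 m x)| <= C * expR (2 * Z x).
    apply: (le_trans (explip_bound p p1 _ _ hF (trunc p p1 m x))).
    apply: ler_wpM2l; first exact: addr_ge0.
    by rewrite ler_expR ler_pM2l; [exact: Zp_trunc|].
  have -> : 4 * C ^+ 2 * expR (4 * Z x) = (2 * (C * expR (2 * Z x))) ^+ 2.
    rewrite (_ : 4 * Z x = 2 * Z x * 2%:R); last by ring.
    by rewrite expRM_natr; ring.
  have C0 : 0 <= C by rewrite addr_ge0.
  rewrite lerXn2r ?nnegrE ?mulr_ge0 ?expR_ge0//.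
  rewrite (le_trans (ler_normB _ _))// mulr_natl mulr2n lerD//.
Qed.

Section step.
Variables (F G : S -> R) (K K' : R) (n : nat).
Hypothesis hF : explip p p1 K F.
Hypothesis hG : explip p p1 K' G.
Local Notation PP := (mu \x mu)%E.

Let mF : measurable_fun setT F. Proof. by case: hF. Qed.
Let mG : measurable_fun setT G. Proof. by case: hG. Qed.
Let K0 : 0 <= K. Proof. by case: hF. Qed.
Let K0' : 0 <= K'. Proof. by case: hG. Qed.

Let F' x := F (iter n T x).
Let mF' : measurable_fun setT F'. Proof. exact: measurableT_comp mF (mT n). Qed.

(** One dominating function for the whole exchange. By invariance its expectation is [6 * M0]
    whatever n and k are. *)
Let Phi k (z : S * S) :=
  expR (12 * Z (iter n T z.1)) + expR (12 * Z (iter n T z.2)) + expR (12 * Z z.1) +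
  (expR (12 * Z z.2) + expR (12 * Z (iter k T z.1)) + expR (12 * Z (iter k T z.2))).

Let Phi_ok k : rint PP (Phi k) /\ Ex PP (Phi k) = 6 * M0.
Proof.
have ok1 m : rint PP (fun z : S * S => expR (12 * Z (iter m T z.1))) /\
    Ex PP (fun z : S * S => expR (12 * Z (iter m T z.1))) = M0.
  have i1 := rint_iter m _ rint_expZ; split; first exact: (rint_fst mu mu _ i1).
  exact: (etrans (Ex_fst mu mu _ i1) (Ex_iter m _ rint_expZ)).
have ok2 m : rint PP (fun z : S * S => expR (12 * Z (iter m T z.2))) /\
    Ex PP (fun z : S * S => expR (12 * Z (iter m T z.2))) = M0.
  have i1 := rint_iter m _ rint_expZ; split; first exact: (rint_snd mu mu _ i1).
  exact: (etrans (Ex_snd mu mu _ i1) (Ex_iter m _ rint_expZ)).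
exact: (Ex_sum6 PP _ _ _ _ _ _ _ (ok1 n) (ok2 n) (ok1 0%N) (ok2 0%N) (ok1 k) (ok2 k)).
Qed.

Let mx k (z : S * S) : S := mix p p1 (fun i => (i < k)%N) z.1 z.2.
Let mmx k : measurable_fun setT (mx k).
Proof. exact: (measurable_mix p p1 w w_gt0 _ _ _ _ _ measurable_fst measurable_snd). Qed.

(** Interpolates the covariance: at k = 0 the two functions see the same point, and as k grows g
    sees an independent copy, so the limit is the product of the expectations. *)
Let a k := Ex PP (fun z => F' z.1 * G (mx k z)).

Let C := `|F (lp0 p1)| + K.
Let C' := `|G (lp0 p1)| + K'.

Let bnd0 z v : Z v <= Z z.1 + Z z.2 -> `|F' z.1 * G v| <= C * C' * Phi 0 z.
Proof.
move=> hv; rewrite normrM.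
have b1 := explip_bound p p1 _ _ hF (iter n T z.1).
have b2 := explip_bound p p1 _ _ hG v.
apply: (le_trans (ler_pM (normr_ge0 _) (normr_ge0 _) b1 b2)).
rewrite -/C -/C' mulrACA -expRD ler_wpM2l ?mulr_ge0 ?addr_ge0//.
apply: le_trans (expR_add6 (Z (iter n T z.1)) (Z (iter n T z.2)) (Z z.1) (Z z.2)
  (Z (iter 0 T z.1)) (Z (iter 0 T z.2))); rewrite ler_expR.
exact: lin_bnd0 hv (Zp_ge0 _ _ _) (Zp_ge0 _ _ _) (Zp_ge0 _ _ _).
Qed.

Let Zmx k z : Z (mx k z) <= Z z.1 + Z z.2. Proof. exact: Zp_mix. Qed.

Let mFG (h : S * S -> S) : measurable_fun setT h ->
  measurable_fun setT (fun z : S * S => F' z.1 * G (h z)).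
Proof.
move=> mh; apply: measurable_funM; first exact: (measurableT_comp mF' measurable_fst).
exact: measurableT_comp.
Qed.

Let iFG k : rint PP (fun z => F' z.1 * G (mx k z)).
Proof.
apply: (rint_le PP _ _ (mFG _ (mmx k)) (rintZ PP (C * C') _ (Phi_ok 0).1)) => z.
exact/bnd0/Zmx.
Qed.

Let a_cvg : a k @[k --> \oo] --> Ex mu F * Ex mu G.
Proof.
have -> : Ex mu F * Ex mu G = Ex PP (fun z => F' z.1 * G z.2).
  rewrite Ex_prod; [|exact/rint_iter/(explip_rint _ _ hF)|exact: explip_rint hG].
  by rewrite (Ex_iter n F)//; exact: explip_rint hF.
apply: (Ex_dominated PP _ _ (fun z => C * C' * Phi 0 z)).
- by move=> k; exact: mFG.
- by apply: mFG; exact: measurable_snd.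
- move=> z; apply: cvgM; first exact: cvg_cst.
  apply: (explip_cvg p p1 K' G (fun k => mx k z) z.2 (Z z.1 + Z z.2)) => //.
  apply: (dlp_tail_cvg0 p p1 (fun k => (mx k z, z.2)) z.1 z.2) => k i /=.
  by rewrite mixE; case: ifP; rewrite ?subrr.
- exact: (rintZ PP (C * C') _ (Phi_ok 0).1).
- by move=> k z; exact/bnd0/Zmx.
Qed.

(** Exchanging coordinate k of the two copies turns [mx k] into [mx k.+1] and back, which is the
    situation of [Ex_swap_le]. *)
Let sw k (z : S * S) : S * S := (mix p p1 (pred1 k) z.1 z.2, mix p p1 (pred1 k) z.2 z.1).

Let mx_sw k z : mx k (sw k z) = mx k.+1 z.
Proof.
apply: (ycoord_inj p p1 w w_gt0) => i; rewrite !ycoord_mix ltnS /=.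
by case: (ltngtP i k).
Qed.

Let mxS_sw k z : mx k.+1 (sw k z) = mx k z.
Proof.
apply: (ycoord_inj p p1 w w_gt0) => i; rewrite !ycoord_mix ltnS /=.
by case: (ltngtP i k).
Qed.

Let msw k : measurable_fun setT (sw k).
Proof.
apply: measurable_fun_pair.
  exact: (measurable_mix p p1 w w_gt0 _ _ _ _ _ measurable_fst measurable_snd).
exact: (measurable_mix p p1 w w_gt0 _ _ _ _ _ measurable_snd measurable_fst).
Qed.

Let dlp_single (u v : S) i : (forall j, j != i -> y j u = y j v) ->
  dlp p p1 u v = `|y i u - y i v| / W i.
Proof.
move=> h; have W0 := Wprod_gt0 w w_gt0 i.
rewrite dlpE.
have -> : proj1_sig u \- proj1_sig v =
    (fun j => if j == i then (y i u - y i v) / W i else 0).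
  apply/funext => j /=; rewrite !(coordE p p1 w w_gt0).
  case: eqP => [->|/eqP /h ->]; last by rewrite subrr.
  by rewrite -mulrBr mulrC.
by rewrite lp_norm_single// normrM [X in _ * X]gtr0_norm ?invr_gt0.
Qed.

Let dG k z : `|G (mx k z) - G (mx k.+1 z)| <=
  K' * expR (2 * Z z.1 + 2 * Z z.2) * (`|y k z.1 - y k z.2| / W k).
Proof.
have [_ _ h] := hG; apply: (le_trans (h _ _)).
rewrite (dlp_single _ _ k) => [|j jk]; last first.
  by rewrite !ycoord_mix ltnS [in RHS]leq_eqVlt (negbTE jk).
rewrite !ycoord_mix ltnn ltnSn; apply: ler_wpM2r.
  by rewrite divr_ge0// ltW// Wprod_gt0.
apply: ler_wpM2l K0' _ _ _; rewrite ler_expR.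
exact: lin_dG (Zmx k z) (Zmx k.+1 z).
Qed.

(** The map B_w^n forgets the coordinates below n and moves coordinate k to place k - n, where its
    weight is 1/W_(k-n). *)
Let dF k z : `|F' z.1 - F' (sw k z).1| <= if (k < n)%N then 0 else
  K * expR (2 * Z (iter n T z.1) + 2 * Z (iter n T z.2)) * (`|y k z.1 - y k z.2| / W (k - n)).
Proof.
rewrite /F' /sw /=; case: ltnP => kn.
  rewrite (_ : iter n T (mix p p1 (pred1 k) z.1 z.2) = iter n T z.1) ?subrr ?normr0//.
  apply: (ycoord_inj p p1 w w_gt0) => i.
  rewrite !(ycoord_iterBw p p1 w w_gt0 w_bnd) ycoord_mix /=.
  by case: eqP => // e; move: kn; rewrite -e ltnNge leq_addr.
have [_ _ h] := hF; apply: (le_trans (h _ _)).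
rewrite (dlp_single _ _ (k - n)%N) => [|j jk]; last first.
  rewrite !(ycoord_iterBw p p1 w w_gt0 w_bnd) ycoord_mix /=.
  by case: eqP => // e; move: jk; rewrite -e addKn eqxx.
rewrite !(ycoord_iterBw p p1 w w_gt0 w_bnd) ycoord_mix /= subnKC// eqxx.
apply: ler_wpM2r; first by rewrite divr_ge0// ltW// Wprod_gt0.
apply: ler_wpM2l K0 _ _ _; rewrite ler_expR.
have h1 : Z (iter n T (mix p p1 (pred1 k) z.1 z.2)) <= Z (iter n T z.1) + Z (iter n T z.2).
  by rewrite (iterBw_mix p p1 w w_gt0 w_bnd); exact: Zp_mix.
exact: lin_dF h1 (Zp_ge0 _ _ _).
Qed.

(** Both increments contain |y_k - y'_k|. Its square is turned into growth factors by
    [sqr_ycoord_le], and [expR_add6] bounds the product of all of them by [Phi k]. *)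
Let step_pointwise k z :
  `|(F' z.1 - F' (sw k z).1) * (G (mx k z) - G (mx k.+1 z))| <=
  (if (k < n)%N then 0 else 4 * K * K' / (W k * W (k - n))) * Phi k z.
Proof.
rewrite normrM; apply: (le_trans (ler_pM (normr_ge0 _) (normr_ge0 _) (dF k z) (dG k z))).
case: ifP => _; first by rewrite !mul0r.
set u := y k z.1; set v := y k z.2.
have Wk := Wprod_gt0 w w_gt0 k; have Wkn := Wprod_gt0 w w_gt0 (k - n).
set e1 := expR (2 * Z (iter n T z.1) + _); set e2 := expR _.
have e12 : e1 * e2 * (u - v) ^+ 2 <= 4 * Phi k z.
  have hu := sqr_ycoord_le p p1 w w_gt0 w_bnd k z.1.
  have hv := sqr_ycoord_le p p1 w w_gt0 w_bnd k z.2.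
  rewrite -/u in hu; rewrite -/v in hv.
  set g := Z (iter k T z.1) in hu *; set h := Z (iter k T z.2) in hv *.
  have g0 : 0 <= g := Zp_ge0 _ _ _. have h0 : 0 <= h := Zp_ge0 _ _ _.
  have uv : (u - v) ^+ 2 <= 4 * expR (2 * g + 2 * h).
    apply: sqrB_le4; first exact: le_trans hu (expR_leD2 _ _ h0).
    by apply: (le_trans hv); rewrite addrC; exact: expR_leD2.
  apply: (le_trans (ler_wpM2l _ uv)); first by rewrite mulr_ge0 ?expR_ge0.
  rewrite mulrCA ler_pM2l// /e1 /e2 -!expRD.
  apply: le_trans (expR_add6 (Z (iter n T z.1)) (Z (iter n T z.2)) (Z z.1) (Z z.2) g h).
  by rewrite ler_expR; exact: lin_prod.
have -> : K * e1 * (`|u - v| / W (k - n)) * (K' * e2 * (`|u - v| / W k)) =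
    K * K' / (W k * W (k - n)) * (e1 * e2 * (u - v) ^+ 2).
  have <- : `|u - v| ^+ 2 = (u - v) ^+ 2 by rewrite -normrX ger0_norm ?sqr_ge0.
  by field; rewrite !gt_eqF.
have -> : 4 * K * K' / (W k * W (k - n)) * Phi k z =
    K * K' / (W k * W (k - n)) * (4 * Phi k z) by ring.
by apply: (ler_wpM2l _ e12); apply: divr_ge0; apply: mulr_ge0 => //; exact: ltW.
Qed.

Let a_step k : `|a k - a k.+1| <=
  if (k < n)%N then 0 else 12 * M0 * K * K' / (W k * W (k - n)).
Proof.
have swlaw (B : set (S * S)) : measurable B -> PP (sw k @^-1` B) = PP B.
  exact: (swap_law p p1 w w_gt0 A mu mu_iid (pred1 k)).
have := Ex_swap_le PP _ (fun z => F' z.1) _ _ _ _ (msw k) swlaw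
  (fun z => congr1 G (mx_sw k z)) (fun z => congr1 G (mxS_sw k z)) (iFG k) (iFG k.+1)
  (Phi_ok k).1 (step_pointwise k).
(* The 12 here is 4 from the pointwise bound, times 6 from [Phi_ok], times 1/2 from the
   antisymmetrisation. *)
rewrite -/(a k) -/(a k.+1) (Phi_ok k).2; case: ifP => _ h.
  by rewrite !mul0r in h.
apply: (le_trans h); rewrite le_eqVlt; apply/orP; left; apply/eqP.
move: (W k * W (k - n)) M0 => D M1; move: (D^-1) => D'; by field.
Qed.

Lemma covariance_bound B :
  (forall N, \sum_(k < N) ((W k)^-1 * (W (n + k))^-1) <= B) ->
  `|Ex mu (fun x => F (iter n T x) * G x) - Ex mu F * Ex mu G| <= 12 * M0 * K * K' * B.
Proof.
move=> hB.
have a0 : a 0 = Ex mu (fun x => F (iter n T x) * G x).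
  have iFG0 : rint mu (fun x => F' x * G x).
    apply: sq_int_mul; last exact: explip_sq_int hG.
    exact: (sq_int_comp mu mu _ (mT n) (inv n) _ (explip_sq_int _ _ hF)).
  rewrite -(Ex_fst mu mu _ iFG0); congr (Ex _ _).
  apply/funext => z; congr (_ * G _); apply: (ycoord_inj p p1 w w_gt0) => i.
  by rewrite ycoord_mix.
(* The first n exchanges cost nothing, since F o B_w^n ignores those coordinates. The telescoping
   therefore starts at n. *)
have an k : (k <= n)%N -> a k = a 0.
  elim: k => [_|k ih kn]; first by [].
  rewrite -(ih (ltnW kn)); have := a_step k; rewrite kn normr_le0 subr_eq0 => /eqP -> //.
rewrite -a0 -(an n (leqnn n)).
have cv : `|a n - a (N + n)%N| @[N --> \oo] --> `|a n - Ex mu F * Ex mu G|.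
  apply: cvg_norm; apply: cvgB; first exact: cvg_cst.
  exact: cvg_addn a_cvg.
apply: (cvg_le_bound _ _ _ cv) => N.
apply: (le_trans (telescope_le _ _ _ n _)).
  move=> k; apply: (le_trans (a_step _)); rewrite ltnNge leq_addl/= addnK; exact: lexx.
under eq_bigr do rewrite (addnC _ n) invfM (mulrC (W (n + _))^-1).
rewrite -mulr_sumr; apply: ler_wpM2l (hB N).
by apply: mulr_ge0 K0'; apply: mulr_ge0 K0; apply: mulr_ge0 => //; exact: expZ_moment_ge0.
Qed.

End step.

End covariance_inequality.

(** * The Bernoulli shift *)

Opaque psum lp_norm Zp dlp.

Section asymptotic_independence.
Context {R : realType} {d : measure_display} {T : measurableType d}.
Variable P : probability T R.

Lemma rint_indic (A : set T) : measurable A -> rint P (\1_A : T -> R).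
Proof.
move=> mA; apply: (rint_bounded P _ 1); first exact: measurable_indic.
by move=> x; rewrite indicE ger0_norm// lern1 leq_b1.
Qed.

Lemma Ex_indic (A : set T) : measurable A -> (Ex P (\1_A : T -> R))%:E = P A.
Proof. by move=> mA; rewrite Ex_EFin ?integral_indic ?setIT//; exact: rint_indic. Qed.

Variables (g : nat -> T -> R) (c : R).
Hypothesis mg : forall n, measurable_fun setT (g n).
Hypothesis g1 : forall n x, `|g n x| <= 1.
Hypothesis c1 : `|c| <= 1.

Let D (f : T -> R) n := Ex P (fun x => f x * g n x) - Ex P f * c.

Let rint_mulg f n : rint P f -> rint P (fun x => f x * g n x).
Proof.
move=> hf; apply: (rint_le P _ _ _ (rint_norm _ _ hf)).
  by apply: measurable_funM => //; exact: rint_meas hf.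
by move=> x; rewrite normrM ler_piMr.
Qed.

Let DB f f' n : rint P f -> rint P f' -> D (fun x => f x - f' x) n = D f n - D f' n.
Proof.
move=> hf hf'; rewrite /D (ExB _ _ _ hf hf').
have := ExB _ _ _ (rint_mulg f n hf) (rint_mulg f' n hf').
have -> : (fun x => f x * g n x - f' x * g n x) = (fun x => (f x - f' x) * g n x).
  by apply/funext => x; rewrite mulrBl.
by move=> ->; ring.
Qed.

Let D_le f n : rint P f -> (forall x, 0 <= f x) -> `|D f n| <= 2 * Ex P f.
Proof.
move=> hf f0; rewrite /D (le_trans (ler_normB _ _))// mulr_natl mulr2n lerD//.
  apply: (le_trans (Ex_norm_le _ _ (rint_mulg _ n hf))).
  apply: Ex_le => //; first by apply: rint_norm; exact: rint_mulg.
  by move=> x; rewrite normrM (ger0_norm (f0 x)) ler_piMr.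
by rewrite normrM ger0_norm ?Ex_ge0// ler_piMr// Ex_ge0.
Qed.

(** The good sets form a lambda-system. Increasing unions pass to the limit because |g n| <= 1
    bounds [D f n] by 2 E f uniformly in n. *)
Lemma asymptotic_independence (G : set (set T)) :
  setI_closed G -> G setT -> G `<=` measurable ->
  measurable_fun setT (id : g_sigma_algebraType G -> T) ->
  (forall A, G A -> D \1_A n @[n --> \oo] --> (0 : R)) ->
  forall A, measurable A -> D \1_A n @[n --> \oo] --> (0 : R).
Proof.
move=> GI GT Gm mid DG A mA.
pose H := [set A : set T | measurable A /\ D \1_A n @[n --> \oo] --> (0 : R)].
suff : <<s setT, G >> `<=` H.
  by move=> /(_ A) []//; have := mid measurableT A mA; rewrite setTI.
apply: lambda_system_subset => //; last by move=> B GB; split; [exact: Gm|exact: DG].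
split => //.
- by split; [exact: measurableT|exact: DG].
- move=> B C CB [mB DB'] [mC DC]; split; first exact: measurableD.
  have -> : D \1_(B `\` C) = (fun n => D \1_B n - D \1_C n).
    apply/funext => n; rewrite -(DB _ _ n (rint_indic _ mB) (rint_indic _ mC)); congr D.
    apply/funext => x; rewrite !indicE in_setD; case: (boolP (x \in C)) => xC.
      by rewrite andbF (_ : x \in B) ?subrr//; apply/mem_set/CB/set_mem.
    by rewrite andbT subr0.
  by rewrite -[X in _ --> X]subr0; exact: cvgB.
- move=> F ndF HF; set C := \bigcup_i F i.
  have mF i : measurable (F i) by case: (HF i).
  have mC : measurable C by exact: bigcup_measurable.
  split => //.
  have FC k x : (\1_(F k) x : R) <= \1_C x.
    rewrite !indicE; case: (boolP (x \in F k)) => xF; last by rewrite ler0n.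
    by rewrite (_ : x \in C)//; apply/mem_set; exists k => //; exact/set_mem.
  have cvE : Ex P (\1_(F k) : T -> R) @[k --> \oo] --> Ex P (\1_C : T -> R).
    apply: (Ex_dominated P _ _ (fun=> 1)) => //.
    + move=> x; have [xC|xC] := pselect (C x); last first.
        rewrite (_ : (fun k => _) = fun=> \1_C x); first exact: cvg_cst.
        apply/funext => k; apply/eqP; rewrite eq_le FC/= !indicE.
        by rewrite (_ : x \in C = false) ?ler0n//; apply/negbTE; rewrite notin_setE.
      have [k0 _ xk] := xC; apply: cvg_near_cst; exists k0 => // k /= k0k.
      have /subsetPset sF := ndF _ _ k0k.
      by rewrite !indicE (mem_set xC) (mem_set (sF _ xk)).
    + exact: rint_cst.
    + by move=> k x; rewrite indicE ger0_norm// lern1 leq_b1.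
  (* Some F_k misses C by less than e/4 in probability; this costs at most e/2 for every n, and F_k
     itself supplies the other e/2. *)
  apply/cvgrPdist_lt => e e0.
  have e4 : 0 < e / 4 by rewrite divr_gt0.
  have /cvgrPdist_lt/(_ _ e4)[k _ /(_ k (leqnn k))] := cvE.
  rewrite -(ExB _ _ _ (rint_indic _ mC) (rint_indic _ (mF k))) => Ek.
  have e2 : 0 < e / 2 by rewrite divr_gt0.
  have [_ /cvgrPdist_lt/(_ _ e2)] := HF k; apply: filterS => n; rewrite !sub0r !normrN => Dk.
  have -> : D \1_C n = D \1_(F k) n + D (fun x => \1_C x - \1_(F k) x) n.
    by rewrite (DB _ _ n (rint_indic _ mC) (rint_indic _ (mF k))) addrC subrK.
  have h : `|D (fun x => \1_C x - \1_(F k) x) n| <= e / 2.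
    have := D_le (fun x => \1_C x - \1_(F k) x) n.
    move=> /(_ (rintB _ _ _ (rint_indic _ mC) (rint_indic _ (mF k)))) => /(_ _)/le_trans -> //.
      by move=> x; rewrite subr_ge0.
    rewrite (_ : e / 2 = 2 * (e / 4)); last by field.
    rewrite ler_pM2l// ltW//; apply: le_lt_trans Ek; exact: ler_norm.
  apply: (le_lt_trans (ler_normD _ _)); rewrite (_ : e = e / 2 + e / 2); last by field.
  exact: ltr_leD.
Qed.

Lemma sq_int_Lfun2 (f : T -> R) : sq_int P f -> f \in Lfun P 2%:E.
Proof.
move=> [mf f2]; rewrite inE; apply/andP; split; rewrite inE//= /finite_norm.
rewrite unlock; apply: poweR_lty.
move/integrableP : f2 => [_]; congr (_ < +oo)%E.
by apply: eq_integral => x _ /=; rewrite normrX powR_mulrn.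
Qed.

Lemma covariance_Ex (f h : T -> R) : sq_int P f -> sq_int P h ->
  covariance P f h = (Ex P (fun x => f x * h x) - Ex P f * Ex P h)%:E.
Proof.
move=> hf hh; have hfh := sq_int_mul _ _ _ hf hh.
have rf := sq_int_rint _ _ hf; have rh := sq_int_rint _ _ hh.
rewrite covarianceE; [|exact/Lfun1_integrable..].
by rewrite !unlock -(Ex_EFin _ _ hfh) -(Ex_EFin _ _ rf) -(Ex_EFin _ _ rh).
Qed.

End asymptotic_independence.

(** * Strong mixing and full support *)

Section invariant_measure.
Context {R : realType}.
Variables (p : R) (p1 : 1 <= p) (w : nat -> R).
Local Notation S := (lp_borel p1).
Local Notation W := (Wprod w).
Hypothesis w_gt0 : forall n, 0 < w n.+1.
Hypothesis w_bnd : exists M, forall n, w n.+1 <= M.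
Local Notation T := (Bw p1 w).
Local Notation y := (ycoord p p1 w).
Variables (A : R) (mu : probability S R).
Hypothesis mu_iid : iid_law p p1 w A mu.

Let measurable_iter n C : measurable C -> measurable (iter n T @^-1` C).
Proof.
by move=> mC; rewrite -[X in measurable X]setTI; exact: (measurable_iterBw p p1 w w_gt0 w_bnd).
Qed.

(** Splicing at N lets the cylinder depend on the first copy only and the n-th iterate on the second
    only. *)
Lemma cyl_independent N B n C : (forall i, measurable (B i)) -> measurable C ->
  (N <= n)%N -> mu (cyl p p1 w N B `&` iter n T @^-1` C) = (mu (cyl p p1 w N B) * mu C)%E.
Proof.
move=> mB mC Nn; have mcyl := measurable_cyl p p1 w N B mB.
rewrite -(iterBw_invariant p p1 w w_gt0 A mu mu_iid w_bnd n _ mC).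
rewrite -(mix_law p p1 w w_gt0 A mu mu_iid (fun i => (N <= i)%N)); last first.
  by apply: measurableI => //; exact: measurable_iter.
transitivity ((mu \x mu)%E (cyl p p1 w N B `*` (iter n T @^-1` C))).
  congr ((mu \x mu)%E _).
  have iterE z1 z2 : iter n T (mix p p1 (fun i => (N <= i)%N) z1 z2) = iter n T z2.
    apply: (ycoord_inj p p1 w w_gt0) => i.
    rewrite !(ycoord_iterBw p p1 w w_gt0 w_bnd) ycoord_mix.
    by rewrite (leq_trans Nn)// leq_addr.
  apply/seteqP; split => -[z1 z2] [/= h1 h2]; split => /=.
  - by move=> i iN; have := h1 i iN; rewrite ycoord_mix leqNgt iN.
  - by move: h2; rewrite iterE.
  - by move=> i iN; have := h1 i iN; rewrite ycoord_mix leqNgt iN.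
  - by rewrite iterE.
by apply: product_measure1E => //; exact: measurable_iter.
Qed.

(** Only B has to be approximated: for a cylinder B the two events are exactly independent once n is
    large, whatever the Borel set C. *)
Lemma iterBw_mixing (B C : set S) : measurable B -> measurable C ->
  (fun n => mu (B `&` iter n T @^-1` C)) @ \oo --> (mu B * mu C)%E.
Proof.
move=> mB mC; pose g n (x : S) : R := \1_C (iter n T x).
have mg n : measurable_fun setT (g n).
  by apply: measurableT_comp; [exact: measurable_indic|exact: measurable_iterBw].
have g1 n x : `|g n x| <= 1 by rewrite /g indicE ger0_norm// lern1 leq_b1.
pose c : R := Ex mu (\1_C : S -> R).
have c1 : `|c| <= 1.
  apply: Ex_norm_le_bound; first exact: rint_indic.
  by move=> x; rewrite indicE ger0_norm// lern1 leq_b1.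
have mulE (D : set S) n : (fun x => \1_D x * g n x) = \1_(D `&` iter n T @^-1` C).
  by apply/funext => x; rewrite /g !indicE in_setI -natrM mulnb.
have mI (D : set S) n : measurable D -> measurable (D `&` iter n T @^-1` C).
  by move=> mD; apply: measurableI => //; exact: measurable_iter.
have key := asymptotic_independence mu g c mg g1 c1
  [set cyl p p1 w NB.1 NB.2 | NB in
      [set NB : nat * (nat -> set R) | forall i, measurable (NB.2 i)]].
have {}key : Ex mu (fun x => \1_B x * g n x) - Ex mu \1_B * c @[n --> \oo] --> (0 : R).
  apply: key mB.
  - move=> _ _ [[N E]/= mE <-] [[N' E']/= mE' <-]; rewrite cylI.
    eexists (_, _); last by [].
    by move=> i /=; apply: measurableI; case: ifP.
  - by exists (0%N, fun=> setT) => //=; apply/seteqP; split.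
  - by move=> _ [[N E]/= mE <-]; exact: measurable_cyl.
  - exact: measurable_id_cyl.
  - move=> _ [[N E]/= mE <-]; apply: cvg_near_cst; exists N => // n /= Nn.
    have mcyl := measurable_cyl p p1 w N E mE.
    apply/eqP; rewrite subr_eq0; apply/eqP/EFin_inj.
    rewrite mulE Ex_indic; last exact: mI.
    by rewrite cyl_independent// EFinM !Ex_indic.
have E n : mu (B `&` iter n T @^-1` C) = (Ex mu (fun x => \1_B x * g n x))%:E.
  by rewrite mulE Ex_indic//; exact: mI.
under eq_fun do rewrite E.
rewrite -(Ex_indic _ _ mB) -(Ex_indic _ _ mC) -EFinM; apply: cvg_EFin; first exact: nearW.
apply/cvgrPdist_lt => e e0; move/cvgrPdist_lt/(_ e e0) : key.
by apply: filterS => n /=; rewrite sub0r opprB.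
Qed.

Lemma cyl_pos N (r : nat -> R) (e : R) : 0 < e ->
  (0 < mu (cyl p p1 w N (fun i => [set u | (`|u - r i| < e)%R])))%E.
Proof.
move=> e0; have mB i : measurable [set u : R | (`|u - r i| < e)%R].
  rewrite (_ : [set _ | _] = ball (r i) e); last first.
    by apply/seteqP; split => u; rewrite /ball/= distrC.
  exact: measurable_ball.
rewrite (mu_cyl p p1 w A mu mu_iid N _ mB).
have [_ _ h] := mu_iid.
elim: N => [|N ih]; first by rewrite big_ord0.
rewrite big_ord_recr/= mule_gt0//.
have := h (r N) e e0; congr (_ < mu _)%E.
by apply/seteqP; split => u /=; rewrite ycoord0.
Qed.

Lemma full_support (U : set S) : lp_open p1 U -> U !=set0 -> (0 < mu U)%E.
Proof.
move=> oU [x Ux]; have p_gt0 : 0 < p by exact: lt_le_trans p1.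
have [e e0 he] := oU x Ux.
(* Moving the target to a finitely supported point x' makes the condition on the far coordinates a
   mere smallness of the tail. *)
have [m Um] : exists m, U (trunc p p1 m x).
  have := dlp_tail_cvg0 p p1 (fun k => (trunc p p1 k x, x)) (lp0 p1) x.
  move=> /(_ _)/cvgrPdist_lt/(_ e e0)[k n /=|m _ /(_ m (leqnn m))].
    by rewrite mixE leqNgt; case: (n < k)%N => //=; rewrite subrr.
  rewrite sub0r normrN dlpE ger0_norm ?lp_norm_ge0// => h.
  by exists m; exact: he.
have [e' e'0 he'] := oU _ Um; set x' := trunc p p1 m x in Um he'.
pose e4 := e' / 4; have e40 : 0 < e4 by rewrite divr_gt0.
pose tl N (u : S) : S := mix p p1 (fun i => (i < N)%N) u (lp0 p1).
pose G N := [set u : S | lp_norm p (proj1_sig (tl N u)) < e4].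
have mG N : measurable (G N).
  have mf : measurable_fun setT (fun u : S => lp_norm p (proj1_sig (tl N u))).
    apply: measurable_lp_norm => n.
    apply: (measurableT_comp (measurable_coord p p1 n)).
    by apply: (measurable_mix p p1 w w_gt0).
  by have := measurable_fun_ltr mf (measurable_cst e4); move=> /(_ measurableT [set true] I);
     rewrite setTI; congr (measurable _); apply/seteqP; split => u.
have GT u : exists2 N, (m <= N)%N & G N u.
  have := dlp_tail_cvg0 p p1 (fun k => (tl k u, lp0 p1)) u (lp0 p1).
  move=> /(_ _)/cvgrPdist_lt/(_ e4 e40)[k n /=|N _ hN].
    by rewrite mixE; case: ifP => _; rewrite /= subr0.
  have [M mM NM] : exists2 M, (m <= M)%N & (N <= M)%N.
    by exists (maxn m N); [exact: leq_maxl|exact: leq_maxr].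
  exists M; first exact: mM.
  have := hN M NM; rewrite sub0r normrN dlpE ger0_norm; last exact: lp_norm_ge0.
  have -> : lp_norm p (proj1_sig (tl M u) \- proj1_sig (lp0 p1)) = lp_norm p (proj1_sig (tl M u)).
    by apply: lp_norm_eq => n /=; rewrite subr0.
  exact: id.
(* Every tail is eventually small, so the sets [G (m + N)] cover the space and cannot all be
   null. *)
have [N mN GN] : exists2 N, (m <= N)%N & (0 < mu (G N))%E.
  apply: contrapT => hN.
  have h0 N : mu (G (m + N)%N) = 0%E.
    apply/eqP; rewrite eq_le measure_ge0 andbT leNgt; apply/negP => h.
    by apply: hN; exists (m + N)%N => //; exact: leq_addr.
  have : mu.-negligible (\bigcup_N (G (m + N)%N)).
    apply: negligible_bigcup => N.
    by apply/(negligibleP mu (mG (m + N)%N)); exact: h0.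
  rewrite (_ : \bigcup_N G (m + N)%N = setT); last first.
    apply/seteqP; split => // u _; have [N mN Gu] := GT u.
    by exists (N - m)%N; first exact: I; rewrite subnKC; [exact: Gu|exact: mN].
  move=> /(negligibleP mu measurableT) h.
  have : (1%E == 0 :> \bar R)%E by apply/eqP; rewrite -h; apply/esym; exact: probability_setT.
  by rewrite onee_eq0.
pose D := 1 + \sum_(k < N) W k `^ (- p).
have D0 : 0 < D by rewrite ltr_wpDr// sumr_ge0// => k _; exact: powR_ge0.
(* If |y_k - y_k(x')| < q^(1/p) for k < N, the head differs from x' by at most q sum_(k < N) W_k^-p
   < e4^p in p-th power of the norm; the 1 in D keeps it positive. *)
pose q := e4 `^ p / (2 * D).
have q0 : 0 < q by rewrite divr_gt0 ?powR_gt0// mulr_gt0.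
pose del := q `^ p^-1.
have del0 : 0 < del by rewrite powR_gt0.
have delp : del `^ p = q by rewrite -powRrM mulVf ?gt_eqF// powRr1// ltW.
pose E := cyl p p1 w N (fun i => [set u | (`|u - y i x'| < del)%R]).
have E0 : (0 < mu E)%E by exact: cyl_pos.
have mE : measurable E.
  apply: measurable_cyl => i; rewrite (_ : [set _ | _] = ball (y i x') del); last first.
    by apply/seteqP; split => u; rewrite /ball/= distrC.
  exact: measurable_ball.
have mU : measurable U by exact: lp_open_measurable.
rewrite -(mix_law p p1 w w_gt0 A mu mu_iid (fun i => (N <= i)%N) _ mU).
(* A head close to x' in the first copy and a small tail in the second are independent events of
   positive probability, and their splice lies in U. *)
apply: (@lt_le_trans _ _ ((mu \x mu)%E (E `*` G N))).
  rewrite (_ : (mu \x mu)%E _ = (mu E * mu (G N))%E); first exact: mule_gt0.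
  exact: product_measure1E.
have mmix : measurable [set z : S * S | U (mix p p1 (fun i => (N <= i)%N) z.1 z.2)].
  have := measurable_mix p p1 w w_gt0 (fun i => (N <= i)%N) _ _ _ _
    (@measurable_fst _ _ S S) (@measurable_snd _ _ S S).
  by move=> /(_ measurableT U mU); rewrite setTI.
apply: le_measure; rewrite ?inE//; first exact: measurableX.
move=> [z1 z2] [/= Ez1 Gz2]; apply: he'.
set a := fun n => if (N <= n)%N then 0 else proj1_sig z1 n - proj1_sig x' n.
set b := proj1_sig (tl N z2).
have ha : lp_mem p a by apply: (lp_mem_fin_supp p p1 _ N) => n Nn; rewrite /a Nn.
have -> : proj1_sig (mix p p1 (fun i => (N <= i)%N) z1 z2) \- proj1_sig x' =
    (fun n => a n + b n).
  apply/funext => n /=; rewrite /b /a !mixE ltnNge; case: leqP => Nn /=.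
    by rewrite (leq_trans mN Nn) subr0 add0r.
  by rewrite addr0.
have hb : lp_mem p b by exact: lpT_mem.
suff ha4 : lp_norm p a < e' / 4 by exact: (lp_normD_lt p p1 a b e' e'0 ha hb ha4 Gz2).
apply/(lp_norm_lt p p1 _ _ (ltW e40) ha).
rewrite (psum_fin_supp p p1 _ N)/=; last by move=> n Nn; rewrite /a Nn.
apply: (@le_lt_trans _ _ (\sum_(k < N) q * W k `^ (- p))).
  apply: ler_sum => k _; rewrite /a leqNgt ltn_ord/=.
  have Wk := Wprod_gt0 w w_gt0 k.
  rewrite !(coordE p p1 w w_gt0) -mulrBr normrM powRM// (gtr0_norm (_ : 0 < (W k)^-1)) ?invr_gt0//.
  rewrite powRV// mulrC ler_wpM2r ?powR_ge0// -delp ge0_ler_powR ?nnegrE ?(ltW p_gt0) ?(ltW del0)//.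
  by apply: ltW; exact: Ez1.
rewrite -mulr_sumr /q mulrAC ltr_pdivrMr ?mulr_gt0// ltr_pM2l ?powR_gt0//.
have : \sum_(k < N) W k `^ (- p) < D by rewrite /D ltrDr.
by move: D0; move: (\sum_(k < N) _) (D) => s D' *; lra.
Qed.

End invariant_measure.

(** * Gaussian smoothing *)

(** The remainder series is dominated term by term by |a|^3 times the exponential series, as (3+i)!
    >= i!. *)
Lemma expR_taylor2 {R : realType} (a : R) :
  `|expR a - 1 - a - a ^+ 2 / 2| <= `|a| ^+ 3 * expR `|a|.
Proof.
have cv : series (exp_coeff a) (n + 3)%N @[n --> \oo] --> expR a.
  rewrite (cvg_shiftn 3 (series (exp_coeff a))).
  exact: (is_cvg_series_exp_coeff a).
have {}cv : `|series (exp_coeff a) (n + 3)%N - 1 - a - a ^+ 2 / 2| @[n --> \oo] -->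
    `|expR a - 1 - a - a ^+ 2 / 2|.
  by apply: cvg_norm; do 3 (apply: cvgB; last exact: cvg_cst).
apply: (cvg_le_bound _ _ _ cv) => n.
rewrite /series/= big_mkord addnC big_split_ord/= !big_ord_recl big_ord0 /exp_coeff/=.
rewrite /bump/= expr0 expr1 fact0 !divr1 addr0.
rewrite (_ : _ - _ - a - _ = \sum_(i < n) a ^+ (3 + i) / (3 + i)`!%:R); last first.
  by move: (\sum_(i < n) _) => s; rewrite (_ : (1 + 1)`! = 2)%N//; ring.
apply: (le_trans (ler_norm_sum _ _ _)).
apply: (@le_trans _ _ (\sum_(i < n) `|a| ^+ 3 * (`|a| ^+ i / i`!%:R))).
  apply: ler_sum => i _; rewrite exprD normrM normrM !normrX -mulrA ler_wpM2l//.
  rewrite ler_wpM2l// ger0_norm ?invr_ge0// lef_pV2 ?posrE ?ltr0n ?fact_gt0//.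
  by rewrite ler_nat leq_fact// leq_addl.
by rewrite -mulr_sumr ler_wpM2l//; exact: exp_partial_le.
Qed.

(** * The standard Gaussian law *)

Section gaussian.
Context {R : realType}.
Local Notation leb := (@lebesgue_measure R).
Local Notation RR := (measurableTypeR R).

Definition stdpdf (z : R) : R := normal_peak 1 * expR (- z ^+ 2 / 2).

Let c0 : R := normal_peak 1.

Lemma stdpdf_ge0 z : 0 <= stdpdf z.
Proof. by rewrite mulr_ge0 ?expR_ge0// normal_peak_ge0. Qed.

Lemma normal_pdf_std (s z : R) : 0 < s -> normal_pdf 0 s z = s^-1 * stdpdf (z / s).
Proof.
move=> s0; rewrite normal_pdfE ?gt_eqF// /stdpdf mulrA; congr (_ * expR _).
  rewrite /normal_peak expr1n mul1r -invfM; congr (_^-1).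
  by rewrite -mulrnAr sqrtrM ?sqr_ge0// sqrtr_sqr gtr0_norm.
by rewrite subr0 -(mulr_natr _ 2); field; rewrite gt_eqF.
Qed.

Lemma stdpdfE : stdpdf = normal_pdf 0 1.
Proof. by apply/funext => z; rewrite normal_pdf_std// invr1 mul1r mulr1. Qed.

Lemma measurable_stdpdf : measurable_fun setT stdpdf.
Proof. by rewrite stdpdfE; exact: measurable_normal_pdf. Qed.

Lemma integral_stdpdf : (\int[leb]_z (stdpdf z)%:E = 1)%E.
Proof. by rewrite stdpdfE integral_normal_pdf. Qed.

Lemma ge0_integral_normal (s : R) (f : R -> \bar R) : measurable_fun setT f ->
  (forall x, 0 <= f x)%E ->
  (\int[normal_prob 0 s]_x f x = \int[leb]_x (f x * (normal_pdf 0 s x)%:E))%E.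
Proof.
move=> mf f0; have dom := @normal_prob_dominates R 0 s.
rewrite -(Radon_Nikodym_SigmaFinite.change_of_variables dom f0 measurableT mf).
have mpdf : measurable_fun setT (fun x : RR => (normal_pdf 0 s x)%:E).
  by apply/measurable_EFinP; exact: measurable_normal_pdf.
have irn := Radon_Nikodym_SigmaFinite.f_integrable dom.
apply: ae_eq_integral => //.
- by apply: emeasurable_funM => //; exact: measurable_int irn.
- exact: emeasurable_funM.
- apply: ae_eqe_mul2l; apply: integral_ae_eq => //.
  by move=> E _ mE; rewrite -(Radon_Nikodym_SigmaFinite.f_integral dom).
Qed.

Definition gauss : probability RR R := normal_prob 0 1.

Lemma ge0_integral_gauss (f : R -> \bar R) : measurable_fun setT f ->
  (forall x, 0 <= f x)%E ->
  (\int[gauss]_x f x = \int[leb]_x (f x * (stdpdf x)%:E))%E.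
Proof. by move=> mf f0; rewrite ge0_integral_normal// stdpdfE. Qed.

Lemma ge0_normal_scale (s : R) (f : R -> \bar R) : 0 < s -> measurable_fun setT f ->
  (forall x, 0 <= f x)%E ->
  (\int[normal_prob 0 s]_x f x = \int[gauss]_x f (s * x)%R)%E.
Proof.
move=> s0 mf f0; rewrite ge0_integral_normal//.
have mfs : measurable_fun setT (fun x : RR => f (s * x)%R).
  by apply: measurableT_comp => //; exact: measurable_funM.
rewrite ge0_integral_gauss//.
pose F (u : R) : \bar R := (f u * (stdpdf (u / s))%:E)%E.
have mF : measurable_fun setT F.
  apply: emeasurable_funM => //; apply/measurable_EFinP.
  by apply: (measurableT_comp measurable_stdpdf); exact: measurable_funM.
have F0 u : (0 <= F u)%E by rewrite mule_ge0// lee_fin stdpdf_ge0.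
have := ge0_integral_affine s 0 s0 F mF F0.
move=> h; transitivity (s^-1%:E * \int[leb]_x F x)%E.
  rewrite -ge0_integralZl ?lee_fin ?invr_ge0 ?(ltW s0)//.
  by apply: eq_integral => x _; rewrite normal_pdf_std// EFinM muleCA.
by rewrite -h; apply: eq_integral => x _; rewrite /F addr0 (mulrC s) mulfK ?gt_eqF// mulrC.
Qed.

(** The ratio of the translated density to the standard one is exp(zu - u^2/2), smooth in u. Through
    it a translation of f becomes a factor that can be expanded. *)
Lemma gauss_shift_exp (u : R) (f : R -> \bar R) : measurable_fun setT f ->
  (forall x, 0 <= f x)%E ->
  (\int[gauss]_z f (u + z)%R = \int[gauss]_z (f z * (expR (z * u - u ^+ 2 / 2))%:E))%E.
Proof.
move=> mf f0.
have mfu : measurable_fun setT (fun z : RR => f (u + z)%R).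
  by apply: measurableT_comp => //; exact: measurable_funD.
have me : measurable_fun setT (fun z : RR => (expR (z * u - u ^+ 2 / 2))%:E).
  apply/measurable_EFinP; apply: measurableT_comp => //.
  by apply: measurable_funB => //; exact: measurable_funM.
rewrite ge0_integral_gauss// [RHS]ge0_integral_gauss; last 2 first.
- exact: emeasurable_funM.
- by move=> x; rewrite mule_ge0// lee_fin expR_ge0.
pose F (v : R) : \bar R := (f v * (stdpdf (v - u))%:E)%E.
have mF : measurable_fun setT F.
  apply: emeasurable_funM => //; apply/measurable_EFinP.
  by apply: (measurableT_comp measurable_stdpdf); exact: measurable_funB.
have F0 v : (0 <= F v)%E by rewrite mule_ge0// lee_fin stdpdf_ge0.
have := ge0_integral_affine 1 u ltr01 F mF F0; rewrite invr1 mul1e => h.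
transitivity (\int[leb]_x F (1 * x + u)%R)%E.
  by apply: eq_integral => x _; rewrite /F mul1r addrK addrC.
rewrite h; apply: eq_integral => x _; rewrite /F -muleA; congr (_ * _)%E.
rewrite -EFinM /stdpdf mulrCA -expRD; congr (_ * expR _)%:E.
by field.
Qed.

(** Independent centred Gaussians of standard deviations a and b add up to one of standard deviation
    c = sqrt(a^2 + b^2). *)
Lemma gauss_conv (a b : R) (f : R -> R) : 0 < a -> 0 < b -> measurable_fun setT f ->
  (forall x, 0 <= f x) ->
  (\int[gauss]_z \int[gauss]_t (f (a * z + b * t))%:E =
   \int[gauss]_v (f (Num.sqrt (a ^+ 2 + b ^+ 2) * v))%:E)%E.
Proof.
move=> a0 b0 mf f0; set c := Num.sqrt _.
have c2 : c ^+ 2 = a ^+ 2 + b ^+ 2 by rewrite sqr_sqrtr// addr_ge0 ?sqr_ge0.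
have c_gt0 : 0 < c by rewrite sqrtr_gt0 ltr_wpDl ?sqr_ge0// exprn_gt0.
(* The joint density, times f u, after the substitution u = az + bt. *)
pose K (z : R) (u : R) : R := stdpdf z * (b^-1 * (stdpdf ((u - a * z) / b) * f u)).
have mst := measurable_stdpdf.
have K0 z u : 0 <= K z u
  by rewrite /K mulr_ge0 ?stdpdf_ge0// mulr_ge0 ?invr_ge0 ?(ltW b0)// mulr_ge0 ?stdpdf_ge0.
have mK : measurable_fun setT (fun zu : RR * RR => (K zu.1 zu.2)%:E).
  apply/measurable_EFinP; apply: measurable_funM.
    exact: measurableT_comp mst measurable_fst.
  apply: measurable_funM => //; apply: measurable_funM; last exact: measurableT_comp mf measurable_snd.
  apply: (measurableT_comp mst); apply: measurable_funM => //.
  by apply: measurable_funB => //; exact: measurable_funM.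
have mK1 z : measurable_fun setT (fun u : RR => (K z u)%:E).
  exact: (measurableT_comp mK (pair1_measurable z)).
have mK2 u : measurable_fun setT (fun z : RR => (K z u)%:E).
  exact: (measurableT_comp mK (pair2_measurable u)).
have mfab z : measurable_fun setT (fun t : RR => (f (a * z + b * t))%:E).
  apply/measurable_EFinP; apply: (measurableT_comp mf).
  by apply: measurable_funD => //; exact: measurable_funM.
have E1 z : ((\int[gauss]_t (f (a * z + b * t))%:E) * (stdpdf z)%:E = \int[leb]_u (K z u)%:E)%E.
  rewrite ge0_integral_gauss; [|exact: mfab|by move=> x; rewrite lee_fin].
  pose F (u : R) : \bar R := (stdpdf ((u - a * z) / b) * f u)%:E.
  have mF : measurable_fun setT F.
    apply/measurable_EFinP; apply: measurable_funM => //.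
    apply: (measurableT_comp mst); apply: measurable_funM => //.
    exact: measurable_funB.
  have F0 u : (0 <= F u)%E by rewrite lee_fin mulr_ge0// stdpdf_ge0.
  have h := ge0_integral_affine b (a * z) b0 F mF F0.
  transitivity ((stdpdf z)%:E * (b^-1%:E * \int[leb]_u F u))%E.
    rewrite muleC -h; congr (_ * _)%E; apply: eq_integral => t _.
    rewrite /F -EFinM addrK (mulrC b t) mulfK ?gt_eqF//.
    by rewrite (addrC (a * z)); congr EFin; exact: mulrC.
  rewrite -ge0_integralZl ?lee_fin ?invr_ge0 ?(ltW b0)//.
  rewrite -ge0_integralZl ?lee_fin ?stdpdf_ge0//; last 2 first.
  - exact: measurable_funeM.
  - by move=> x _; rewrite mule_ge0// lee_fin invr_ge0 ltW.
rewrite [LHS]ge0_integral_gauss; last 2 first.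
- have mh : measurable_fun setT (fun zt : RR * RR => (f (a * zt.1 + b * zt.2))%:E).
    apply/measurable_EFinP; apply: (measurableT_comp mf).
    by apply: measurable_funD; exact: measurable_funM.
  by apply: (@measurable_fun_fubini_tonelli_F _ _ RR RR R gauss _ mh) => x; rewrite lee_fin.
- by move=> z; apply: integral_ge0 => t _; rewrite lee_fin.
under eq_integral do rewrite E1.
rewrite (@fubini_tonelli _ _ RR RR R leb leb _ mK); last by move=> x; rewrite lee_fin.
(* Completing the square in z separates the exponent into that of (c/b) z - au/(bc), which
   integrates out, and that of u/c. *)
have E2 u : (\int[leb]_z (K z u)%:E = (c^-1 * (stdpdf (u / c) * f u))%:E)%E.
  pose k := (b^-1 * f u * stdpdf (u / c)).
  pose F (z : R) : \bar R := (stdpdf z)%:E.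
  have mF : measurable_fun setT F by exact/measurable_EFinP.
  have F0 z : (0 <= F z)%E by rewrite lee_fin stdpdf_ge0.
  have cb0 : 0 < c / b by rewrite divr_gt0.
  have := ge0_integral_affine (c / b) (- (a * u / (b * c))) cb0 F mF F0.
  rewrite [X in (_ * X)%E]integral_stdpdf mule1 => h.
  transitivity (k%:E * \int[leb]_z F (c / b * z - a * u / (b * c))%R)%E.
    rewrite -ge0_integralZl//; last 2 first.
    - by apply: (measurableT_comp mF); apply: measurable_funB => //; exact: measurable_funM.
    - by rewrite lee_fin mulr_ge0 ?stdpdf_ge0// mulr_ge0// invr_ge0 ltW.
    apply: eq_integral => z _; rewrite -EFinM /F /K /k /stdpdf; congr EFin.
    have e (x1 x2 y1 y2 fu bi : R) : x1 + x2 = y1 + y2 ->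
        c0 * expR x1 * (bi * (c0 * expR x2 * fu)) = bi * fu * (c0 * expR y1) * (c0 * expR y2).
      move=> E; transitivity (c0 ^+ 2 * bi * fu * expR (x1 + x2)); first by rewrite expRD; ring.
      by rewrite E expRD; ring.
    apply: e; rewrite -mulrDl -[RHS]mulrDl; congr (_ / 2).
    rewrite -!opprD; congr (- _).
    have -> : (c / b * z - a * u / (b * c)) ^+ 2 = (c ^+ 2 * z - a * u) ^+ 2 / (b ^+ 2 * c ^+ 2).
      by field; rewrite !gt_eqF.
    rewrite expr_div_n [(u / c) ^+ 2]expr_div_n c2.
    have bN0 : b != 0 by rewrite gt_eqF.
    have D0 : a ^+ 2 + b ^+ 2 != 0 by rewrite gt_eqF// ltr_wpDl ?sqr_ge0// exprn_gt0.
    by field; rewrite ?bN0 ?D0.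
  rewrite h -EFinM /k; congr EFin; by field; rewrite !gt_eqF.
under eq_integral do rewrite E2.
pose F (u : R) : \bar R := (stdpdf (u / c) * f u)%:E.
have mF : measurable_fun setT F.
  apply/measurable_EFinP; apply: measurable_funM => //.
  by apply: (measurableT_comp mst); exact: measurable_funM.
have F0 u : (0 <= F u)%E by rewrite lee_fin mulr_ge0// stdpdf_ge0.
have h := ge0_integral_affine c 0 c_gt0 F mF F0.
transitivity (c^-1%:E * \int[leb]_u F u)%E.
  by rewrite -ge0_integralZl ?lee_fin ?invr_ge0 ?(ltW c_gt0).
rewrite -h [RHS]ge0_integral_gauss; last 2 first.
- by apply/measurable_EFinP; apply: (measurableT_comp mf); exact: measurable_funM.
- by move=> x; rewrite lee_fin.
apply: eq_integral => v _; rewrite /F -EFinM addr0; congr EFin.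
by rewrite [in X in stdpdf X]mulrC mulKf ?gt_eqF// mulrC.
Qed.

End gaussian.

Lemma EFin_Ex_addc {R : realType} {d} {T : measurableType d} (P : probability T R)
  (f : T -> R) (c : R) : rint P f -> (Ex P f + c)%:E = (\int[P]_x (f x + c)%:E)%E.
Proof.
move=> hf; rewrite -[in LHS](Ex_cst P c) -(ExD _ _ _ hf (rint_cst _ c)).
by rewrite (Ex_EFin _ _ (rintD _ _ _ hf (rint_cst _ c))).
Qed.

(** * Smoothing by a Gaussian convolution *)

Section gauss_smoothing.
Context {R : realType}.
Local Notation RR := (measurableTypeR R).
Local Notation gauss := (@gauss R).

Lemma gauss_shift_Ex (u M : R) (f : RR -> R) : measurable_fun setT f ->
  (forall z, `|f z| <= M) ->
  rint gauss (fun z => expR (z * u - u ^+ 2 / 2)) /\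
  Ex gauss (fun z => f (u + z)) = Ex gauss (fun z => f z * expR (z * u - u ^+ 2 / 2)).
Proof.
move=> mf fM.
have me : measurable_fun setT (fun z : RR => expR (z * u - u ^+ 2 / 2)).
  by apply: measurableT_comp => //; apply: measurable_funB => //; exact: measurable_funM.
have oneE : (\int[gauss]_z (1 * (expR (z * u - u ^+ 2 / 2))%:E) = 1)%E.
  rewrite -(gauss_shift_exp u (fun=> 1%E) (measurable_cst _) (fun=> lee01)).
  by rewrite integral_cst// mul1e; exact: probability_setT.
have ie : rint gauss (fun z => expR (z * u - u ^+ 2 / 2)).
  apply/integrableP; split; first exact/measurable_EFinP.
  rewrite (_ : (\int[gauss]_x _)%E = 1%E) ?ltry//; rewrite -oneE.
  by apply: eq_integral => z _; rewrite mul1e /= ger0_norm ?expR_ge0.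
split => //.
have ife : rint gauss (fun z => f z * expR (z * u - u ^+ 2 / 2)).
  apply: (rint_le _ _ _ _ (rintZ _ M _ ie)); first exact: measurable_funM.
  by move=> z; rewrite normrM [X in _ * X]ger0_norm ?expR_ge0// ler_wpM2r ?expR_ge0.
have mfu : measurable_fun setT (fun z : RR => f (u + z)).
  by apply: (measurableT_comp mf); exact: measurable_funD.
have ifu : rint gauss (fun z => f (u + z)) by apply: rint_bounded => //.
(* Adding M makes f nonnegative, which is what the change of variables asks for; the constant
   cancels because the tilting factor has expectation 1. *)
have M0 x : 0 <= f x + M by have := fM x; rewrite ler_norml -lerBlDr sub0r => /andP[].
have e1 : Ex gauss (fun z => expR (z * u - u ^+ 2 / 2)) = 1.
  apply: EFin_inj; rewrite (Ex_EFin _ _ ie) -oneE.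
  by apply: eq_integral => z _; rewrite mul1e.
have mfM : measurable_fun setT (fun z : RR => (f z + M)%:E).
  by apply/measurable_EFinP; exact: measurable_funD.
have h := gauss_shift_exp u (fun z => (f z + M)%:E) mfM (fun x => M0 x).
have i1 : rint gauss (fun z => f (u + z) + M) := rintD _ _ _ ifu (rint_cst _ M).
have i2 : rint gauss (fun z => (f z + M) * expR (z * u - u ^+ 2 / 2)).
  have := rintD _ _ _ ife (rintZ _ M _ ie).
  by congr rint; apply/funext => z; rewrite mulrDl.
have : Ex gauss (fun z => f (u + z) + M) = Ex gauss (fun z => (f z + M) * expR (z * u - u ^+ 2 / 2)).
  apply: EFin_inj; rewrite (Ex_EFin _ _ i1) (Ex_EFin _ _ i2) h.
  by apply: eq_integral => z _; rewrite EFinM.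
rewrite (ExD _ _ _ ifu (rint_cst _ M)) Ex_cst.
have -> : (fun z => (f z + M) * expR (z * u - u ^+ 2 / 2)) =
  (fun z => f z * expR (z * u - u ^+ 2 / 2) + M * expR (z * u - u ^+ 2 / 2)).
  by apply/funext => z; rewrite mulrDl.
rewrite (ExD _ _ _ ife (rintZ _ M _ ie)) (ExZ _ _ _ ie) e1 mulr1.
exact: addIr.
Qed.

(** exp(c|z|) <= exp(cz) + exp(-cz), and each summand is a multiple of an integrable tilting
    factor. *)
Lemma rint_gauss_exp_abs (c : R) : 0 <= c -> rint gauss (fun z => expR (c * `|z|)).
Proof.
move=> c0; have m1 : measurable_fun setT (fun z : RR => expR (c * `|z|)).
  by apply: measurableT_comp => //; apply: measurable_funM => //; exact: measurableT_comp.
have n0 (z : RR) : `|0 : R| <= 0 by rewrite normr0.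
have [i1 _] := gauss_shift_Ex c 0 (fun=> 0) (measurable_cst _) n0.
have [i2 _] := gauss_shift_Ex (- c) 0 (fun=> 0) (measurable_cst _) n0.
apply: (rint_le _ _ _ m1 (rintZ _ (expR (c ^+ 2 / 2)) _ (rintD _ _ _ i1 i2))) => z.
rewrite ger0_norm ?expR_ge0// mulrDr -!expRD.
have -> : c ^+ 2 / 2 + (z * c - c ^+ 2 / 2) = c * z by field.
have -> : c ^+ 2 / 2 + (z * - c - (- c) ^+ 2 / 2) = c * - z by field.
by case: (ger0P z) => _; [rewrite lerDl expR_ge0|rewrite lerDr expR_ge0].
Qed.

(** A single integrable envelope for the powers of z needed below and for the Taylor remainder. Its
    expectation [gauss_const] is the only Gaussian constant in the estimates. *)
Definition gauss_env (z : R) : R := 2 * expR (4 * (`|z| + 1)).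

Lemma rint_gauss_env : rint gauss gauss_env.
Proof.
have -> : gauss_env = (fun z => 2 * expR 4 * expR (4 * `|z|)).
  apply/funext => z; rewrite /gauss_env (_ : 4 * (`|z| + 1) = 4 + 4 * `|z|); last by ring.
  by rewrite expRD mulrA.
exact: rintZ _ (rint_gauss_exp_abs 4 (ler0n _ _)).
Qed.

Definition gauss_const : R := Ex gauss gauss_env.
Local Notation CH := gauss_const.

Lemma gauss_env_ge z : [/\ 1 <= gauss_env z, `|z| <= gauss_env z,
  z ^+ 2 + 1 <= gauss_env z & `|z| ^+ 3 <= gauss_env z].
Proof.
rewrite /gauss_env; set q := `|z| + 1; have q1 : 1 <= q by rewrite lerDr.
have q4 : q ^+ 4 <= expR (4 * q).
  rewrite mulrC expRM_natr lerXn2r ?nnegrE ?expR_ge0 ?(le_trans ler01)//.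
  by apply: le_trans (expR_ge1Dx q); rewrite lerDr.
have z2 : z ^+ 2 = `|z| ^+ 2 by rewrite -normrX ger0_norm ?sqr_ge0.
rewrite z2; have zq : `|z| = q - 1 by rewrite /q addrK.
have z0 := normr_ge0 z; rewrite zq in z0 *.
have qq : q <= q ^+ 4 by rewrite ler_eXnr.
have q2 : q ^+ 2 <= q ^+ 4 by rewrite ler_weXn2l.
have q3 : q ^+ 3 <= q ^+ 4 by rewrite ler_weXn2l.
split; [lra|lra| |].
  by apply: le_trans (_ : q ^+ 2 <= _); [nra|lra].
apply: (@le_trans _ _ (q ^+ 3)); last lra.
by rewrite lerXn2r ?nnegrE//; lra.
Qed.

Lemma gauss_const_ge1 : 1 <= CH.
Proof.
rewrite -[leLHS](Ex_cst gauss); apply: Ex_le; [exact: rint_cst|exact: rint_gauss_env|].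
by move=> z; have [] := gauss_env_ge z.
Qed.

Lemma gauss_moment_le (f : RR -> R) : measurable_fun setT f ->
  (forall z, `|f z| <= gauss_env z) -> rint gauss f /\ `|Ex gauss f| <= CH.
Proof.
move=> mf fe; have hf : rint gauss f by exact: rint_le mf rint_gauss_env fe.
split => //; apply: (le_trans (Ex_norm_le _ _ hf)).
by apply: Ex_le; [exact: rint_norm|exact: rint_gauss_env|].
Qed.

(** What is left of the Hermite generating function exp(zu - u^2/2) after 1, the first Hermite
    polynomial z and the second, z^2 - 1. *)
Definition gauss_rem (u z : R) : R :=
  expR (z * u - u ^+ 2 / 2) - 1 - z * u - (z ^+ 2 - 1) * (u ^+ 2 / 2).

Lemma gauss_rem_le u z : `|u| <= 1 -> `|gauss_rem u z| <= `|u| ^+ 3 * gauss_env z.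
Proof.
move=> u1; set a := z * u - u ^+ 2 / 2; set q := `|z| + 1.
have q1 : 1 <= q by rewrite lerDr.
have q0 : 0 <= q by exact: le_trans q1.
have u0 := normr_ge0 u; have z0 := normr_ge0 z.
have au : `|a| <= `|u| * q.
  rewrite /a (le_trans (ler_normB _ _))// normrM normrM normrX [`|2^-1|]ger0_norm//.
  by rewrite /q; nra.
have aq : `|a| <= q by apply: (le_trans au); rewrite ler_piMl.
(* The terms of a^2/2 other than z^2 u^2/2 are already of order three in u. *)
have -> : gauss_rem u z = (expR a - 1 - a - a ^+ 2 / 2) + (u ^+ 4 / 8 - z * u ^+ 3 / 2).
  by rewrite /gauss_rem /a; field.
have h1 : `|expR a - 1 - a - a ^+ 2 / 2| <= `|u| ^+ 3 * expR (4 * q).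
  apply: (le_trans (expR_taylor2 a)).
  apply: (@le_trans _ _ ((`|u| * q) ^+ 3 * expR q)).
    apply: ler_pM; rewrite ?exprn_ge0 ?expR_ge0 ?ler_expR//.
    by rewrite lerXn2r ?nnegrE ?mulr_ge0.
  rewrite exprMn -mulrA ler_wpM2l ?exprn_ge0// (_ : 4 * q = q * 3%:R + q); last by ring.
  rewrite [leRHS]expRD ler_wpM2r ?expR_ge0// expRM_natr lerXn2r ?nnegrE ?expR_ge0//.
  by apply: le_trans (expR_ge1Dx q); rewrite lerDr.
have h2 : `|u ^+ 4 / 8 - z * u ^+ 3 / 2| <= `|u| ^+ 3 * expR (4 * q).
  apply: (@le_trans _ _ (`|u| ^+ 3 * q)).
    have -> : u ^+ 4 / 8 - z * u ^+ 3 / 2 = u ^+ 3 * (u / 8 - z / 2) by ring.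
    rewrite normrM normrX ler_wpM2l ?exprn_ge0// (le_trans (ler_normB _ _))//.
    by rewrite !normrM [`|8^-1|]ger0_norm// [`|2^-1|]ger0_norm// /q; lra.
  rewrite ler_wpM2l ?exprn_ge0//; apply: le_trans (_ : 4 * q <= _); first lra.
  by apply: le_trans (expR_ge1Dx _); rewrite lerDr.
rewrite (le_trans (ler_normD _ _))// /gauss_env -/q.
apply: (le_trans (lerD h1 h2)); move: (expR _) => E.
by rewrite le_eqVlt; apply/orP; left; apply/eqP; ring.
Qed.

Lemma small_slope0 (A D : R) : (forall u, 0 < u -> u <= 1 -> `|A| <= u * D) -> A = 0.
Proof.
move=> h; apply/eqP; rewrite -normr_le0; apply/ler_addgt0Pr => e e0; rewrite add0r.
have D0 : 0 <= D by have := h 1 ltr01 (lexx _); rewrite mul1r; exact: le_trans.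
pose u := Num.min 1 (e / (D + 1)).
have D1 : 0 < D + 1 by rewrite ltr_wpDl.
have u0 : 0 < u by rewrite lt_min ltr01 divr_gt0.
apply: (le_trans (h u u0 _)); first by rewrite ge_min lexx.
apply: (@le_trans _ _ (e / (D + 1) * D)).
  by rewrite ler_wpM2r// ge_min lexx orbT.
by rewrite mulrAC ler_pdivrMr//; nra.
Qed.

(** The mean and variance are found without computing an integral. The translated density has mass
    1, so the expectations m1 and m2 of z and z^2 - 1 satisfy u m1 + (u^2/2) m2 = O(u^3), which
    forces both to vanish. *)
Lemma gauss_moments : [/\ rint gauss (fun z => z), rint gauss (fun z => z ^+ 2 - 1),
  Ex gauss (fun z => z) = 0 & Ex gauss (fun z => z ^+ 2 - 1) = 0].
Proof.
have [i1 _] : rint gauss (fun z => z) /\ `|Ex gauss (fun z => z)| <= CH.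
  by apply: gauss_moment_le => // z; have [] := gauss_env_ge z.
have [i2 b2] : rint gauss (fun z => z ^+ 2 - 1) /\ `|Ex gauss (fun z => z ^+ 2 - 1)| <= CH.
  apply: gauss_moment_le; first exact: measurable_funB.
  move=> z; have [_ _ h _] := gauss_env_ge z; apply: le_trans h.
  by rewrite (le_trans (ler_normB _ _))// normr1 ger0_norm ?sqr_ge0.
set m1 := Ex gauss (fun z => z); set m2 := Ex gauss _ in b2 *.
have key u : 0 < u -> u <= 1 -> `|u * m1 + u ^+ 2 / 2 * m2| <= u ^+ 3 * CH.
  move=> u0 u1.
  have n1 (z : RR) : `|1 : R| <= 1 by rewrite normr1.
  have [ie] := gauss_shift_Ex u 1 (fun=> 1) (measurable_cst _) n1.
  rewrite Ex_cst (_ : (fun z => 1 * expR _) = (fun z => expR (z * u - u ^+ 2 / 2))); last first.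
    by apply/funext => z; rewrite mul1r.
  move=> /esym ee.
  have j1 := rintZ _ u _ i1; have j2 := rintZ _ (u ^+ 2 / 2) _ i2.
  have j12 := rintD _ _ _ j1 j2; have j0 := rintB _ _ _ ie (rint_cst _ 1).
  have := ExB _ _ _ j0 j12.
  rewrite (ExB _ _ _ ie (rint_cst _ 1)) (ExD _ _ _ j1 j2) (ExZ _ _ _ i1) (ExZ _ _ _ i2) Ex_cst ee.
  rewrite subrr sub0r -/m1 -/m2 => er.
  rewrite -normrN -er -(ExZ _ _ _ rint_gauss_env).
  have j := rintB _ _ _ j0 j12.
  apply: (le_trans (Ex_norm_le _ _ j)).
  apply: Ex_le; [exact: rint_norm|exact: (rintZ _ _ _ rint_gauss_env)|move=> z].
  have := gauss_rem_le u z; rewrite (gtr0_norm u0) => /(_ u1); apply: le_trans.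
  by rewrite /gauss_rem le_eqVlt; apply/orP; left; apply/eqP; congr `|_|; ring.
have m10 : m1 = 0.
  apply: (small_slope0 _ (CH + CH)) => u u0 u1.
  have := key u u0 u1; move: b2 gauss_const_ge1; set c := CH => b2 c1 h.
  have : u * `|m1| <= u * (u * (c + c)); last by rewrite ler_pM2l.
  have -> : u * `|m1| = `|(u * m1 + u ^+ 2 / 2 * m2) - u ^+ 2 / 2 * m2|.
    by rewrite addrK normrM gtr0_norm.
  apply: (le_trans (ler_normB _ _)); rewrite [X in _ + X]normrM ger0_norm ?divr_ge0 ?sqr_ge0//.
  have : u ^+ 3 * c <= u ^+ 2 * c by rewrite ler_wpM2r ?ler_wiXn2l ?(ltW u0)//; lra.
  have : u ^+ 2 / 2 * `|m2| <= u ^+ 2 / 2 * c by rewrite ler_wpM2l ?divr_ge0 ?sqr_ge0.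
  have : 0 <= u ^+ 2 * c by rewrite mulr_ge0 ?sqr_ge0//; lra.
  by rewrite (_ : u * (u * (c + c)) = u ^+ 2 * c + u ^+ 2 * c); [lra|ring].
split => //; apply: (small_slope0 _ (2 * CH)) => u u0 u1.
have := key u u0 u1; rewrite m10 mulr0 add0r normrM ger0_norm ?divr_ge0 ?sqr_ge0//.
rewrite (_ : u ^+ 3 * CH = u ^+ 2 / 2 * (u * (2 * CH))); last by field.
by rewrite ler_pM2l// divr_gt0// exprn_gt0.
Qed.

(** Convolution of phi with the centred Gaussian law of standard deviation s. The value s = 0 is
    allowed and returns phi, in accordance with [gauss_expect]. *)
Definition gconv (s : R) (phi : R -> R) (x : R) : R := Ex gauss (fun z => phi (x + s * z)).

Section bounded.
Variables (phi : R -> R) (M : R).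
Hypothesis mphi : measurable_fun (setT : set RR) (phi : RR -> RR).
Hypothesis phiM : forall x, `|phi x| <= M.

Let M_ge0 : 0 <= M. Proof. exact: le_trans (phiM 0). Qed.

Lemma gconv_meas (s x : R) : measurable_fun setT (fun z : RR => phi (x + s * z)).
Proof.
by apply: (measurableT_comp mphi); apply: measurable_funD => //; exact: measurable_funM.
Qed.

Lemma gconv_rint (s x : R) : rint gauss (fun z => phi (x + s * z)).
Proof. by apply: rint_bounded => //; exact: gconv_meas. Qed.

Lemma gconv_le (s x : R) : `|gconv s phi x| <= M.
Proof. by apply: Ex_norm_le_bound => //; exact: gconv_rint. Qed.

Lemma measurable_gconv (s : R) : measurable_fun (setT : set RR) (gconv s phi : RR -> RR).
Proof.
apply: (measurable_Ex2 gauss gauss (fun z => phi (z.1 + s * z.2)) M) => //.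
by apply: (measurableT_comp mphi); apply: measurable_funD => //; exact: measurable_funM.
Qed.

Lemma gconv0 x : gconv 0 phi x = phi x.
Proof.
rewrite /gconv (_ : (fun z => _) = fun=> phi x) ?Ex_cst//.
by apply/funext => z; rewrite mul0r addr0.
Qed.

(* No smoothness of phi is needed: the shift of phi is moved to the Gaussian density. *)
Lemma gconv_taylor (s : R) : 0 < s -> exists d1 d2 : R -> R, forall x y,
  [/\ `|d1 x| <= M * CH, `|d2 x| <= M * CH &
   `|gconv s phi (x + y) - gconv s phi x - d1 x * (y / s) - d2 x * ((y / s) ^+ 2 / 2)|
     <= 4 * M * CH * `|y / s| ^+ 3].
Proof.
move=> s0.
have [i1 i2 _ _] := gauss_moments.
exists (fun x => Ex gauss (fun z => phi (x + s * z) * z)).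
exists (fun x => Ex gauss (fun z => phi (x + s * z) * (z ^+ 2 - 1))) => x y.
pose f (z : RR) := phi (x + s * z); have mf : measurable_fun setT f := gconv_meas s x.
have c1 := gauss_const_ge1.
have bd (g : RR -> R) : measurable_fun setT g -> (forall z, `|g z| <= gauss_env z) ->
    rint gauss (fun z => f z * g z) /\ `|Ex gauss (fun z => f z * g z)| <= M * CH.
  move=> mg ge; have mfg : measurable_fun setT (fun z => f z * g z) by exact: measurable_funM.
  have le z : `|f z * g z| <= M * gauss_env z.
    by rewrite normrM; apply: ler_pM => //; exact: phiM.
  have ifg := rint_le _ _ _ mfg (rintZ _ M _ rint_gauss_env) le.
  split => //; apply: (le_trans (Ex_norm_le _ _ ifg)); rewrite -(ExZ _ _ _ rint_gauss_env).
  by apply: Ex_le => //; [exact: rint_norm|exact: (rintZ _ _ _ rint_gauss_env)].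
have [j1 b1] := bd (fun z => z) (@measurable_id _ RR setT) (fun z => let: And4 _ h _ _ := gauss_env_ge z in h).
have [j2 b2] : rint gauss (fun z => f z * (z ^+ 2 - 1)) /\
    `|Ex gauss (fun z => f z * (z ^+ 2 - 1))| <= M * CH.
  apply: bd; first exact: measurable_funB.
  move=> z; have [_ _ h _] := gauss_env_ge z; apply: le_trans h.
  by rewrite (le_trans (ler_normB _ _))// normr1 ger0_norm ?sqr_ge0.
split => //; set u := y / s.
set d1 := Ex gauss _ in b1 *; set d2 := Ex gauss _ in b2 *.
have [u1|u1] := leP `|u| 1; last first.
  have h1 := gconv_le s (x + y); have h2 := gconv_le s x.
  have u3 : `|u| <= `|u| ^+ 3 by rewrite ler_eXnr// ltW.
  have u2 : `|u| ^+ 2 <= `|u| ^+ 3 by rewrite ler_weXn2l// ltW.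
  have MC0 : 0 <= M * CH by rewrite mulr_ge0//; lra.
  have MC : M <= M * CH by rewrite ler_peMr.
  have e1 : `|d1 * u| <= M * CH * `|u| ^+ 3 by rewrite normrM; apply: ler_pM.
  have e2 : `|d2 * (u ^+ 2 / 2)| <= M * CH * `|u| ^+ 3.
    rewrite normrM; apply: ler_pM => //; rewrite normrM normrX [`|2^-1|]ger0_norm//.
    by have := exprn_ge0 2 (normr_ge0 u); lra.
  have e0 : M <= M * CH * `|u| ^+ 3.
    by apply: (le_trans MC); rewrite ler_peMr// exprn_ege1// ltW.
  have := ler_normB (gconv s phi (x + y) - gconv s phi x - d1 * u) (d2 * (u ^+ 2 / 2)).
  have := ler_normB (gconv s phi (x + y) - gconv s phi x) (d1 * u).
  have := ler_normB (gconv s phi (x + y)) (gconv s phi x).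
  lra.
have [ie E] := gauss_shift_Ex u M f mf (fun z => phiM _).
have -> : gconv s phi (x + y) = Ex gauss (fun z => f z * expR (z * u - u ^+ 2 / 2)).
  rewrite -E; congr (Ex _ _); apply/funext => z; rewrite /f; congr phi.
  by rewrite /u; field; rewrite gt_eqF.
have ife : rint gauss (fun z => f z * expR (z * u - u ^+ 2 / 2)).
  apply: (rint_le _ _ _ _ (rintZ _ M _ ie)).
    by apply: measurable_funM => //; exact: rint_meas ie.
  by move=> z; rewrite normrM [X in _ * X]ger0_norm ?expR_ge0// ler_wpM2r ?expR_ge0// phiM.
have iff := gconv_rint s x.
have k1 := rintZ _ u _ j1; have k2 := rintZ _ (u ^+ 2 / 2) _ j2.
have k3 := rintB _ _ _ ife iff; have k4 := rintB _ _ _ k3 k1; have k5 := rintB _ _ _ k4 k2.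
have : Ex gauss (fun z => f z * gauss_rem u z) =
   Ex gauss (fun z => f z * expR (z * u - u ^+ 2 / 2)) - gconv s phi x - d1 * u - d2 * (u ^+ 2 / 2).
  rewrite (mulrC d1) (mulrC d2) -(ExZ _ _ _ j1) -(ExZ _ _ _ j2) -(ExB _ _ _ ife iff).
  rewrite -(ExB _ _ _ k3 k1) -(ExB _ _ _ k4 k2); congr (Ex _ _).
  by apply/funext => z; rewrite /gauss_rem /f; ring.
move=> <-.
have ir : rint gauss (fun z => f z * gauss_rem u z).
  by move: k5; congr rint; apply/funext => z; rewrite /gauss_rem /f; ring.
apply: (le_trans (Ex_norm_le _ _ ir)).
apply: (@le_trans _ _ (M * `|u| ^+ 3 * CH)); last first.
  rewrite mulrAC ler_wpM2r ?exprn_ge0// -mulrA ler_peMl ?ler1n// mulr_ge0//; lra.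
rewrite -(ExZ _ _ _ rint_gauss_env).
apply: Ex_le; [exact: rint_norm|exact: (rintZ _ _ _ rint_gauss_env)|move=> z].
rewrite normrM -mulrA; apply: ler_pM => //; first exact: phiM.
exact: gauss_rem_le.
Qed.

(** For |y/s| <= 1 the expansion gives the factor 1 + 1/2 + 4; for larger y the trivial bound 2M is
    enough. *)
Lemma gconv_lip (s : R) : 0 < s -> forall x y,
  `|gconv s phi (x + y) - gconv s phi x| <= 6 * M * CH / s * `|y|.
Proof.
move=> s0 x y; have [d1 [d2 /(_ x y)[b1 b1' b2]]] := gconv_taylor s s0.
have c1 := gauss_const_ge1.
have -> : 6 * M * CH / s * `|y| = 6 * M * CH * `|y / s|.
  by rewrite normrM [`|s^-1|]gtr0_norm ?invr_gt0//; ring.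
set u := y / s in b2 *; have MC0 : 0 <= M * CH by rewrite mulr_ge0//; lra.
have MC : M <= M * CH by rewrite ler_peMr.
have [u1|u1] := leP `|u| 1; last first.
  apply: (le_trans (ler_normB _ _)).
  have h1 := gconv_le s (x + y); have h2 := gconv_le s x.
  have : M * CH <= M * CH * `|u| by rewrite ler_peMr// ltW.
  lra.
have e1 : `|d1 x * u| <= M * CH * `|u| by rewrite normrM ler_wpM2r.
have u2 : `|u| ^+ 2 <= `|u| by rewrite expr2 ler_piMl.
have u3 : `|u| ^+ 3 <= `|u| by rewrite exprS ler_piMr// (le_trans u2).
have e2 : `|d2 x * (u ^+ 2 / 2)| <= M * CH * (`|u| / 2).
  by rewrite normrM; apply: ler_pM => //; rewrite normrM normrX [`|2^-1|]ger0_norm// ler_wpM2r.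
have e3 : 4 * M * CH * `|u| ^+ 3 <= 4 * M * CH * `|u|.
  by rewrite ler_wpM2l// -mulrA mulr_ge0.
have -> : gconv s phi (x + y) - gconv s phi x =
  (gconv s phi (x + y) - gconv s phi x - d1 x * u - d2 x * (u ^+ 2 / 2)) + d1 x * u + d2 x * (u ^+ 2 / 2).
  by ring.
set t := gconv s phi (x + y) - _ - _ - _ in b2 *.
have := ler_normD (t + d1 x * u) (d2 x * (u ^+ 2 / 2)); have := ler_normD t (d1 x * u).
have := mulr_ge0 MC0 (normr_ge0 u); lra.
Qed.

(** The semigroup property: adding an independent Gaussian to the argument only widens the
    smoothing. Vanishing deviations are separate cases since [gauss_conv] wants positive ones. *)
Lemma gconv_conv (a b : R) : 0 <= a -> 0 <= b -> forall x,
  gconv a (gconv b phi) x = gconv (Num.sqrt (a ^+ 2 + b ^+ 2)) phi x.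
Proof.
rewrite le_eqVlt => /predU1P[<-|a0]; rewrite le_eqVlt => /predU1P[<-|b0] x.
- rewrite expr0n addr0 sqrtr0; congr (Ex _ _); apply/funext => z.
  by rewrite mul0r addr0 gconv0.
- rewrite expr0n add0r sqrtr_sqr gtr0_norm//.
  rewrite [LHS]/gconv (_ : (fun z => _) = fun=> gconv b phi x) ?Ex_cst//.
  by apply/funext => z; rewrite mul0r addr0.
- rewrite expr0n addr0 sqrtr_sqr gtr0_norm//.
  by congr (Ex _ _); apply/funext => z; rewrite gconv0.
have mG : measurable_fun setT (fun z : RR => gconv b phi (x + a * z)).
  apply: (measurableT_comp (measurable_gconv b)).
  by apply: measurable_funD => //; exact: measurable_funM.
have iG : rint gauss (fun z => gconv b phi (x + a * z)).
  by apply: rint_bounded => // z; exact: gconv_le.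
set c := Num.sqrt _.
have ic := gconv_rint c x.
pose f (u : RR) := phi (x + u) + M.
have f0 u : 0 <= f u by have := phiM (x + u); rewrite ler_norml /f -lerBlDr sub0r => /andP[].
have mf : measurable_fun setT f.
  by apply: measurable_funD => //; apply: (measurableT_comp mphi); exact: measurable_funD.
apply: (@addIr _ M); apply: EFin_inj.
rewrite (EFin_Ex_addc _ _ M iG) (EFin_Ex_addc _ _ M ic).
rewrite -(gauss_conv a b f a0 b0 mf f0); apply: eq_integral => z _.
have ib := gconv_rint b (x + a * z).
rewrite (EFin_Ex_addc _ _ M ib).
by apply: eq_integral => t _; rewrite /f addrA.
Qed.

Lemma gauss_expect_gconv (s : R) : 0 <= s -> gauss_expect s phi = gconv s phi 0.
Proof.
rewrite le_eqVlt => /predU1P[<-|s0]; first by rewrite /gauss_expect eqxx gconv0.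
rewrite /gauss_expect (negbTE (lt0r_neq0 s0)).
have iN : rint (normal_prob 0 s : probability RR R) phi by apply: (rint_bounded _ _ M).
have i0 := gconv_rint s 0.
transitivity (Ex (normal_prob 0 s : probability RR R) phi); first by rewrite /Ex /Rintegral.
apply: (@addIr _ M); apply: EFin_inj.
have mM : measurable_fun setT (fun x : RR => (phi x + M)%:E).
  by apply/measurable_EFinP; exact: measurable_funD.
have M0' x : (0 <= (phi x + M)%:E)%E.
  by rewrite lee_fin; have := phiM x; rewrite ler_norml -lerBlDr sub0r => /andP[].
have e1 := EFin_Ex_addc _ _ M iN; have e2 := EFin_Ex_addc _ _ M i0.
have e3 := ge0_normal_scale s (fun x => (phi x + M)%:E) s0 mM M0'.
refine (etrans e1 (etrans e3 (etrans _ (esym e2)))).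
by apply: eq_integral => z _; rewrite add0r.
Qed.

End bounded.

Lemma unif_continuous_itv (phi : R -> R) (N e : R) : continuous phi -> 0 < e ->
  exists2 d : R, 0 < d & forall x y, `|x| <= N -> `|y| <= d -> `|phi (x + y) - phi x| <= e.
Proof.
move=> cphi e0.
have K : compact `[- N, N]%classic by exact: segment_compact.
have /compact_near_coveringP nc := K.
pose P (d x : R) : Prop := forall y, `|y| < d -> `|phi (x + y) - phi x| <= e.
have : \forall d \near 0^'+, `[- N, N]%classic `<=` P d.
  apply: nc => x _; have e2 : 0 < e / 2 by rewrite divr_gt0.
  have /cvgrPdist_lt/(_ _ e2)/nbhs_ballP[r /= r0 hr] := cphi x.
  have r2 : 0 < r / 2 by rewrite divr_gt0.
  exists (ball x (r / 2), [set d | d < r / 2]) => /=.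
    by split; [exact: nbhsx_ballx|exact: nbhs_right_lt].
  move=> [x' d] /= [xx' dr] y yd.
  have h1 : `|phi x - phi x'| < e / 2.
    by apply: hr; apply: lt_trans xx' _; rewrite ltr_pdivrMr// ltr_pMr// ltr1n.
  have h2 : `|phi x - phi (x' + y)| < e / 2.
    apply: hr; rewrite /ball/= opprD addrA (le_lt_trans (ler_normB _ _))//.
    rewrite (_ : r = r / 2 + r / 2); last by field.
    by rewrite ltrD// (lt_trans yd).
  rewrite distrC (_ : phi x' - _ = (phi x - phi (x' + y)) - (phi x - phi x')); last by ring.
  rewrite (le_trans (ler_normB _ _))// (_ : e = e / 2 + e / 2); last by field.
  by rewrite lerD// ltW.
move=> [r /= r0 hr]; have r2 : 0 < r / 2 by rewrite divr_gt0.
have r2r : r / 2 < r by rewrite ltr_pdivrMr// ltr_pMr// ltr1n.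
have hd : `[- N, N]%classic `<=` P (r / 2).
  by apply: hr => //=; rewrite sub0r normrN gtr0_norm.
have r4 : r / 4 < r / 2 by rewrite ltr_pM2l// ltf_pV2 ?posrE// ltr_nat.
exists (r / 4); first by rewrite divr_gt0.
move=> x y xN yd; apply: hd; first by rewrite /= in_itv/= -ler_norml.
exact: le_lt_trans yd r4.
Qed.

(** A continuous phi is uniformly continuous on a compact interval only, hence the restriction |x|
    <= N. Where |hz| > d the difference is at most 2M (hz/d)^2, whose expectation is of order
    h^2. *)
Lemma gconv_close (phi : R -> R) (M N e : R) : continuous phi -> (forall x, `|phi x| <= M) ->
  0 < e -> exists2 h0 : R, 0 < h0 & forall h x, 0 < h -> h <= h0 -> `|x| <= N ->
    `|gconv h phi x - phi x| <= e.
Proof.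
move=> cphi phiM e0; have mphi : measurable_fun (setT : set RR) (phi : RR -> RR).
  exact: continuous_measurable_fun.
have e2 : 0 < e / 2 by rewrite divr_gt0.
have [d d0 hd] := unif_continuous_itv phi N _ cphi e2.
have M0 : 0 <= M := le_trans (normr_ge0 _) (phiM 0).
pose D := 2 * M / d ^+ 2 + 1.
have D0 : 0 < D by rewrite ltr_wpDl// divr_ge0 ?sqr_ge0 ?mulr_ge0.
exists (Num.min 1 (e / 2 / D)); first by rewrite lt_min ltr01 divr_gt0.
move=> h x h0 hh xN.
have [_ i2 _ e22] := gauss_moments.
have iz2 : rint gauss (fun z => z ^+ 2) /\ Ex gauss (fun z => z ^+ 2) = 1.
  have i3 := rintD _ _ _ i2 (rint_cst _ 1).
  have E : (fun z : RR => z ^+ 2 - 1 + 1) = (fun z => z ^+ 2) by apply/funext => z; rewrite subrK.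
  split; first by rewrite -E.
  by rewrite -E (ExD _ _ _ i2 (rint_cst _ 1)) e22 Ex_cst add0r.
have ip := gconv_rint phi M mphi phiM h x.
rewrite -[phi x](Ex_cst gauss) -(ExB _ _ _ ip (rint_cst _ _)).
have idf := rintB _ _ _ ip (rint_cst _ (phi x)).
apply: (le_trans (Ex_norm_le _ _ idf)).
have ib := rintD _ _ _ (rint_cst gauss (e / 2)) (rintZ _ (2 * M / d ^+ 2 * h ^+ 2) _ iz2.1).
apply: (@le_trans _ _ (Ex gauss (fun z => e / 2 + 2 * M / d ^+ 2 * h ^+ 2 * z ^+ 2))).
  apply: Ex_le; [exact: rint_norm|exact: ib|move=> z].
  have k0 : 0 <= 2 * M / d ^+ 2 by rewrite divr_ge0 ?sqr_ge0 ?mulr_ge0.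
  have [zd|zd] := leP `|h * z| d.
    apply: (le_trans (hd _ _ xN zd)); rewrite lerDl -mulrA -exprMn mulr_ge0 ?sqr_ge0//.
  apply: (@le_trans _ _ (2 * M)).
    by rewrite (le_trans (ler_normB _ _))// mulr_natl mulr2n lerD.
  rewrite -[leLHS]add0r lerD ?(ltW e2)// -mulrA -exprMn mulrAC ler_pdivlMr ?exprn_gt0//.
  rewrite ler_wpM2l ?mulr_ge0// -[leRHS]ger0_norm ?sqr_ge0// normrX.
  by rewrite lerXn2r ?nnegrE ?(ltW d0)// ltW.
rewrite (ExD _ _ _ (rint_cst gauss _) (rintZ _ _ _ iz2.1)) Ex_cst (ExZ _ _ _ iz2.1) iz2.2 mulr1.
rewrite {2}(_ : e = e / 2 + e / 2); last by field.
rewrite lerD2l; move: hh; rewrite le_min => /andP[h1 hD].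
apply: (@le_trans _ _ (D * h)).
  have : h ^+ 2 <= h by rewrite expr2 ler_piMl// ltW.
  have : 0 <= 2 * M / d ^+ 2 by rewrite divr_ge0 ?sqr_ge0 ?mulr_ge0.
  by rewrite /D; move: (2 * M / d ^+ 2) => k *; nra.
by rewrite mulrC -ler_pdivlMr.
Qed.

End gauss_smoothing.

(** * Central limit theorem *)

Lemma gauss_second_moment {R : realType} (s : R) :
  sq_int (@gauss R) (fun z => s * z) /\ Ex (@gauss R) (fun z => (s * z) ^+ 2) = s ^+ 2.
Proof.
have [_ i2 _ e2] := gauss_moments (R := R).
have i3 := rintD _ _ _ i2 (rint_cst _ 1).
have E : (fun z : measurableTypeR R => z ^+ 2 - 1 + 1) = (fun z => z ^+ 2).
  by apply/funext => z; rewrite subrK.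
have e3 := ExD _ _ _ i2 (rint_cst _ 1); rewrite Ex_cst e2 add0r E in e3; rewrite E in i3.
have E2 : (fun z : measurableTypeR R => (s * z) ^+ 2) = (fun z => s ^+ 2 * z ^+ 2).
  by apply/funext => z; rewrite exprMn.
split; first (split; first exact: measurable_funM).
  by rewrite E2; exact: (rintZ _ _ _ i3).
by rewrite E2 (ExZ _ _ _ i3) e3 mulr1.
Qed.

(** For centred Y the main terms depend on the variance alone, so they cancel when two variables of
    equal variance are compared. *)
Lemma Ex_taylor {R : realType} {d} {T : measurableType d} (P : probability T R)
  (psi d1 d2 : R -> R) (s K : R) (Y : T -> R) (t : R) :
  measurable_fun (setT : set (measurableTypeR R)) (psi : measurableTypeR R -> measurableTypeR R) ->
  (exists M, forall x, `|psi x| <= M) -> 0 <= K ->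
  (forall y, `|psi (t + y) - psi t - d1 t * (y / s) - d2 t * ((y / s) ^+ 2 / 2)| <=
    K * `|y / s| ^+ 3) ->
  sq_int P Y -> rint P (fun x => `|Y x| ^+ 3) -> Ex P Y = 0 ->
  `|Ex P (fun x => psi (t + Y x)) - psi t - d2 t / (2 * s ^+ 2) * Ex P (fun x => Y x ^+ 2)| <=
    K * `|s^-1| ^+ 3 * Ex P (fun x => `|Y x| ^+ 3).
Proof.
move=> mpsi [M psiM] K0 tay Y2 Y3 EY0; have mY := Y2.1; have iY := sq_int_rint _ _ Y2.
have ip : rint P (fun x => psi (t + Y x)).
  apply: (rint_bounded _ _ M) => //; apply: (measurableT_comp mpsi).
  exact: measurable_funD.
have j1 := rintZ _ (d1 t / s) _ iY.
have j2 := rintZ _ (d2 t / (2 * s ^+ 2)) _ Y2.2.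
have k1 := rintB _ _ _ ip (rint_cst _ (psi t)); have k2 := rintB _ _ _ k1 j1.
have k3 := rintB _ _ _ k2 j2.
have -> : Ex P (fun x => psi (t + Y x)) - psi t - d2 t / (2 * s ^+ 2) * Ex P (fun x => Y x ^+ 2) =
  Ex P (fun x => psi (t + Y x) - psi t - d1 t / s * Y x - d2 t / (2 * s ^+ 2) * Y x ^+ 2).
  rewrite (ExB _ _ _ k2 j2) (ExB _ _ _ k1 j1) (ExB _ _ _ ip (rint_cst _ (psi t))) Ex_cst.
  by rewrite (ExZ _ _ _ iY) (ExZ _ _ _ Y2.2) EY0 mulr0 subr0.
apply: (le_trans (Ex_norm_le _ _ k3)); rewrite -(ExZ _ _ _ Y3).
apply: Ex_le; [exact: rint_norm|exact: (rintZ _ _ _ Y3)|move=> x].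
have -> : K * `|s^-1| ^+ 3 * `|Y x| ^+ 3 = K * `|Y x / s| ^+ 3 by rewrite normrM exprMn; ring.
apply: le_trans (tay (Y x)).
rewrite le_eqVlt; apply/orP; left; apply/eqP; congr `|_|.
by rewrite expr_div_n invfM; move: (s^-1) (s ^- 2) => s1 s2; ring.
Qed.

(** * Lindeberg's replacement *)

Section lindeberg.
Context {R : realType} {d : measure_display} {T : measurableType d}.
Variable P : probability T R.
Local Notation RR := (measurableTypeR R).
Local Notation CH := (@gauss_const R).

(* Independence from the previous partial sum is all that the replacement step uses. *)
Definition lindeberg_array (X : nat -> T -> R) : Prop :=
  [/\ forall i, sq_int P (X i), rint P (fun x => `|X 0%N x| ^+ 3), Ex P (X 0%N) = 0,
    forall j (psi : R -> R) M, measurable_fun (setT : set RR) (psi : RR -> RR) ->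
      (forall u, `|psi u| <= M) ->
      Ex P (fun x => psi (\sum_(i < j) X i x + X j x)) =
      Ex P (fun x => Ex P (fun y => psi (\sum_(i < j) X i x + X 0%N y))) &
    forall j, Ex P (fun x => (\sum_(i < j) X i x) * X j x) = 0 /\
      Ex P (fun x => X j x ^+ 2) = Ex P (fun x => X 0%N x ^+ 2)].

Lemma lindeberg_array_L2 X q : lindeberg_array X ->
  Ex P (fun x => (\sum_(i < q) X i x) ^+ 2) = q%:R * Ex P (fun x => X 0%N x ^+ 2).
Proof.
move=> [X2 _ _ _ orth]; elim: q => [|q ih].
  by rewrite mul0r -[RHS](Ex_cst P); congr (Ex _ _); apply/funext => x; rewrite big_ord0 expr0n.
have sS : sq_int P (fun x => \sum_(i < q) X i x) by exact: sq_int_sum.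
have [ort1 ort2] := orth q.
have iSX := sq_int_mul _ _ _ sS (X2 q).
have := ExD _ _ _ (rintD _ _ _ sS.2 (rintZ _ 2 _ iSX)) (X2 q).2.
rewrite (ExD _ _ _ sS.2 (rintZ _ 2 _ iSX)) (ExZ _ _ _ iSX) ort1 ort2 mulr0 addr0 ih.
move=> H; rewrite -natr1 mulrDl mul1r -H.
by congr (Ex _ _); apply/funext => x; rewrite big_ord_recr/=; ring.
Qed.

Section step.
Variables (phi : R -> R) (M h : R).
Hypothesis mphi : measurable_fun (setT : set RR) (phi : RR -> RR).
Hypothesis phiM : forall x, `|phi x| <= M.
Hypothesis h0 : 0 < h.
Variable X : nat -> T -> R.
Hypothesis lX : lindeberg_array X.

Let tau := L2n P (X 0%N).
(** The smoothing level after k of the variables have become Gaussian and been absorbed. It never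
    falls below h, so the bound D is uniform in k. *)
Let s k := Num.sqrt (h ^+ 2 + k%:R * tau ^+ 2).
Let D := 4 * M * CH / h ^+ 3 * (Ex P (fun x => `|X 0%N x| ^+ 3) + tau ^+ 3 * CH).

Let h_le_s k : h <= s k.
Proof.
by rewrite -[leLHS](gtr0_norm h0) -sqrtr_sqr ler_wsqrtr// lerDl mulr_ge0// sqr_ge0.
Qed.

Let M0 : 0 <= M. Proof. exact: le_trans (phiM 0). Qed.

Let step_bound k t : `|Ex P (fun y => gconv (s k) phi (t + X 0%N y)) - gconv (s k.+1) phi t| <= D.
Proof.
have [X2 X3 EX0 _ _] := lX; have s0 : 0 < s k := lt_le_trans h0 (h_le_s k).
have tau0 : 0 <= tau by exact: L2n_ge0.
have [d1 [d2 tay]] := gconv_taylor phi M mphi phiM (s k) s0.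
set psi := gconv (s k) phi.
have mpsi : measurable_fun (setT : set RR) (psi : RR -> RR) := measurable_gconv phi M mphi phiM _.
have psiM : exists M, forall x, `|psi x| <= M by exists M => x; exact: gconv_le.
have c1 := gauss_const_ge1 (R := R); have c0 : 0 <= CH by exact: le_trans c1.
have K0 : 0 <= 4 * M * CH by rewrite !mulr_ge0.
have tay' y : `|psi (t + y) - psi t - d1 t * (y / s k) - d2 t * ((y / s k) ^+ 2 / 2)| <=
    4 * M * CH * `|y / s k| ^+ 3 by have [] := tay t y.
have b1 := Ex_taylor P psi d1 d2 _ _ _ t mpsi psiM K0 tay' (X2 0%N) X3 EX0.
have [i1 i2 e1 e2] := gauss_moments (R := R).
have [i4 e4] : rint (@gauss R) (fun z => `|z| ^+ 3) /\ `|Ex (@gauss R) (fun z => `|z| ^+ 3)| <= CH.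
  have mn : measurable_fun setT (fun z : RR => `|z|) by exact: measurableT_comp.
  apply: gauss_moment_le; first exact: (measurable_funX 3 mn).
  by move=> z; have [_ _ _ hz] := gauss_env_ge z; rewrite ger0_norm ?exprn_ge0.
have [Z2 E2] := gauss_second_moment tau.
have Z3 : rint (@gauss R) (fun z => `|tau * z| ^+ 3).
  have := rintZ _ (tau ^+ 3) _ i4; congr rint; apply/funext => z.
  by rewrite normrM (ger0_norm tau0) exprMn.
have EZ0 : Ex (@gauss R) (fun z => tau * z) = 0 by rewrite (ExZ _ _ _ i1) e1 mulr0.
have E3 : Ex (@gauss R) (fun z => `|tau * z| ^+ 3) <= tau ^+ 3 * CH.
  rewrite (_ : (fun z => _) = (fun z => tau ^+ 3 * `|z| ^+ 3)); last first.
    by apply/funext => z; rewrite normrM (ger0_norm tau0) exprMn.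
  by rewrite (ExZ _ _ _ i4) ler_wpM2l ?exprn_ge0// (le_trans _ e4)// ler_norm.
have b2 : `|Ex (@gauss R) (fun z => psi (t + tau * z)) - psi t -
    d2 t / (2 * s k ^+ 2) * tau ^+ 2| <= 4 * M * CH * `|(s k)^-1| ^+ 3 * (tau ^+ 3 * CH).
  rewrite -E2; apply: (le_trans (Ex_taylor (@gauss R) _ _ _ _ _ _ _ mpsi psiM K0 tay' Z2 Z3 EZ0)).
  by rewrite ler_wpM2l ?mulr_ge0 ?exprn_ge0.
(* The Gaussian that replaces one variable is absorbed by [gconv_conv], which raises the level from
   k to k + 1. *)
have sk1 : gconv (s k.+1) phi t = Ex (@gauss R) (fun z => psi (t + tau * z)).
  rewrite -[RHS]/(gconv tau psi t) (gconv_conv phi M mphi phiM)//; last exact: ltW.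
  suff -> : tau ^+ 2 + s k ^+ 2 = h ^+ 2 + k.+1%:R * tau ^+ 2 by [].
  rewrite /s sqr_sqrtr; last by rewrite addr_ge0 ?sqr_ge0// mulr_ge0// sqr_ge0.
  by rewrite -natr1; ring.
have s3 : `|(s k)^-1| ^+ 3 <= (h ^+ 3)^-1.
  rewrite gtr0_norm ?invr_gt0// exprVn lef_pV2 ?posrE ?exprn_gt0//.
  by rewrite lerXn2r ?nnegrE ?(ltW h0) ?(ltW s0).
rewrite sk1 -(sqr_L2n P (X 0%N)) -/tau in b1 *.
set u := Ex P _ in b1 *; set v := Ex gauss _ in b2 *.
set w := d2 t / _ * _ in b1 b2.
have -> : u - v = (u - psi t - w) - (v - psi t - w) by ring.
apply: (le_trans (ler_normB _ _)); apply: (le_trans (lerD b1 b2)).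
rewrite -mulrDr /D; apply: ler_wpM2r.
  by rewrite addr_ge0 ?mulr_ge0 ?exprn_ge0// Ex_ge0// => x; rewrite exprn_ge0.
by rewrite ler_wpM2l.
Qed.

Lemma lindeberg q : `|Ex P (fun x => gconv h phi (\sum_(i < q) X i x)) -
  gconv (Num.sqrt (h ^+ 2 + q%:R * L2n P (X 0%N) ^+ 2)) phi 0| <= q%:R * D.
Proof.
have [X2 _ _ indep _] := lX.
have mS j : measurable_fun setT (fun x => \sum_(i < j) X i x).
  by case: (sq_int_sum P _ (index_enum 'I_j) xpredT (fun i => X i) (fun i => X2 i)).
(* Generalised over the level: removing the last variable passes from (k, j+1) to (k+1, j), so k + j
   is preserved. *)
suff key j k : `|Ex P (fun x => gconv (s k) phi (\sum_(i < j) X i x)) - gconv (s (k + j)%N) phi 0| <= j%:R * D.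
  have := key q 0%N; by rewrite add0n /s mul0r addr0 sqrtr_sqr (gtr0_norm h0).
have mg k' : measurable_fun (setT : set RR) (gconv (s k') phi : RR -> RR) := measurable_gconv phi M mphi phiM _.
have gM k' x : `|gconv (s k') phi x| <= M := gconv_le phi M mphi phiM _ x.
elim: j k => [|j ih] k.
  rewrite mul0r addn0 (_ : (fun x => _) = fun=> gconv (s k) phi 0) ?Ex_cst ?subrr ?normr0//.
  by apply/funext => x; rewrite big_ord0.
have := ih k.+1; rewrite addSnnS => ihk.
rewrite (_ : (fun x => _) = (fun x => gconv (s k) phi (\sum_(i < j) X i x + X j x))); last first.
  by apply/funext => x; rewrite big_ord_recr.
rewrite (indep j _ M (mg k) (gM k)).
have i1 : rint P (fun x => gconv (s k.+1) phi (\sum_(i < j) X i x)).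
  by apply: (rint_bounded _ _ M) => //; exact: (measurableT_comp (mg k.+1) (mS j)).
have mX0 : measurable_fun setT (X 0%N) := (X2 0%N).1.
have mh : measurable_fun setT (fun z : T * T => gconv (s k) phi (\sum_(i < j) X i z.1 + X 0%N z.2)).
  apply: (measurableT_comp (mg k)); apply: measurable_funD.
    exact: (measurableT_comp (mS j) measurable_fst).
  exact: (measurableT_comp mX0 measurable_snd).
have i2 : rint P (fun x => Ex P (fun y => gconv (s k) phi (\sum_(i < j) X i x + X 0%N y))).
  apply: (rint_bounded _ _ M).
    exact: (measurable_Ex2 P P _ M mh (fun z => gM k _)).
  move=> x; apply: Ex_norm_le_bound => //.
  apply: (rint_bounded _ _ M) => //; apply: (measurableT_comp (mg k)).
  exact: measurable_funD.
set E1 := Ex P _; set E2 := gconv _ _ _ in ihk *; set E3 := Ex P _ in ihk.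
have -> : E1 - E2 = (E1 - E3) + (E3 - E2) by ring.
rewrite -natr1 mulrDl mul1r addrC (le_trans (ler_normD _ _))// lerD//.
rewrite /E1 /E3 -(ExB _ _ _ i2 i1); apply: Ex_norm_le_bound; first exact: rintB.
by move=> x; exact: step_bound.
Qed.

End step.

End lindeberg.

Section clt.
Context {R : realType} {d : measure_display} {T : measurableType d}.
Variable P : probability T R.
Local Notation RR := (measurableTypeR R).
Local Notation CH := (@gauss_const R).
Variables (phi : R -> R) (M : R).
Hypothesis cphi : continuous phi.
Hypothesis phiM : forall x, `|phi x| <= M.

Let mphi : measurable_fun (setT : set RR) (phi : RR -> RR).
Proof. exact: continuous_measurable_fun. Qed.

Let M0 : 0 <= M. Proof. exact: le_trans (phiM 0). Qed.

(** Here h depends on V but on neither the space nor Y, so one h serves a whole sequence and its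
    Gaussian limit. Large values of Y are controlled by Chebyshev. *)
Lemma Ex_gconv_close (V e : R) : 0 < e -> exists2 h : R, 0 < h &
  forall d' (T' : measurableType d') (Q : probability T' R) (Y : T' -> R), sq_int Q Y ->
    Ex Q (fun x => Y x ^+ 2) <= V ->
    `|Ex Q (fun x => gconv h phi (Y x)) - Ex Q (fun x => phi (Y x))| <= e.
Proof.
move=> e0; have e2 : 0 < e / 2 by rewrite divr_gt0.
(* Chosen so that 2MV/N^2 <= e/2, using N <= N^2. *)
pose N := 1 + 4 * M * `|V| / e.
have N1 : 1 <= N by rewrite lerDl divr_ge0 ?mulr_ge0// ltW.
have N0 : 0 < N := lt_le_trans ltr01 N1.
have [h h0 hh] := gconv_close phi M N _ cphi phiM e2.
exists h => // d' T' Q Y Y2 YV.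
have mg := measurable_gconv phi M mphi phiM h; have gM := gconv_le phi M mphi phiM h.
have i1 : rint Q (fun x => gconv h phi (Y x)).
  by apply: (rint_bounded _ _ M) => //; exact: (measurableT_comp mg Y2.1).
have i2 : rint Q (fun x => phi (Y x)).
  by apply: (rint_bounded _ _ M) => //; exact: (measurableT_comp mphi Y2.1).
rewrite -(ExB _ _ _ i1 i2); have i3 := rintB _ _ _ i1 i2.
apply: (le_trans (Ex_norm_le _ _ i3)).
have i4 := rintD _ _ _ (rint_cst Q (e / 2)) (rintZ _ (2 * M / N ^+ 2) _ Y2.2).
apply: (@le_trans _ _ (Ex Q (fun x => e / 2 + 2 * M / N ^+ 2 * Y x ^+ 2))).
  apply: Ex_le; [exact: rint_norm|exact: i4|move=> x].
  have k0 : 0 <= 2 * M / N ^+ 2 by rewrite divr_ge0 ?sqr_ge0 ?mulr_ge0.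
  have [YN|YN] := leP `|Y x| N.
    by apply: (le_trans (hh _ _ h0 (lexx _) YN)); rewrite lerDl mulr_ge0 ?sqr_ge0.
  apply: (@le_trans _ _ (2 * M)).
    by rewrite (le_trans (ler_normB _ _))// mulr_natl mulr2n lerD.
  rewrite -[leLHS]add0r lerD ?(ltW e2)// mulrAC ler_pdivlMr ?exprn_gt0//.
  rewrite ler_wpM2l ?mulr_ge0// -[leRHS]ger0_norm ?sqr_ge0// normrX.
  by rewrite lerXn2r ?nnegrE ?(ltW N0)// ltW.
rewrite (ExD _ _ _ (rint_cst Q _) (rintZ _ _ _ Y2.2)) Ex_cst (ExZ _ _ _ Y2.2).
rewrite [leRHS](_ : e = e / 2 + e / 2); last by field.
rewrite lerD2l.
apply: (@le_trans _ _ (2 * M / N ^+ 2 * `|V|)).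
  rewrite ler_wpM2l ?divr_ge0 ?sqr_ge0 ?mulr_ge0//.
  exact: le_trans YV (ler_norm _).
rewrite mulrAC ler_pdivrMr ?exprn_gt0//.
have : 4 * M * `|V| / e <= N ^+ 2.
  by apply: (@le_trans _ _ N); [rewrite /N lerDr|rewrite expr2 ler_peMr// ltW].
rewrite ler_pdivrMr//; lra.
Qed.

(** Both sides are averages of the Lipschitz function [gconv h phi], at az and at bz for the same
    Gaussian z, which differ by |a - b| |z|. *)
Lemma gconv_sd_lip (h a b : R) : 0 < h -> 0 <= a -> 0 <= b ->
  `|gconv (Num.sqrt (h ^+ 2 + a ^+ 2)) phi 0 - gconv (Num.sqrt (h ^+ 2 + b ^+ 2)) phi 0| <=
    6 * M * CH / h * CH * `|a - b|.
Proof.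
move=> h0 a0 b0.
rewrite ![h ^+ 2 + _]addrC -!(gconv_conv phi M mphi phiM _ _ _ (ltW h0))//.
have mg := measurable_gconv phi M mphi phiM h; have gM := gconv_le phi M mphi phiM h.
have ia := gconv_rint _ M mg gM a 0; have ib := gconv_rint _ M mg gM b 0.
rewrite /(gconv a) /(gconv b) -(ExB _ _ _ ia ib).
have [i1 b1] : rint (@gauss R) (fun z => `|z|) /\ `|Ex (@gauss R) (fun z => `|z|)| <= CH.
  have mn : measurable_fun setT (fun z : RR => `|z|) by exact: measurableT_comp.
  by apply: gauss_moment_le => // z; have [_ hz _ _] := gauss_env_ge z; rewrite normr_id.
have i3 := rintB _ _ _ ia ib.
apply: (le_trans (Ex_norm_le _ _ i3)).
pose k := 6 * M * CH / h * `|a - b|.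
have c0 : 0 <= CH by exact: le_trans (gauss_const_ge1 (R := R)).
have k0 : 0 <= k by rewrite !mulr_ge0// invr_ge0 ltW.
apply: (@le_trans _ _ (Ex gauss (fun z => k * `|z|))).
  apply: Ex_le; [exact: rint_norm|exact: (rintZ _ k _ i1)|move=> z].
  have := gconv_lip phi M mphi phiM h h0 (0 + b * z) ((a - b) * z).
  rewrite (_ : 0 + b * z + (a - b) * z = 0 + a * z); last by ring.
  by rewrite normrM mulrA.
rewrite (ExZ _ _ _ i1) (_ : _ * CH * _ = k * CH); last by rewrite /k; ring.
by apply: ler_wpM2l => //; exact: le_trans (ler_norm _) b1.
Qed.

(** The array may depend on n and on the precision e. It need not have the variance s^2 itself: its
    L2 norm is within e of that of Y_n, which converges to s. *)
Lemma central_limit (Y : nat -> T -> R) (s : R) :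
  (forall n, sq_int P (Y n)) -> L2n P (Y n) @[n --> \oo] --> s ->
  (forall e, 0 < e -> \forall n \near \oo, exists q X, [/\ lindeberg_array P X,
     L2n P (fun x => Y n x - \sum_(i < q) X i x) <= e &
     q%:R * (Ex P (fun x => `|X 0%N x| ^+ 3) + L2n P (X 0%N) ^+ 3 * CH) <= e]) ->
  Ex P (fun x => phi (Y n x)) @[n --> \oo] --> gauss_expect s phi.
Proof.
move=> Y2 Ys approx.
have s0 : 0 <= s.
  rewrite -oppr_le0; apply: (cvg_le_bound (fun n => - L2n P (Y n))); first exact: cvgN.
  by move=> n; rewrite oppr_le0 L2n_ge0.
rewrite (gauss_expect_gconv phi M mphi phiM s s0).
apply/cvgrPdist_le => e e0; have e8 : 0 < e / 8 by rewrite divr_gt0.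
have [h h0 close] := Ex_gconv_close ((s + 1) ^+ 2) _ e8.
have c1 := gauss_const_ge1 (R := R); have c0 : 0 <= CH by exact: le_trans c1.
pose Lp := 6 * M * CH / h; pose D := 4 * M * CH / h ^+ 3.
have Lp0 : 0 <= Lp by rewrite !mulr_ge0// invr_ge0 ltW.
have D0 : 0 <= D by rewrite !mulr_ge0// invr_ge0 exprn_ge0// ltW.
(* Collects the coefficients of e' in the comparisons below. These cost at most e/2 together, and
   the two removals of the smoothing e/8 each. *)
pose k := Lp + Lp * CH * 2 + D + 1.
have LC0 : 0 <= Lp * CH by rewrite mulr_ge0.
have k0 : 0 < k by rewrite /k; lra.
pose e' := Num.min 1 (e / 2 / k).
have e'0 : 0 < e' by rewrite lt_min ltr01 !divr_gt0.
have e'1 : e' <= 1 by rewrite ge_min lexx.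
have e'k : e' * k <= e / 2 by rewrite -ler_pdivlMr// ge_min lexx orbT.
have mg := measurable_gconv phi M mphi phiM h; have gM := gconv_le phi M mphi phiM h.
move/cvgrPdist_le/(_ _ e'0) : Ys => Ys; have := approx _ e'0; apply: filterS2 Ys.
move=> n sn [q [X [lX YX qX]]].
set Sq := fun x => \sum_(i < q) X i x in YX.
have X2 : forall i, sq_int P (X i) by case: lX.
have S2 : sq_int P Sq by exact: sq_int_sum.
have Lq := lindeberg P phi M h mphi phiM h0 X lX q.
have L2S := lindeberg_array_L2 P X q lX.
rewrite -(sqr_L2n P (X 0%N)) -(sqr_L2n P Sq) in L2S; rewrite -L2S in Lq.
set b := L2n P Sq in Lq L2S; have b0 : 0 <= b by exact: L2n_ge0.
have snb : `|s - b| <= e' + e'.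
  have -> : s - b = (s - L2n P (Y n)) + (L2n P (Y n) - b) by ring.
  by rewrite (le_trans (ler_normD _ _))// lerD// (le_trans _ YX)//; exact: L2n_dist.
have t1 : `|Ex P (fun x => gconv h phi (Y n x)) - Ex P (fun x => phi (Y n x))| <= e / 8.
  apply: close => //; rewrite -sqr_L2n lerXn2r ?nnegrE ?L2n_ge0 ?addr_ge0//.
  by move: sn; rewrite ler_norml => /andP[h1 h2]; lra.
have t2 : `|Ex P (fun x => gconv h phi (Y n x)) - Ex P (fun x => gconv h phi (Sq x))| <= Lp * e'.
  have i1 : rint P (fun x => gconv h phi (Y n x)).
    by apply: (rint_bounded _ _ M) => //; exact: (measurableT_comp mg (Y2 n).1).
  have i2 : rint P (fun x => gconv h phi (Sq x)).
    by apply: (rint_bounded _ _ M) => //; exact: (measurableT_comp mg S2.1).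
  have YS2 := sq_intB _ _ _ (Y2 n) S2; have iYS := rint_norm _ _ (sq_int_rint _ _ YS2).
  rewrite -(ExB _ _ _ i1 i2); have i3 := rintB _ _ _ i1 i2.
  apply: (le_trans (Ex_norm_le _ _ i3)).
  apply: (@le_trans _ _ (Ex P (fun x => Lp * `|Y n x - Sq x|))).
    apply: Ex_le; [exact: rint_norm|exact: (rintZ _ Lp _ iYS)|move=> x].
    have := gconv_lip phi M mphi phiM h h0 (Sq x) (Y n x - Sq x).
    by rewrite (addrC (Sq x)) subrK.
  rewrite (ExZ _ _ _ iYS) ler_wpM2l// (le_trans _ YX)//; exact: Ex_norm_L2n.
have t3 : `|Ex P (fun x => gconv h phi (Sq x)) - gconv (Num.sqrt (h ^+ 2 + b ^+ 2)) phi 0| <= D * e'.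
  by apply: (le_trans Lq); rewrite mulrCA ler_wpM2l.
have t4 : `|gconv (Num.sqrt (h ^+ 2 + s ^+ 2)) phi 0 - gconv (Num.sqrt (h ^+ 2 + b ^+ 2)) phi 0| <=
    Lp * CH * (e' + e').
  by apply: (le_trans (gconv_sd_lip h s b h0 s0 b0)); rewrite ler_wpM2l.
have t5 : `|gconv (Num.sqrt (h ^+ 2 + s ^+ 2)) phi 0 - gconv s phi 0| <= e / 8.
  have E0 : (fun z : RR => 0 + s * z) = (fun z => s * z) by apply/funext => z; rewrite add0r.
  have [Z2 E2] := gauss_second_moment s; rewrite -E0 in Z2.
  have {}E2 : Ex (@gauss R) (fun z => (0 + s * z) ^+ 2) = s ^+ 2.
    by rewrite -[RHS]E2; congr (Ex _ _); apply/funext => z; rewrite add0r.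
  have := close _ _ (@gauss R) (fun z => 0 + s * z) Z2.
  rewrite -[X in `|X - _|]/(gconv s (gconv h phi) 0) -[X in `|_ - X|]/(gconv s phi 0).
  rewrite (gconv_conv phi M mphi phiM)//; last exact: ltW.
  rewrite (addrC (s ^+ 2)); apply.
  by rewrite E2 lerXn2r ?nnegrE ?addr_ge0// lerDl.
have key (u1 u2 u3 u4 u5 u6 : R) : `|u2 - u1| <= e / 8 -> `|u2 - u3| <= Lp * e' ->
    `|u3 - u4| <= D * e' -> `|u5 - u4| <= Lp * CH * (e' + e') -> `|u5 - u6| <= e / 8 ->
    `|u6 - u1| <= e.
  move: e'k; rewrite /k !ler_norml => e'k /andP[? ?] /andP[? ?] /andP[? ?] /andP[? ?] /andP[? ?].
  by apply/andP; split; nra.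
exact: key t1 t2 t3 t4 t5.
Qed.

End clt.

(** * Variance of sums with summable autocovariances *)

Section stationary_variance.
Context {R : realType} {d : measure_display} {T : measurableType d}.
Variable P : probability T R.
Variables (H : nat -> T -> R).
Hypothesis H2 : forall i, sq_int P (H i).

Lemma variance_step (c : pred nat) n :
  Ex P (fun x => (\sum_(i < n.+1 | c i) H i x) ^+ 2) =
  Ex P (fun x => (\sum_(i < n | c i) H i x) ^+ 2) +
  (c n)%:R * (2 * (\sum_(i < n | c i) Ex P (fun x => H i x * H n x)) + Ex P (fun x => H n x ^+ 2)).
Proof.
case cn : (c n); last first.
  rewrite mul0r addr0; congr (Ex _ _); apply/funext => x.
  by rewrite big_mkcond big_ord_recr/= cn addr0 -big_mkcond.
have S2 := sq_int_sum P _ (index_enum 'I_n) (fun i : 'I_n => c i) (fun i : 'I_n => H i) (fun i => H2 i).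
have iSH := sq_int_mul _ _ _ S2 (H2 n).
have e1 : \sum_(i < n | c i) Ex P (fun x => H i x * H n x) =
    Ex P (fun x => (\sum_(i < n | c i) H i x) * H n x).
  rewrite -(Ex_sum P _ (index_enum 'I_n) (fun i : 'I_n => c i) (fun i x => H i x * H n x)).
    by congr (Ex _ _); apply/funext => x; rewrite mulr_suml.
  by move=> i; exact: sq_int_mul.
rewrite e1 mul1r addrA -(ExZ _ _ _ iSH) -(ExD _ _ _ S2.2 (rintZ _ 2 _ iSH)).
rewrite -(ExD _ _ _ (rintD _ _ _ S2.2 (rintZ _ 2 _ iSH)) (H2 n).2).
congr (Ex _ _); apply/funext => x.
rewrite big_mkcond big_ord_recr/= cn -big_mkcond; ring.
Qed.

Lemma sum_rev_ord (r : nat -> R) n : \sum_(i < n) r (n - i)%N = \sum_(i < n) r i.+1.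
Proof.
rewrite (reindex_inj rev_ord_inj)/=; apply: eq_bigr => i _; congr r.
by rewrite subKn.
Qed.

(** Each selected index contributes at most twice the sum of all autocovariance bounds. The result
    is proportional to the number of selected indices, which keeps the gaps between blocks
    negligible. *)
Lemma variance_le (r : nat -> R) (Theta : R) (c : pred nat) n :
  (forall i j, (i <= j)%N -> `|Ex P (fun x => H i x * H j x)| <= r (j - i)%N) ->
  (forall n, \sum_(k < n) r k <= Theta) ->
  Ex P (fun x => (\sum_(i < n | c i) H i x) ^+ 2) <= 2 * Theta * (\sum_(i < n) (c i)%:R).
Proof.
move=> Hr rT; have r0 k : 0 <= r k by have := Hr 0%N k (leq0n k); rewrite subn0; exact: le_trans.
elim: n => [|n ih].
  rewrite big_ord0 mulr0 -[leRHS](Ex_cst P) le_eqVlt; apply/orP; left; apply/eqP.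
  by congr (Ex _ _); apply/funext => x; rewrite big_ord0 expr0n.
rewrite variance_step big_ord_recr/= [leRHS]mulrDr lerD// [leRHS]mulrC ler_wpM2l//.
have h1 : \sum_(i < n | c i) Ex P (fun x => H i x * H n x) <= \sum_(i < n) r i.+1.
  rewrite -sum_rev_ord big_mkcond; apply: ler_sum => i _; case: ifP => _ //.
  by apply: (le_trans (ler_norm _)); apply: Hr; exact/ltnW.
have h2 : Ex P (fun x => H n x ^+ 2) <= r 0%N.
  have := Hr n n (leqnn n); rewrite subnn; apply: le_trans; apply: (le_trans (ler_norm _)).
  by rewrite le_eqVlt; apply/orP; left; apply/eqP; congr `|Ex _ _|; apply/funext => x; rewrite expr2.
have := rT n.+1; rewrite big_ord_recl/= /bump/=; under eq_bigr do rewrite add1n.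
have := r0 0%N; lra.
Qed.

(** The increments of the variance of partial sums are 2 sum_(k <= n) rho_k - rho_0; they converge,
    and Cesaro's theorem gives the limit of the mean. *)
Lemma variance_cvg (rho : nat -> R) :
  (forall i j, (i <= j)%N -> Ex P (fun x => H i x * H j x) = rho (j - i)%N) ->
  cvgn (series rho) ->
  exists V : R, Ex P (fun x => (\sum_(i < n) H i x) ^+ 2) / n%:R @[n --> \oo] --> V.
Proof.
move=> Hr cr; pose V n := Ex P (fun x => (\sum_(i < n) H i x) ^+ 2).
pose u n := 2 * series rho n.+1 - rho 0%N.
have VS n : V n.+1 = V n + u n.
  rewrite /V (variance_step xpredT n) mul1r; congr (_ + _); rewrite /u /series/= big_mkord.
  under eq_bigr => i _ do rewrite (Hr _ _ (ltnW (ltn_ord i))).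
  rewrite sum_rev_ord big_ord_recl/= /bump/=; under [in RHS]eq_bigr do rewrite add1n.
  rewrite (_ : Ex P (fun x => H n x ^+ 2) = rho 0%N); first by ring.
  have := Hr n n (leqnn n); rewrite subnn => <-.
  by congr (Ex _ _); apply/funext => x; rewrite expr2.
have V0 : V 0%N = 0.
  by rewrite /V -[RHS](Ex_cst P); congr (Ex _ _); apply/funext => x; rewrite big_ord0 expr0n.
exists (2 * limn (series rho) - rho 0%N).
have cu : u n @[n --> \oo] --> 2 * limn (series rho) - rho 0%N.
  apply: cvgB; last exact: cvg_cst; apply: cvgM; first exact: cvg_cst.
  by have := cr; rewrite -(cvg_shiftS (series rho)).
have := cesaro cu; rewrite /arithmetic_mean => ha.
have : (fun n => V n.+1 / n.+1%:R) @ \oo --> 2 * limn (series rho) - rho 0%N.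
  apply: cvg_trans ha; apply: near_eq_cvg; near=> n.
  rewrite /= mulrC; congr (_ * _); rewrite /series/=.
  have -> : V n.+1 = \sum_(0 <= i < n.+1) (V i.+1 - V i) by rewrite telescope_sumr// V0 subr0.
  by apply: eq_bigr => i _; rewrite VS addrC addKr.
by rewrite (cvg_shiftS (fun n => V n / n%:R)).
Unshelve. all: by end_near. Qed.

End stationary_variance.

Opaque psum lp_norm Zp dlp.

Lemma cvg0_small {R : realType} (u : nat -> R) (c e : R) :
  u n @[n --> \oo] --> (0 : R) -> 0 < e -> exists N, c * u N <= e.
Proof.
move=> u0 e0; have cu : c * u n @[n --> \oo] --> (0 : R).
  by rewrite -(mulr0 c); apply: cvgM => //; exact: cvg_cst.
move/cvgrPdist_le/(_ e e0) : cu => [N _ /(_ N (leqnn N))].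
by rewrite sub0r normrN => h; exists N; exact: le_trans (ler_norm _) h.
Qed.

Section block_sums.
Context {R : realType}.
Variables (L m : nat).
Local Notation B := (L + m)%N.
Hypothesis L0 : (0 < L)%N.

Definition in_block q i := (i < q * B)%N && (i %% B < L)%N.

Lemma block_sum (a : nat -> R) q r :
  \sum_(i < q * B + r | in_block q i) a i = \sum_(j < q) \sum_(i < L) a (j * B + i)%N.
Proof.
have B0 : (0 < B)%N by rewrite addn_gt0 L0.
rewrite big_mkcond big_split_ord/= [X in _ + X]big1 ?addr0; last first.
  by move=> i _; rewrite /in_block ltnNge leq_addr.
transitivity (\sum_(i < q * B) if (i %% B < L)%N then a i else 0).
  by apply: eq_bigr => i _; rewrite /in_block ltn_ord.
elim: q => [|q ih]; first by rewrite mul0n !big_ord0.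
rewrite mulSnr big_split_ord/= ih big_ord_recr/=; congr (_ + _).
rewrite big_split_ord/= [X in _ + X]big1 ?addr0; last first.
  by move=> i _; rewrite modnMDl modn_small ?ltn_add2l// ltnNge leq_addr.
apply: eq_bigr => i _; rewrite modnMDl modn_small ?ltn_ord//.
by rewrite (leq_trans (ltn_ord i))// leq_addr.
Qed.

Lemma gap_count q r : \sum_(i < q * B + r) (~~ in_block q i)%:R = (q * m + r)%:R :> R.
Proof.
have h1 : \sum_(i < q * B + r) (in_block q i)%:R = (q * L)%:R :> R.
  under eq_bigr do rewrite mulrb.
  rewrite -big_mkcond (block_sum (fun=> 1) q r).
  under eq_bigr do rewrite sumr_const card_ord.
  by rewrite sumr_const card_ord -mulrnA mulnC.
have h2 : \sum_(i < q * B + r) ((~~ in_block q i)%:R + (in_block q i)%:R) = (q * B + r)%:R :> R.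
  rewrite -[in RHS](card_ord (q * B + r)) -sumr_const; apply: eq_bigr => i _.
  by case: (in_block q i); rewrite ?add0r ?addr0.
rewrite big_split/= h1 in h2; apply: (@addIr _ (q * L)%:R).
by rewrite h2 -natrD mulnDr -addnA addnC.
Qed.

End block_sums.

(** * Block decomposition for exponentially Lipschitz functions *)

Section explip_clt.
Context {R : realType}.
Variables (p : R) (p1 : 1 <= p) (w : nat -> R).
Local Notation S := (lp_borel p1).
Local Notation W := (Wprod w).
Hypothesis w_gt0 : forall n, 0 < w n.+1.
Hypothesis w_bnd : exists M, forall n, w n.+1 <= M.
Hypothesis W_sum : (\sum_(n <oo) (W n.+1 `^ (- p))%:E < +oo)%E.
Local Notation T := (Bw p1 w).
Local Notation y := (ycoord p p1 w).
Variables (A : R) (mu : probability S R).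
Hypothesis mu_iid : iid_law p p1 w A mu.
Hypothesis A_ge : 12 * Wsum p w <= A.

Let inv n := iterBw_invariant p p1 w w_gt0 A mu mu_iid w_bnd n.
Let mT n := measurable_iterBw p p1 w w_gt0 w_bnd n.
Let rintT n F := rint_iter p p1 w w_gt0 w_bnd A mu mu_iid n F.
Let ExT n F := Ex_iter p p1 w w_gt0 w_bnd A mu mu_iid n F.

Let sqT n F : sq_int mu F -> sq_int mu (fun x => F (iter n T x)).
Proof. exact: (sq_int_comp mu mu _ (mT n) (inv n)). Qed.

Definition local (B : nat) (U : S -> R) : Prop :=
  forall x z : S, (forall i, (i < B)%N -> y i x = y i z) -> U x = U z.

(** The terms with index below j read only coordinates below jB and the j-th reads only later ones,
    so a splice at jB separates them. *)
Lemma local_array B (U : S -> R) : sq_int mu U -> rint mu (fun x => `|U x| ^+ 3) ->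
  Ex mu U = 0 -> local B U -> lindeberg_array mu (fun j x => U (iter (j * B) T x)).
Proof.
move=> U2 U3 EU locU; have mU := U2.1.
have X2 j : sq_int mu (fun x => U (iter (j * B) T x)) by exact: sqT.
pose mx j (z : S * S) : S := mix p p1 (fun i => (j * B <= i)%N) z.1 z.2.
have mmx j : measurable_fun setT (mx j).
  exact: (measurable_mix p p1 w w_gt0 _ _ _ _ _ measurable_fst measurable_snd).
have mxlaw j (C : set S) : measurable C -> (mu \x mu)%E (mx j @^-1` C) = mu C.
  exact: (mix_law p p1 w w_gt0 A mu mu_iid).
have S2 j : sq_int mu (fun x => \sum_(i < j) U (iter (i * B) T x)).
  exact: (sq_int_sum mu _ (index_enum 'I_j) xpredT (fun (i : 'I_j) x => U (iter (i * B) T x))).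
have Smx j z : \sum_(i < j) U (iter (i * B) T (mx j z)) = \sum_(i < j) U (iter (i * B) T z.1).
  apply: eq_bigr => i _; apply: locU => k kB.
  rewrite !(ycoord_iterBw p p1 w w_gt0 w_bnd) ycoord_mix leqNgt.
  rewrite (_ : (i * B + k < j * B)%N)//; apply: (@leq_trans (i.+1 * B)).
    by rewrite mulSnr ltn_add2l.
  by rewrite leq_mul2r ltn_ord orbT.
have Xmx j z : U (iter (j * B) T (mx j z)) = U (iter (j * B) T z.2).
  apply: locU => k kB.
  by rewrite !(ycoord_iterBw p p1 w w_gt0 w_bnd) ycoord_mix leq_addr.
split => //.
- move=> j psi M mpsi psiM.
  have mh : measurable_fun setT (fun x => psi (\sum_(i < j) U (iter (i * B) T x) + U (iter (j * B) T x))).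
    apply: (measurableT_comp mpsi); apply: measurable_funD; first exact: (S2 j).1.
    exact: (X2 j).1.
  have ih := rint_bounded mu _ M mh (fun x => psiM _).
  rewrite -(Ex_comp (mu \x mu)%E mu _ (mmx j) (mxlaw j) _ ih).
  under [in LHS]eq_fun => z do rewrite Smx Xmx.
  pose hh (z : S * S) := psi (\sum_(i < j) U (iter (i * B) T z.1) + U (iter (j * B) T z.2)).
  have mhh : measurable_fun setT hh.
    apply: (measurableT_comp mpsi); apply: measurable_funD.
      exact: (measurableT_comp (S2 j).1 measurable_fst).
    exact: (measurableT_comp (X2 j).1 measurable_snd).
  transitivity (Ex mu (fun x => Ex mu (fun z => hh (x, z)))).
    exact: (Ex_Fubini mu mu hh M mhh (fun z => psiM _)).
  congr (Ex _ _); apply/funext => x; set t := \sum_(i < j) U (iter (i * B) T x).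
  have it : rint mu (fun z => psi (t + U z)).
    apply: (rint_bounded mu _ M) => [|z]; last exact: psiM.
    by apply: (measurableT_comp mpsi); apply: measurable_funD.
  exact: (ExT (j * B) (fun z => psi (t + U z)) it).
- move=> j; split; last first.
    by rewrite (ExT (j * B) (fun x => U x ^+ 2) U2.2) (ExT (0 * B) (fun x => U x ^+ 2) U2.2).
  have ih := sq_int_mul _ _ _ (S2 j) (X2 j).
  rewrite -(Ex_comp (mu \x mu)%E mu _ (mmx j) (mxlaw j) _ ih).
  under [in LHS]eq_fun => z do rewrite Smx Xmx.
  transitivity (Ex mu (fun x => \sum_(i < j) U (iter (i * B) T x)) * Ex mu (fun x => U (iter (j * B) T x))).
    exact: (Ex_prod mu mu _ _ (sq_int_rint _ _ (S2 j)) (sq_int_rint _ _ (X2 j))).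
  by rewrite (ExT (j * B) U (sq_int_rint _ _ U2)) EU mulr0.
Qed.

Variable beta : nat -> R.
Hypothesis betaP : forall k N, \sum_(i < N) ((W i)^-1 * (W (k + i))^-1) <= beta k.
Hypothesis cvg_beta : cvgn (series beta).

Let beta_ge0 k : 0 <= beta k.
Proof. by have := betaP k 0; rewrite big_ord0. Qed.

Let C0 := 12 * expZ_moment p p1 mu.

Let C0_ge0 : 0 <= C0.
Proof. by rewrite mulr_ge0//; exact: expZ_moment_ge0. Qed.

Let tail N := limn (series beta) - series beta N.

Let tail_cvg : tail N @[N --> \oo] --> (0 : R).
Proof. by rewrite -[X in _ --> X](subrr (limn (series beta))); apply: cvgB => //; exact: cvg_cst. Qed.

Let series_beta_le n N : \sum_(k < n) beta (N + k)%N <= tail N.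
Proof.
rewrite lerBrDl; have -> : series beta N + \sum_(k < n) beta (N + k)%N = series beta (N + n)%N.
  by rewrite /series/= !big_mkord big_split_ord.
apply: nondecreasing_cvgn_le => //; apply: nondecreasing_series => k _ _; exact: beta_ge0.
Qed.

Section stationary.
Variables (H : S -> R) (K : R).
Hypothesis hH : explip p p1 K H.
Hypothesis EH : Ex mu H = 0.

Let H2 : sq_int mu H.
Proof. exact: (explip_sq_int p p1 w w_gt0 w_bnd W_sum A mu mu_iid A_ge K H hH). Qed.

Lemma autocov_shift i j : (i <= j)%N ->
  Ex mu (fun x => H (iter i T x) * H (iter j T x)) =
  Ex mu (fun x => H (iter (j - i) T x) * H x).
Proof.
move=> ij; have iH := sq_int_mul _ _ _ (sqT (j - i) H H2) H2.
rewrite -(ExT i _ iH); congr (Ex _ _); apply/funext => x.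
by rewrite -iterD subnK// mulrC.
Qed.

Lemma autocov_le1 k : `|Ex mu (fun x => H (iter k T x) * H x)| <= Ex mu (fun x => H x ^+ 2).
Proof.
have Hk := sqT k H H2; have iH := sq_int_mul _ _ _ Hk H2.
have i2 := rintZ _ 2^-1 _ (rintD _ _ _ Hk.2 H2.2).
apply: (le_trans (Ex_norm_le _ _ iH)).
apply: (@le_trans _ _ (Ex mu (fun x => 2^-1 * (H (iter k T x) ^+ 2 + H x ^+ 2)))).
  apply: Ex_le => [||x]; [exact: rint_norm|exact: i2|].
  have l (a b : R) : `|a * b| <= 2^-1 * (a ^+ 2 + b ^+ 2).
    have := sqr_ge0 (a - b); have := sqr_ge0 (a + b).
    by rewrite ler_norml => h1 h2; apply/andP; split; nra.
  exact: l.
rewrite (ExZ _ _ _ (rintD _ _ _ Hk.2 H2.2)) (ExD _ _ _ Hk.2 H2.2).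
rewrite (ExT k (fun x => H x ^+ 2) H2.2); move: (Ex mu _) => e; lra.
Qed.

Lemma autocov_le2 k : `|Ex mu (fun x => H (iter k T x) * H x)| <= C0 * K ^+ 2 * beta k.
Proof.
have := covariance_bound p p1 w w_gt0 w_bnd W_sum A mu mu_iid A_ge H H K K k hH hH (beta k) (betaP k).
by rewrite EH mulr0 subr0 -[C0 * _ * _]mulrA expr2 !mulrA.
Qed.

(** Lags below N are bounded by the second moment of H, the others by the summable covariance bound.
    With N large and then H small in L2, the variance per term becomes small. *)
Lemma stationary_sum_le N (c : pred nat) n :
  Ex mu (fun x => (\sum_(i < n | c i) H (iter i T x)) ^+ 2) <=
  2 * (N%:R * Ex mu (fun x => H x ^+ 2) + C0 * K ^+ 2 * tail N) * (\sum_(i < n) (c i)%:R).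
Proof.
set V := Ex mu (fun x => H x ^+ 2); have V0 : 0 <= V by apply: Ex_ge0 => x; exact: sqr_ge0.
have D0 : 0 <= C0 * K ^+ 2 by rewrite mulr_ge0 ?sqr_ge0.
pose r k := if (k < N)%N then V else C0 * K ^+ 2 * beta k.
have r0 k : 0 <= r k by rewrite /r; case: ifP => // _; rewrite mulr_ge0.
apply: (variance_le mu (fun i x => H (iter i T x)) (fun i => sqT i H H2) r).
  move=> i j ij; rewrite autocov_shift// /r; case: ifP => _.
    exact: autocov_le1.
  exact: autocov_le2.
move=> k; apply: (@le_trans _ _ (\sum_(i < N + k) r i)).
  by rewrite addnC big_split_ord/= lerDl sumr_ge0.
rewrite big_split_ord/=; apply: lerD.
  rewrite mulr_natl -[X in _ *+ X]card_ord -sumr_const; apply: ler_sum => i _.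
  by rewrite /r ltn_ord.
apply: (@le_trans _ _ (\sum_(i < k) C0 * K ^+ 2 * beta (N + i)%N)).
  by apply: ler_sum => i _; rewrite /r ltnNge leq_addr.
by rewrite -mulr_sumr ler_wpM2l.
Qed.

End stationary.

Variables (f : S -> R) (K : R).
Hypothesis hf : explip p p1 K f.
Hypothesis Ef : Ex mu f = 0.

Let f2 : sq_int mu f.
Proof. exact: (explip_sq_int p p1 w w_gt0 w_bnd W_sum A mu mu_iid A_ge K f hf). Qed.

Let ftr m x := f (trunc p p1 m x).
Let cm m := Ex mu (ftr m).
Let Fm m x := ftr m x - cm m.

Let hftr m : explip p p1 K (ftr m).
Proof. exact: (explip_trunc p p1 w w_gt0 m K f hf). Qed.

Let ftr2 m : sq_int mu (ftr m).
Proof. exact: (explip_sq_int p p1 w w_gt0 w_bnd W_sum A mu mu_iid A_ge K _ (hftr m)). Qed.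

Let hFm m : explip p p1 K (Fm m).
Proof. exact: explipBcst (hftr m). Qed.

Let EFm m : Ex mu (Fm m) = 0.
Proof.
by rewrite /Fm (ExB _ _ _ (sq_int_rint _ _ (ftr2 m)) (rint_cst _ _)) Ex_cst subrr.
Qed.

Let Fm2 m : sq_int mu (Fm m).
Proof. exact: (explip_sq_int p p1 w w_gt0 w_bnd W_sum A mu mu_iid A_ge K _ (hFm m)). Qed.

Let localF m : local m (Fm m).
Proof.
move=> x z xz; have E : trunc p p1 m x = trunc p p1 m z.
  apply: (ycoord_inj p p1 w w_gt0) => i.
  by rewrite !ycoord_trunc; case: leqP => // im; exact: xz.
by rewrite /Fm /ftr E.
Qed.

Let Hm m x := f x - Fm m x.

(** The constant K + K is independent of m, so the lag N can be fixed before the truncation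
    level. *)
Let hHm m : explip p p1 (K + K) (Hm m).
Proof. exact: (explipD p p1 K K f _ hf (explipN p p1 K _ (hFm m))). Qed.

Let EHm m : Ex mu (Hm m) = 0.
Proof.
by rewrite /Hm (ExB _ _ _ (sq_int_rint _ _ f2) (sq_int_rint _ _ (Fm2 m))) Ef EFm subrr.
Qed.

(** Recentring subtracts the mean of the truncation error, which can only lower its second
    moment. *)
Let Hm_cvg : Ex mu (fun x => Hm m x ^+ 2) @[m --> \oo] --> (0 : R).
Proof.
have cv := explip_trunc_cvg p p1 w w_gt0 w_bnd W_sum A mu mu_iid A_ge K f hf.
apply: (squeeze_cvgr _ (cvg_cst 0) cv); near=> m.
apply/andP; split; first by apply: Ex_ge0 => x; exact: sqr_ge0.
have g2 := sq_intB _ _ _ f2 (ftr2 m); have ig := sq_int_rint _ _ g2.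
have i1 := rintZ _ (2 * cm m) _ ig.
have Eg : Ex mu (fun x => f x - ftr m x) = - cm m.
  by rewrite (ExB _ _ _ (sq_int_rint _ _ f2) (sq_int_rint _ _ (ftr2 m))) Ef sub0r.
have -> : (fun x => Hm m x ^+ 2) =
    (fun x => (f x - ftr m x) ^+ 2 + 2 * cm m * (f x - ftr m x) + cm m ^+ 2).
  by apply/funext => x; rewrite /Hm /Fm; ring.
rewrite (ExD _ _ _ (rintD _ _ _ g2.2 i1) (rint_cst _ _)) (ExD _ _ _ g2.2 i1) Ex_cst.
rewrite (ExZ _ _ _ ig) Eg.
have l (a b : R) : a + 2 * b * - b + b ^+ 2 <= a by have := sqr_ge0 b; nra.
exact: l.
Unshelve. all: by end_near. Qed.

Let Um L m x := \sum_(i < L) Fm m (iter i T x).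

Let Um2 L m : sq_int mu (Um L m).
Proof. by apply: sq_int_sum => i; exact: sqT. Qed.

Let EUm L m : Ex mu (Um L m) = 0.
Proof.
rewrite Ex_sum => [|i]; last exact: rintT (sq_int_rint _ _ (Fm2 m)).
by rewrite big1// => i _; rewrite (ExT i _ (sq_int_rint _ _ (Fm2 m))).
Qed.

(** The last of the L terms reads m coordinates starting at L - 1, so blocks started L + m apart
    read disjoint coordinates. *)
Let localU L m : local (L + m) (Um L m).
Proof.
move=> x z xz; apply: eq_bigr => i _; apply: localF => k km.
rewrite !(ycoord_iterBw p p1 w w_gt0 w_bnd); apply: xz.
by rewrite -addSn; apply: leq_add => //; exact: ltnW.
Qed.

Let Um3 L m : rint mu (fun x => `|Um L m x| ^+ 3).
Proof.
elim: L => [|L ih].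
  have := rint_cst mu 0; congr rint; apply/funext => x.
  by rewrite /Um big_ord0 normr0 expr0n.
have F3 : rint mu (fun x => `|Fm m (iter L T x)| ^+ 3).
  apply: (rintT L (fun x => `|Fm m x| ^+ 3)).
  exact: (explip_cube_int p p1 w w_gt0 w_bnd W_sum A mu mu_iid A_ge K _ (hFm m)).
apply: (rint_le _ _ _ _ (rintZ _ 8 _ (rintD _ _ _ ih F3))).
  by apply: measurable_funX; apply: measurableT_comp => //; exact: (Um2 L.+1 m).1.
move=> x; rewrite ger0_norm ?exprn_ge0// /Um big_ord_recr/=.
have l (a b : R) : `|a + b| ^+ 3 <= 8 * (`|a| ^+ 3 + `|b| ^+ 3).
  apply: (@le_trans _ _ ((`|a| + `|b|) ^+ 3)).
    by rewrite lerXn2r ?nnegrE ?addr_ge0// ler_normD.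
  move: (`|a|) (`|b|) (normr_ge0 a) (normr_ge0 b) => {}a {}b a0 b0.
  wlog ab : a b a0 b0 / a <= b => [hw|].
    by have [/hw|/ltW/hw] := leP a b; [exact|rewrite addrC [a ^+ 3 + _]addrC; exact].
  apply: (@le_trans _ _ ((2 * b) ^+ 3)).
    by rewrite lerXn2r ?nnegrE ?addr_ge0 ?mulr_ge0//; lra.
  by have := exprn_ge0 3 a0; rewrite exprMn; lra.
exact: l.
Qed.

Let Sf n x := \sum_(i < n) f (iter i T x).
Let Yf n x := Sf n x / Num.sqrt n%:R.

Let Sf2 n : sq_int mu (Sf n).
Proof. by apply: sq_int_sum => i; exact: sqT. Qed.

Let Yf2 n : sq_int mu (Yf n).
Proof.
have := sq_intZ mu (Num.sqrt n%:R)^-1 _ (Sf2 n); congr sq_int.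
by apply/funext => x; rewrite mulrC.
Qed.

(* n = q (L + m) + r: the sum of f is split into q independent blocks of length L of truncated *)
(* terms, the gaps of length m between them, the last r terms, and the truncation error.       *)
Let block_error (e : R) N L m q r : (0 < L)%N -> 0 <= e ->
  2 * (N%:R * Ex mu (fun x => Hm m x ^+ 2) + C0 * (K + K) ^+ 2 * tail N) <= e ^+ 2 ->
  2 * (C0 * K ^+ 2 * tail 0) * (q * m + r)%:R <= e ^+ 2 * (q * (L + m) + r)%:R ->
  L2n mu (fun x => Sf (q * (L + m) + r) x - \sum_(j < q) Um L m (iter (j * (L + m)) T x)) <=
  2 * e * Num.sqrt (q * (L + m) + r)%:R.
Proof.
move=> L0 e0 e1 e2; set n := (q * (L + m) + r)%N in e2 *.
pose c := in_block L m q.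
pose E1 x := \sum_(i < n) Hm m (iter i T x).
pose E2 x := \sum_(i < n | ~~ c i) Fm m (iter i T x).
have Hm2 : sq_int mu (Hm m) by exact: (explip_sq_int p p1 w w_gt0 w_bnd W_sum A mu mu_iid A_ge _ _ (hHm m)).
have E12 : sq_int mu E1 by apply: sq_int_sum => i; exact: sqT.
have E22 : sq_int mu E2 by apply: sq_int_sum => i; exact: sqT.
have -> : (fun x => Sf n x - \sum_(j < q) Um L m (iter (j * (L + m)) T x)) = (fun x => E1 x + E2 x).
  apply/funext => x.
  have -> : \sum_(j < q) Um L m (iter (j * (L + m)) T x) = \sum_(i < n | c i) Fm m (iter i T x).
    rewrite /n /c (block_sum L m L0 (fun i => Fm m (iter i T x)) q r).
    apply: eq_bigr => j _; apply: eq_bigr => i _.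
    exact: (congr1 (Fm m) (esym (etrans (congr1 (fun k => iter k T x) (addnC _ _)) (iterD i _ T x)))).
  have -> : E1 x = Sf n x - \sum_(i < n) Fm m (iter i T x).
    by rewrite /E1 /Sf -sumrB.
  rewrite [in RHS](bigID (fun i : 'I_n => c i))/= /E2.
  by rewrite opprD addrA subrK.
apply: (le_trans (L2n_triangle _ _ _ E12 E22)).
have sn := Num.Theory.sqrtr_ge0 (n%:R : R).
have sqn : Num.sqrt (n%:R : R) ^+ 2 = n%:R by rewrite sqr_sqrtr.
have l (a : R) : 0 <= a -> a ^+ 2 <= e ^+ 2 * n%:R -> a <= e * Num.sqrt n%:R.
  move=> a0 h; rewrite -(@ler_pXn2r _ 2)// ?nnegrE ?mulr_ge0//.
  by rewrite exprMn sqn.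
have h1 : L2n mu E1 <= e * Num.sqrt n%:R.
  apply: l; [exact: L2n_ge0|rewrite sqr_L2n].
  apply: (le_trans (stationary_sum_le (Hm m) (K + K) (hHm m) (EHm m) N xpredT n)).
  by rewrite sumr_const card_ord; apply: ler_wpM2r.
have h2 : L2n mu E2 <= e * Num.sqrt n%:R.
  apply: l; [exact: L2n_ge0|rewrite sqr_L2n].
  apply: (le_trans (stationary_sum_le (Fm m) K (hFm m) (EFm m) 0 (fun i => ~~ c i) n)).
  by rewrite mul0r add0r /n gap_count.
by apply: (le_trans (lerD h1 h2)); rewrite -mulrA [leRHS]mulr_natl mulr2n.
Qed.

(** The parameters are chosen in the order N, m, L, n: the lag cut, the truncation level, the block
    length against the gap m, and at last n against the fixed block. *)
Let approx e : 0 < e -> \forall n \near \oo, exists q X, [/\ lindeberg_array mu X,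
  L2n mu (fun x => Yf n x - \sum_(i < q) X i x) <= e &
  q%:R * (Ex mu (fun x => `|X 0%N x| ^+ 3) + L2n mu (X 0%N) ^+ 3 * @gauss_const R) <= e].
Proof.
move=> e0; pose e2 := e / 2; have e20 : 0 < e2 by rewrite divr_gt0.
have e22 : 0 < e2 ^+ 2 by rewrite exprn_gt0.
have e222 : 0 < e2 ^+ 2 / 2 by rewrite divr_gt0.
have [N tN] : exists N, 2 * (C0 * (K + K) ^+ 2 * tail N) <= e2 ^+ 2 / 2.
  have [N hN] := cvg0_small _ (2 * (C0 * (K + K) ^+ 2)) _ tail_cvg e222.
  by exists N; rewrite mulrA.
have [m Vm] : exists m, 2 * (N%:R * Ex mu (fun x => Hm m x ^+ 2)) <= e2 ^+ 2 / 2.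
  have [m hm] := cvg0_small _ (2 * N%:R) _ Hm_cvg e222.
  by exists m; rewrite mulrA.
pose Th := 2 * (C0 * K ^+ 2 * tail 0).
have arch (x : R) : exists n : nat, x <= n%:R.
  by exists (Num.truncn `|x|).+1; rewrite (le_trans (ler_norm x))// ltW// truncnS_gt.
have Th0 : 0 <= Th.
  have t0 : 0 <= tail 0 by have := series_beta_le 0 0; rewrite big_ord0.
  exact: (mulr_ge0 (ler0n _ 2) (mulr_ge0 (mulr_ge0 C0_ge0 (sqr_ge0 _)) t0)).
(* L so large that the gaps, a proportion m/(L + m) of all indices, use at most half of the allowed
   variance. *)
have [L1 hL1] := arch (2 * Th * m%:R / e2 ^+ 2).
pose L := L1.+1; pose B := (L + m)%N.
have L0 : (0 < L)%N by [].
have B0 : (0 < B)%N by rewrite addn_gt0.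
have hL : 2 * Th * m%:R <= e2 ^+ 2 * L%:R.
  apply: (@le_trans _ _ (e2 ^+ 2 * L1%:R)); first by rewrite [leRHS]mulrC -ler_pdivrMr.
  by apply: ler_wpM2l; [exact: ltW|rewrite ler_nat].
(* For n beyond n1 the fewer than B terms after the last block use at most the other half. *)
have [n1 hn1] := arch (2 * Th * B%:R / e2 ^+ 2).
pose Q := Ex mu (fun x => `|Um L m x| ^+ 3) + L2n mu (Um L m) ^+ 3 * @gauss_const R.
have gc0 : 0 <= @gauss_const R by exact: le_trans (gauss_const_ge1 (R := R)).
have Q0 : 0 <= Q.
  by rewrite addr_ge0 ?mulr_ge0 ?exprn_ge0 ?L2n_ge0// Ex_ge0// => x; rewrite exprn_ge0.
(* With q <= n blocks scaled by n^(-1/2), the third moments add up to at most Q n^(-1/2), which is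
   below e beyond n2. *)
have [n2 hn2] := arch ((Q / e) ^+ 2).
exists (maxn 1 (maxn n1 n2)) => // n /=.
rewrite !geq_max => /andP[n_gt0 /andP[n1n n2n]].
pose q := (n %/ B)%N; pose r := (n %% B)%N.
have nE : n = (q * B + r)%N by exact: divn_eq.
have rB : (r < B)%N by rewrite ltn_mod.
have nR : 0 < n%:R :> R by rewrite ltr0n.
pose s : R := Num.sqrt n%:R.
have s0 : 0 < s by rewrite sqrtr_gt0.
have s2 : s ^+ 2 = n%:R by rewrite sqr_sqrtr// ltW.
exists q, (fun j x => s^-1 * Um L m (iter (j * B) T x)).
have i3 : rint mu (fun x => `|s^-1 * Um L m x| ^+ 3).
  have := rintZ _ (s^-1 ^+ 3) _ (Um3 L m); congr rint; apply/funext => x.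
  by rewrite normrM (gtr0_norm (_ : 0 < s^-1)) ?invr_gt0// exprMn.
have EX3 : Ex mu (fun x => `|s^-1 * Um L m x| ^+ 3) = s^-1 ^+ 3 * Ex mu (fun x => `|Um L m x| ^+ 3).
  rewrite -(ExZ _ _ _ (Um3 L m)); congr (Ex _ _); apply/funext => x.
  by rewrite normrM (gtr0_norm (_ : 0 < s^-1)) ?invr_gt0// exprMn.
split.
- have u2 : sq_int mu (fun x => s^-1 * Um L m x) by exact: sq_intZ.
  have u0 : Ex mu (fun x => s^-1 * Um L m x) = 0.
    by rewrite (ExZ _ _ _ (sq_int_rint _ _ (Um2 L m))) EUm mulr0.
  have ul : local B (fun x => s^-1 * Um L m x).
    by move=> x z xz; rewrite (localU L m x z xz).
  exact: (local_array B _ u2 i3 u0 ul).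
- have -> : (fun x => Yf n x - \sum_(i < q) s^-1 * Um L m (iter (i * B) T x)) =
      (fun x => s^-1 * (Sf n x - \sum_(i < q) Um L m (iter (i * B) T x))).
    by apply/funext => x; rewrite -mulr_sumr mulrBr /Yf mulrC.
  have D2 : sq_int mu (fun x => Sf n x - \sum_(i < q) Um L m (iter (i * B) T x)).
    by apply: sq_intB => //; apply: sq_int_sum => i; exact: sqT.
  rewrite (L2nZ _ _ _ D2.2) gtr0_norm ?invr_gt0// mulrC ler_pdivrMr//.
  rewrite (_ : e = 2 * e2); last by rewrite /e2; field.
  rewrite /s nE; apply: (block_error e2 N L m q r L0 (ltW e20)).
    by rewrite mulrDr; apply: (le_trans (lerD Vm tN)); rewrite -splitr.
  rewrite -/Th -/B -nE natrD mulrDr.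
  have h1 : Th * (q * m)%:R <= e2 ^+ 2 / 2 * n%:R.
    rewrite natrM mulrCA; apply: (@le_trans _ _ (q%:R * (e2 ^+ 2 / 2 * L%:R))).
      by rewrite ler_wpM2l//; lra.
    rewrite mulrCA ler_wpM2l ?divr_ge0 ?sqr_ge0// -natrM ler_nat nE.
    by rewrite (leq_trans _ (leq_addr _ _))// leq_mul2l leq_addr orbT.
  have h2 : Th * r%:R <= e2 ^+ 2 / 2 * n%:R.
    apply: (@le_trans _ _ (Th * B%:R)); first by rewrite ler_wpM2l// ler_nat ltnW.
    have : 2 * Th * B%:R / e2 ^+ 2 <= n%:R by rewrite (le_trans hn1)// ler_nat.
    by rewrite ler_pdivrMr//; lra.
  by apply: (le_trans (lerD h1 h2)); rewrite -mulrDl -splitr.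
- rewrite EX3 (L2nZ _ _ _ (Um2 L m).2) (gtr0_norm (_ : 0 < s^-1)) ?invr_gt0//.
  have QE (a b g u : R) : u ^+ 3 * a + (u * b) ^+ 3 * g = u ^+ 3 * (a + b ^+ 3 * g) by ring.
  rewrite QE -/Q.
  have qn : q%:R <= s ^+ 2.
    by rewrite s2 ler_nat nE (leq_trans _ (leq_addr _ _))// leq_pmulr.
  have sQ : Q / e <= s.
    rewrite -(@ler_pXn2r _ 2)// ?nnegrE ?divr_ge0 ?(ltW s0) ?(ltW e0)//.
    by rewrite s2 (le_trans hn2)// ler_nat.
  apply: (@le_trans _ _ (s ^+ 2 * (s^-1 ^+ 3 * Q))).
    by rewrite ler_wpM2r// mulr_ge0// exprn_ge0// invr_ge0 ltW.
  have -> : s ^+ 2 * (s^-1 ^+ 3 * Q) = Q / s by field; rewrite gt_eqF.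
  by rewrite ler_pdivrMr// mulrC -ler_pdivrMr.
Qed.

Lemma explip_clt : exists s : R, 0 <= s /\ forall phi : R -> R, continuous phi ->
  (exists M : R, forall t, `|phi t| <= M) ->
  Ex mu (fun x => phi ((\sum_(i < n) f (iter i T x)) / Num.sqrt n%:R)) @[n --> \oo]
    --> gauss_expect s phi.
Proof.
pose rho k := Ex mu (fun x => f (iter k T x) * f x).
have [V VP] : exists V : R, Ex mu (fun x => Sf n x ^+ 2) / n%:R @[n --> \oo] --> V.
  apply: (variance_cvg mu (fun i x => f (iter i T x)) (fun i => sqT i f f2) rho).
    by move=> i j ij; rewrite (autocov_shift f K hf).
  apply: normed_cvg; apply: (series_le_cvg (v_ := fun k => C0 * K ^+ 2 * beta k)).
  - by move=> k; exact: normr_ge0.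
  - by move=> k; exact: (mulr_ge0 (mulr_ge0 C0_ge0 (sqr_ge0 _)) (beta_ge0 _)).
  - by move=> k; exact: (autocov_le2 f K hf Ef).
  - exact: is_cvg_seriesZ.
exists (Num.sqrt V); split; first exact: sqrtr_ge0.
move=> phi cphi [M phiM].
apply: (central_limit mu phi M cphi phiM Yf (Num.sqrt V) Yf2 _ approx).
have -> : (fun n => L2n mu (Yf n)) = (fun n => Num.sqrt (Ex mu (fun x => Sf n x ^+ 2) / n%:R)).
  apply/funext => n; congr (Num.sqrt _).
  rewrite mulrC -(ExZ _ _ _ (Sf2 n).2); congr (Ex _ _); apply/funext => x.
  by rewrite /Yf expr_div_n sqr_sqrtr// mulrC.
by apply: cvg_comp VP _; exact: sqrt_continuous.
Qed.

End explip_clt.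

(** * Rates of decay *)

Section power_sums.
Context {R : realType}.
Implicit Types (s t alpha : R) (k n N : nat).

Lemma ln_succ_ge k : (k.+2%:R : R)^-1 <= ln k.+2%:R - ln k.+1%:R.
Proof.
have x0 : 0 < k.+2%:R :> R by rewrite ltr0n.
have k0 : 0 < k.+1%:R :> R by rewrite ltr0n.
rewrite -ln_div ?posrE// -[leRHS]opprK -lnV ?posrE ?divr_gt0// lerNr invf_div.
have -> : k.+1%:R / k.+2%:R = 1 + - (k.+2%:R : R)^-1.
  have -> : k.+1%:R = k.+2%:R - 1 :> R by rewrite -[k.+2%:R]natr1 addrK.
  by rewrite mulrBl divff ?gt_eqF// mul1r.
apply: le_ln1Dx; rewrite ltrN2 invf_lt1// ltr1n//.
Qed.

Lemma powR_succE k t : k.+2%:R `^ t = k.+1%:R `^ t * expR (t * (ln (k.+2%:R : R) - ln k.+1%:R)).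
Proof.
rewrite /powR !pnatr_eq0/= -expRD; congr expR; ring.
Qed.

(** A discrete substitute for comparison with the integral of x^(t-1): the differences telescope.
    The factor 1/2 pays for (k+2)^t <= 2 (k+1)^t. *)
Lemma powR_incr t k : 0 < t -> t < 1 ->
  t / 2 * k.+1%:R `^ (t - 1) <= k.+1%:R `^ t - k%:R `^ t.
Proof.
move=> t0 t1; case: k => [|k].
  by rewrite !powR1 powR0 ?gt_eqF// subr0 mulr1; lra.
have k0 : 0 < k.+1%:R :> R by rewrite ltr0n.
have k2 : 0 < k.+2%:R :> R by rewrite ltr0n.
have e : k.+2%:R `^ (t - 1) = k.+2%:R `^ t / k.+2%:R.
  by rewrite powRB; [rewrite powRr1 ?ler0n|rewrite (gt_eqF k2) implybT].
have h1 : k.+1%:R `^ t * (t / k.+2%:R) <= k.+2%:R `^ t - k.+1%:R `^ t.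
  rewrite [in leRHS]powR_succE -[X in _ - X]mulr1 -mulrBr ler_wpM2l ?powR_ge0//.
  rewrite lerBrDl (le_trans _ (expR_ge1Dx _))// lerD2l ler_wpM2l ?(ltW t0)//.
  exact: ln_succ_ge.
apply: le_trans h1; rewrite e [leLHS](_ : _ = (k.+2%:R `^ t / 2) * (t / k.+2%:R)); last by ring.
rewrite ler_wpM2r ?divr_ge0 ?(ltW t0)// ler_pdivrMr//.
have le2 : k.+2%:R <= k.+1%:R * 2 :> R by rewrite -natrM ler_nat; lia.
apply: (@le_trans _ _ ((k.+1%:R * 2) `^ t)).
  by rewrite ge0_ler_powR ?nnegrE ?(ltW t0).
rewrite powRM ?ler0n// ler_wpM2l ?powR_ge0//.
by rewrite -[leRHS]powRr1// ler_powR ?ler1n// ltW.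
Qed.

Lemma powR_decr t k : t < 0 ->
  - t * k.+2%:R `^ (t - 1) <= k.+1%:R `^ t - k.+2%:R `^ t.
Proof.
move=> t0; have k0 : 0 < k.+1%:R :> R by rewrite ltr0n.
have k2 : 0 < k.+2%:R :> R by rewrite ltr0n.
have e : k.+2%:R `^ (t - 1) = k.+2%:R `^ t / k.+2%:R.
  by rewrite powRB; [rewrite powRr1 ?ler0n|rewrite (gt_eqF k2) implybT].
have e2 : k.+1%:R `^ t = k.+2%:R `^ t * expR (- t * (ln (k.+2%:R : R) - ln k.+1%:R)).
  by rewrite powR_succE -mulrA -expRD -mulrDl addrN mul0r expR0 mulr1.
rewrite e e2 mulrCA -[X in _ - X]mulr1 -mulrBr ler_wpM2l ?powR_ge0//.
rewrite lerBrDl (le_trans _ (expR_ge1Dx _))// lerD2l ler_wpM2l ?ln_succ_ge// oppr_ge0 ltW//.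
Qed.

Lemma powRN_anti (x z alpha : R) : 0 <= alpha -> 0 < x -> x <= z -> z `^ (- alpha) <= x `^ (- alpha).
Proof.
move=> a0 x0 xz; have z0 : 0 < z := lt_le_trans x0 xz.
by rewrite !powRN lef_pV2 ?posrE ?powR_gt0// ge0_ler_powR ?nnegrE ?(ltW x0) ?(ltW z0).
Qed.

Lemma sum_powR_head alpha n : 0 < alpha -> alpha < 1 ->
  \sum_(k < n) k.+1%:R `^ (- alpha) <= 2 / (1 - alpha) * n%:R `^ (1 - alpha).
Proof.
move=> a0 a1; have t0 : 0 < 1 - alpha by lra.
rewrite -ler_pdivrMl ?divr_gt0// invf_div mulr_sumr.
apply: (@le_trans _ _ (\sum_(0 <= k < n) (k.+1%:R `^ (1 - alpha) - k%:R `^ (1 - alpha)))).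
  rewrite big_mkord; apply: ler_sum => k _.
  have := powR_incr (1 - alpha) k t0; rewrite (_ : 1 - alpha - 1 = - alpha); last by ring.
  by apply; lra.
by rewrite telescope_sumr// powR0 ?gt_eqF// subr0.
Qed.

Lemma sum_powR_tail s n N : 1 < s ->
  \sum_(k < N) (n + k).+2%:R `^ (- s) <= n.+1%:R `^ (1 - s) / (s - 1).
Proof.
move=> s1; have t0 : 1 - s < 0 by lra.
rewrite ler_pdivlMr ?subr_gt0// mulr_suml.
apply: (@le_trans _ _ (\sum_(0 <= k < N) ((n + k).+1%:R `^ (1 - s) - (n + k.+1).+1%:R `^ (1 - s)))).
  rewrite big_mkord; apply: ler_sum => k _.
  have := powR_decr (1 - s) (n + k) t0; rewrite (_ : 1 - s - 1 = - s); last by ring.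
  by rewrite addnS opprB mulrC.
under eq_bigr do rewrite -opprB.
rewrite sumrN (telescope_sumr (fun k => (n + k).+1%:R `^ (1 - s)))// opprB addn0.
by rewrite gerBl powR_ge0.
Qed.

Lemma sum_powR_le s N : 1 < s -> \sum_(k < N) k.+1%:R `^ (- s) <= 1 + (s - 1)^-1.
Proof.
move=> s1; case: N => [|N]; first by rewrite big_ord0 addr_ge0// invr_ge0 subr_ge0 ltW.
rewrite big_ord_recl/= powR1 lerD2l.
have := sum_powR_tail s 0 N s1; rewrite powR1 mul1r; apply: le_trans.
by apply: ler_sum => k _; rewrite /bump add0n add1n.
Qed.

Lemma harmonic_le n : \sum_(k < n) (k.+1%:R : R)^-1 <= 2 * ln n.+1%:R.
Proof.
elim: n => [|n ih]; first by rewrite big_ord0 ln1 mulr0.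
rewrite big_ord_recr/=; have := ln_succ_ge n.
have : (n.+1%:R : R)^-1 <= 2 * (n.+2%:R : R)^-1.
  rewrite -[2]invrK -invfM lef_pV2 ?posrE ?mulr_gt0 ?invr_gt0 ?ltr0n//.
  rewrite mulrC ler_pdivrMr// -natrM ler_nat; lia.
have l (S u v a b : R) : S <= 2 * a -> u <= 2 * v -> v <= b - a -> S + u <= 2 * b by lra.
exact: l ih.
Qed.

Lemma sum_widen_le (h : nat -> R) n N : (forall k, 0 <= h k) ->
  \sum_(k < N) h k <= \sum_(k < n) h k + \sum_(k < N) h (n + k)%N.
Proof.
move=> h0; apply: (@le_trans _ _ (\sum_(k < n + N) h k)).
  by rewrite addnC big_split_ord/= lerDl sumr_ge0.
by rewrite big_split_ord.
Qed.

Lemma sum_powR_shift_le alpha n N : 1 < alpha ->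
  \sum_(k < N) (k.+1%:R `^ (- alpha) * (n + k).+1%:R `^ (- alpha)) <=
  (1 + (alpha - 1)^-1) * n.+1%:R `^ (- alpha).
Proof.
move=> a1; apply: (@le_trans _ _ (\sum_(k < N) k.+1%:R `^ (- alpha) * n.+1%:R `^ (- alpha))).
  apply: ler_sum => k _; rewrite ler_wpM2l ?powR_ge0//.
  by apply: powRN_anti; rewrite ?ltr0n ?ler_nat ?ltnS ?leq_addr//; lra.
by rewrite -mulr_suml ler_wpM2r ?powR_ge0//; exact: sum_powR_le.
Qed.

(** For alpha < 1 the sum is split at k = n: before it the second factor is about n^-alpha, after it
    the product is at most k^(-2 alpha). For alpha > 1 the second factor is bounded by n^-alpha
    throughout and the first is summable. *)
Lemma sum_cov_rate alpha : 2^-1 < alpha -> exists2 K : R, 0 <= K &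
  forall n N, (0 < n)%N ->
    \sum_(k < N) (k.+1%:R `^ (- alpha) * (n + k).+1%:R `^ (- alpha)) <= K * cov_rate alpha n.
Proof.
move=> a2; rewrite /cov_rate; case: (ltgtP alpha 1) => [a1|a1|->].
- exists (2 / (1 - alpha) + (2 * alpha - 1)^-1).
    by rewrite addr_ge0 ?divr_ge0 ?invr_ge0//; lra.
  case=> // n N _; set m := n.+1.
  have m0 : 0 < m%:R :> R by rewrite ltr0n.
  apply: (le_trans (sum_widen_le (fun k => k.+1%:R `^ (- alpha) * (m + k).+1%:R `^ (- alpha)) m N _)).
    by move=> k; rewrite mulr_ge0 ?powR_ge0.
  rewrite mulrDl; apply: lerD.
    apply: (@le_trans _ _ (\sum_(k < m) k.+1%:R `^ (- alpha) * m%:R `^ (- alpha))).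
      apply: ler_sum => k _; rewrite ler_wpM2l ?powR_ge0//.
      by apply: powRN_anti; rewrite ?ler_nat//; [lra|rewrite (leq_trans (leq_addr k _))].
    rewrite -mulr_suml (_ : 1 - 2 * alpha = (1 - alpha) + - alpha); last by ring.
    rewrite powRD ?(gt_eqF m0) ?implybT// mulrA ler_wpM2r ?powR_ge0//.
    by apply: sum_powR_head; lra.
  have h := sum_powR_tail (2 * alpha) n N; rewrite mulrC; apply: le_trans (h _); last lra.
  apply: ler_sum => k _; rewrite (_ : - (2 * alpha) = - alpha + - alpha); last by ring.
  rewrite powRD ?pnatr_eq0 ?implybT//; apply: ler_pM; rewrite ?powR_ge0 ?addSn//.
  by apply: powRN_anti; rewrite ?ltr0n ?ler_nat//; [lra|lia].
- exists (1 + (alpha - 1)^-1); first by rewrite addr_ge0// invr_ge0; lra.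
  move=> n N n0.
  apply: (le_trans (sum_powR_shift_le alpha n N a1)).
  rewrite ler_wpM2l ?addr_ge0 ?invr_ge0 ?subr_ge0 ?(ltW a1)//.
  by apply: powRN_anti; rewrite ?ltr0n ?ler_nat//; lra.
- exists 2 => // n N n0; have nR : 0 < n%:R :> R by rewrite ltr0n.
  rewrite mulrA ler_pdivlMr//; apply: le_trans (harmonic_le n).
  rewrite mulr_suml.
  (* At alpha = 1, partial fractions leave a difference of harmonic sums shifted by n, at most the
     n-th harmonic number. *)
  apply: (@le_trans _ _ (\sum_(k < N) (k.+1%:R^-1 - (n + k).+1%:R^-1))).
    apply: ler_sum => k _; rewrite !powR_inv1 ?ler0n//.
    have k1 : (k.+1%:R : R) != 0 by rewrite pnatr_eq0.
    have nk : ((n + k).+1%:R : R) != 0 by rewrite pnatr_eq0.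
    rewrite le_eqVlt; apply/orP; left; apply/eqP.
    have -> : n%:R = (n + k).+1%:R - k.+1%:R :> R by rewrite -natrB ?ltnS ?leq_addl// subSS addnK.
    move: (k.+1%:R : R) ((n + k).+1%:R : R) k1 nk => a b aN0 bN0.
    by field; rewrite ?aN0 ?bN0.
  have := sum_widen_le (fun k => (k.+1%:R : R)^-1) n N (fun k => _).
  by rewrite sumrB lerBlDr; apply => k; rewrite invr_ge0.
Qed.

End power_sums.

Section weights_growth.
Context {R : realType}.
Variables (w : nat -> R) (C alpha : R).
Local Notation W := (Wprod w).
Hypothesis w_gt0 : forall n, 0 < w n.+1.
Hypothesis C0 : 0 < C.
Hypothesis a2 : 2^-1 < alpha.
Hypothesis W_ge : forall n, C * n.+1%:R `^ alpha <= W n.+1.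

(** Passing from n^alpha to (n+1)^alpha makes the bound meaningful at n = 0. The factor 2^-alpha in
    c pays for this shift, and the minimum with 1 covers W_0 = 1. *)
Lemma Wprod_inv_le : exists2 D : R, 0 <= D & forall n, (W n)^-1 <= D * n.+1%:R `^ (- alpha).
Proof.
have a0 : 0 < alpha by rewrite (lt_trans _ a2)// invr_gt0.
pose c := Num.min 1 (C * 2 `^ (- alpha)).
have c0 : 0 < c by rewrite lt_min ltr01 mulr_gt0// powR_gt0.
exists c^-1; first by rewrite invr_ge0 ltW.
move=> n; rewrite powRN -invfM lef_pV2 ?posrE ?mulr_gt0 ?powR_gt0 ?Wprod_gt0//.
case: n => [|n]; first by rewrite Wprod0 powR1 mulr1 ge_min lexx.
apply: le_trans (W_ge n); apply: (@le_trans _ _ (C * 2 `^ (- alpha) * n.+2%:R `^ alpha)).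
  by rewrite ler_wpM2r ?powR_ge0// ge_min lexx orbT.
rewrite -mulrA ler_wpM2l ?(ltW C0)// powRN ler_pdivrMl ?powR_gt0// -powRM//.
by rewrite ge0_ler_powR ?nnegrE ?(ltW a0) ?mulr_ge0// -natrM ler_nat; lia.
Qed.

Lemma weight_sum_cov_rate : exists2 K : R, 0 <= K & forall n N, (0 < n)%N ->
  \sum_(k < N) ((W k)^-1 * (W (n + k))^-1) <= K * cov_rate alpha n.
Proof.
have [D D0 hD] := Wprod_inv_le; have [K K0 hK] := sum_cov_rate alpha a2.
exists (D ^+ 2 * K); first by rewrite mulr_ge0 ?sqr_ge0.
move=> n N n0; rewrite -mulrA; apply: (@le_trans _ _ (D ^+ 2 *
    \sum_(k < N) (k.+1%:R `^ (- alpha) * (n + k).+1%:R `^ (- alpha)))); last first.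
  by rewrite ler_wpM2l ?sqr_ge0// hK.
rewrite mulr_sumr; apply: ler_sum => k _; rewrite expr2 mulrACA.
by apply: ler_pM; rewrite ?invr_ge0 ?(ltW (Wprod_gt0 _ _ _)).
Qed.

Lemma weight_sum_summable : 1 < alpha -> exists beta : nat -> R,
  (forall k N, \sum_(i < N) ((W i)^-1 * (W (k + i))^-1) <= beta k) /\ cvgn (series beta).
Proof.
move=> a1; have [D D0 hD] := Wprod_inv_le.
pose Z := 1 + (alpha - 1)^-1.
have Z0 : 0 <= Z by rewrite addr_ge0// invr_ge0 subr_ge0 ltW.
have DZ0 : 0 <= D ^+ 2 * Z by rewrite mulr_ge0 ?sqr_ge0.
exists (fun k => D ^+ 2 * Z * k.+1%:R `^ (- alpha)); split.
  move=> n N; rewrite -mulrA; apply: (@le_trans _ _ (D ^+ 2 *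
      \sum_(k < N) (k.+1%:R `^ (- alpha) * (n + k).+1%:R `^ (- alpha)))); last first.
    by rewrite ler_wpM2l ?sqr_ge0//; exact: sum_powR_shift_le.
  rewrite mulr_sumr; apply: ler_sum => k _; rewrite expr2 mulrACA.
  by apply: ler_pM; rewrite ?invr_ge0 ?(ltW (Wprod_gt0 _ _ _)).
apply: nondecreasing_is_cvgn.
  by apply: nondecreasing_series => k _ _; rewrite mulr_ge0 ?powR_ge0.
exists (D ^+ 2 * Z * Z) => _ [n _ <-]; rewrite /series/= big_mkord -mulr_sumr.
by rewrite ler_wpM2l//; exact: sum_powR_le.
Qed.

End weights_growth.

Theorem theorem2p4 (R : realType) (p : R) (p1 : 1 <= p) (omega : nat -> R)
  (w : nat -> R) :
  (forall k, 1 < omega k) -> omega @ \oo --> +oo ->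
  (forall n, 0 < w n.+1) -> (exists M : R, forall n, w n.+1 <= M) ->
  (\sum_(n <oo) ((\prod_(i < n.+1) w i.+1) `^ (- p))%:E < +oo)%E ->
  (exists mu : probability (lp_borel p1) R,
     (forall A, measurable A -> mu (Bw p1 w @^-1` A) = mu A) /\
     (forall U, lp_open p1 U -> U !=set0 -> (0 < mu U)%E) /\
     (forall A B, measurable A -> measurable B ->
        (fun n => mu (A `&` iter n (Bw p1 w) @^-1` B)) @ \oo
          --> (mu A * mu B)%E) /\
     (forall f, E_omega p1 omega f -> f \in Lfun mu 2%:E)) /\
  (forall C alpha : R, 0 < C -> 2^-1 < alpha ->
     (forall n, C * n.+1%:R `^ alpha <= \prod_(i < n.+1) w i.+1) ->
   exists mu : probability (lp_borel p1) R,
     ((forall A, measurable A -> mu (Bw p1 w @^-1` A) = mu A) /\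
      (forall U, lp_open p1 U -> U !=set0 -> (0 < mu U)%E) /\
      (forall A B, measurable A -> measurable B ->
         (fun n => mu (A `&` iter n (Bw p1 w) @^-1` B)) @ \oo
           --> (mu A * mu B)%E) /\
      (forall f, E_omega p1 omega f -> f \in Lfun mu 2%:E)) /\
     (forall f g, E_omega p1 omega f -> E_omega p1 omega g ->
        exists K : R, forall n : nat, (0 < n)%N ->
          (`|covariance mu (f \o iter n (Bw p1 w)) g|
             <= (K * cov_rate alpha n)%:E)%E) /\
     (1 < alpha -> forall f, E_omega p1 omega f ->
        (\int[mu]_x (f x)%:E = 0)%E ->
        exists s : R, 0 <= s /\
          forall phi : R -> R, continuous phi ->
            (exists M : R, forall y, `|phi y| <= M) ->
            (fun n : nat => (\int[mu]_x
               (phi ((\sum_(i < n) f (iter i (Bw p1 w) x)) / Num.sqrt n%:R))%:E)%E)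
              @ \oo --> (gauss_expect s phi)%:E)).
Proof.
move=> om1 _ w_gt0 w_bnd W_sum.
(* The smallest level that the integrability of exp(12 ||x||^p) asks for. It involves neither C nor
   alpha, so one measure serves both halves of the statement. *)
pose A := 12 * Wsum p w.
have A0 : 0 < A by rewrite mulr_gt0// (lt_le_trans ltr01)// Wsum_ge1.
have [mu mu_iid] := iid_law_exists p p1 w w_gt0 W_sum A A0.
have E2 f : E_omega p1 omega f -> exists2 K, explip p p1 K f & sq_int mu f.
  move=> /(E_omega_explip p p1 omega f om1)[K hK]; exists K => //.
  exact: (explip_sq_int p p1 w w_gt0 w_bnd W_sum A mu mu_iid (lexx _) K f hK).
have base : (forall A, measurable A -> mu (Bw p1 w @^-1` A) = mu A) /\
     (forall U, lp_open p1 U -> U !=set0 -> (0 < mu U)%E) /\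
     (forall A B, measurable A -> measurable B ->
        (fun n => mu (A `&` iter n (Bw p1 w) @^-1` B)) @ \oo
          --> (mu A * mu B)%E) /\
     (forall f, E_omega p1 omega f -> f \in Lfun mu 2%:E).
  split; first exact: (Bw_invariant p p1 w w_gt0 A mu mu_iid w_bnd).
  split; first exact: (full_support p p1 w w_gt0 A mu mu_iid).
  split; first exact: (iterBw_mixing p p1 w w_gt0 w_bnd A mu mu_iid).
  by move=> f /E2[K _ f2]; exact: sq_int_Lfun2.
split; first by exists mu.
move=> C alpha C0 a2 W_ge; exists mu; split; first exact: base.
have itsq n f : sq_int mu f -> sq_int mu (f \o iter n (Bw p1 w)).
  exact: (sq_int_comp mu mu _ (measurable_iterBw p p1 w w_gt0 w_bnd n)
    (iterBw_invariant p p1 w w_gt0 A mu mu_iid w_bnd n)).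
split.
  move=> f g /E2[K hf f2] /E2[K' hg g2].
  have [K1 K10 hK1] := weight_sum_cov_rate w C alpha w_gt0 C0 a2 W_ge.
  exists (12 * expZ_moment p p1 mu * K * K' * K1) => n n0.
  rewrite (covariance_Ex mu _ _ (itsq n f f2) g2) abse_EFin lee_fin.
  rewrite (_ : Ex mu (f \o iter n (Bw p1 w)) = Ex mu f); last first.
    exact: (Ex_iter p p1 w w_gt0 w_bnd A mu mu_iid n f (sq_int_rint _ _ f2)).
  rewrite -[leRHS]mulrA.
  exact: (covariance_bound p p1 w w_gt0 w_bnd W_sum A mu mu_iid (lexx _) f g K K' n hf hg _
    (fun N => hK1 n N n0)).
move=> a1 f /E2[K hf f2] If0.
have Ef : Ex mu f = 0 by rewrite /Ex /Rintegral If0.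
have [beta [betaP cb]] := weight_sum_summable w C alpha w_gt0 C0 a2 W_ge a1.
have [s [s0 hs]] := explip_clt p p1 w w_gt0 w_bnd W_sum A mu mu_iid (lexx _) beta betaP cb f K hf Ef.
exists s; split=> // phi cphi [M phiM].
have mphi : measurable_fun (setT : set (measurableTypeR R)) (phi : measurableTypeR R -> measurableTypeR R).
  exact: continuous_measurable_fun.
have iphi n : rint mu (fun x => phi ((\sum_(i < n) f (iter i (Bw p1 w) x)) / Num.sqrt n%:R)).
  apply: (rint_bounded mu _ M) => [|x]; last exact: phiM.
  apply: (measurableT_comp mphi); apply: measurable_funM => //.
  by apply: measurable_sum => i; exact: (itsq i f f2).1.
under eq_fun => n do rewrite -(Ex_EFin _ _ (iphi n)).
apply: cvg_EFin; first exact: nearW.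
exact: (hs phi cphi (ex_intro _ M phiM)).
Qed.
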